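(* Let $\xi_0\in\mathbb R$, $w\in\mathbb C$, and for $i=0,1$ let $$a_i=a_{i-}H(\xi_0-x)+a_{i+}H(x-\xi_0)+\sum_{j=0}^1A_{ij}\delta^{(j)}_{\xi_0},\qquad b_i=b_{i-}H(\xi_0-x)+b_{i+}H(x-\xi_0)+\sum_{j=0}^3B_{ij}\delta^{(j)}_{\xi_0},$$ where $a_{i\pm},b_{i\pm}\in\mathcal C^\infty(\mathbb R)$ and $A_{ij},B_{ij}\in\mathbb C$. Set $a=a_{0-}+a_{1+}$, $a_\pm=a_{0\pm}+a_{1\pm}$, and assume $a(\xi_0)\neq0$ and $a_\pm(x)\neq0$ for all $x\in\mathbb R$. Let $$\mathbf A=\begin{pmatrix}B_{10}w^2&-B_{11}w^2&a_-'+B_{12}w^2&a_--B_{13}w^2\\ B_{11}w^2&-2B_{12}w^2&a_-+3B_{13}w^2&0\\ -a'+B_{12}w^2&a-3B_{13}w^2&-A_{10}&A_{11}\\ a+B_{13}w^2&0&-A_{11}&0\end{pmatrix},$$ $$\mathbf B=\begin{pmatrix}-B_{00}w^2&B_{01}w^2&a_+'-B_{02}w^2&a_++B_{03}w^2\\ -B_{01}w^2&2B_{02}w^2&a_+-3B_{03}w^2&0\\ -a'-B_{02}w^2&a+3B_{03}w^2&A_{00}&-A_{01}\\ a-B_{03}w^2&0&A_{01}&0\end{pmatrix}.$$ Consider the ODE $$\sum_{i=0}^{2}\binom{2}{i}\left(a_0^{(i)}*\phi^{(4-i)}+\phi^{(4-i)}*a_1^{(i)}\right)-w^2\left(b_0*\phi+\phi*b_1\right)=0$$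 with boundary conditions $\overline{\phi(x_0)}=\overline C$, where $\overline\phi=(\phi,\phi',\phi'',\phi''')^T$ and $\overline C\in\mathbb C^4$ is arbitrary. If $x_0<\xi_0$, then the solution of this boundary value problem exists and is unique if and only if $\det\mathbf B(\xi_0)\neq0$. If $x_0>\xi_0$, then the solution of this boundary value problem exists and is unique if and only if $\det\mathbf A(\xi_0)\neq0$.
   Context: All functions and distributions are complex valued and all derivatives are distributional. $\mathcal D'$ is the space of Schwartz distributions on $\mathbb R$; locally integrable functions are identified with the associated regular distributions. $H$ is the Heaviside step function and $\delta_{x_0}$ the Dirac measure at $x_0$. $\mathcal C_p^\infty$ is the space of functions on $\mathbb R$ that are smooth except on a finite set of points, where they and all their derivatives have finite left and right limits. $\mathcal A\subset\mathcal D'$ is the space of all functions in $\mathcal C_p^\infty$, regarded as distributions, together with all their distributional derivatives of all orders. Equivalently, $F\in\mathcal A$ iff there are points $x_1<\dots<x_m$ such that, with $x_0=-\infty$, $x_{m+1}=+\infty$, $\Omega_i=(x_i,x_{i+1})$ and $\chi_{\Omega_i}$ the characteristic function of $\Omega_i$, $F=\sum_{i=1}^m\sum_{j=0}^n c_{ij}\delta^{(j)}_{x_i}+\sum_{i=0}^m f_i\chi_{\Omega_i}$ with $c_{ij}\in\mathbb C$ and $f_i\in\mathcal C^\infty(\mathbb R)$. Product $*$: for $F,G\in\mathcal A$, $F*G=\lim_{\epsilon\downarrow0}F(x)\cdot G(x+\epsilon)$ in the distributional sense, where for small $\epsilon>0$ the two factors have disjoint singular supports and $\cdot$ is the Hörmander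 product (locally, the product of a distribution by a smooth function). Explicitly, if $F=\sum_{i=1}^m\sum_{j=0}^n c_{ij}\delta^{(j)}_{x_i}+\sum_{i=0}^m f_i\chi_{\Omega_i}$ and $G=\sum_{i=1}^m\sum_{j=0}^n d_{ij}\delta^{(j)}_{x_i}+\sum_{i=0}^m g_i\chi_{\Omega_i}$ (same points for both, $f_i,g_i\in\mathcal C^\infty(\mathbb R)$), then $$F*G=\sum_{i=1}^m\sum_{j=0}^n\left[c_{ij}g_i+d_{ij}f_{i-1}\right]\delta^{(j)}_{x_i}+\sum_{i=0}^m f_ig_i\chi_{\Omega_i}\in\mathcal A .$$ A solution of the ODE is a $\phi\in\mathcal A$ satisfying it in the sense of distributions on $\mathbb R$. It satisfies the boundary conditions $\overline{\phi(x_0)}=\overline C=(C_1,\dots,C_4)^T$ at $x_0\neq\xi_0$ iff there are an open interval $\Omega\ni x_0$ and $\varphi\in\mathcal C^\infty(\mathbb R)$ such that $\phi=\varphi$ on $\Omega$ (as distributions) and $\varphi^{(i)}(x_0)=C_{i+1}$ for $i=0,\dots,3$. A solution of the boundary value problem is a solution of the ODE that satisfies the boundary conditions; uniqueness is within $\mathcal A$. *)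

(* Defs.v *)
From Stdlib Require Import Reals Lra Lia List ClassicalEpsilon.
From Stdlib Require Import FunctionalExtensionality ProofIrrelevance.
From Coquelicot Require Import Coquelicot.

Open Scope R_scope.

Definition rsmooth (f : R -> R) : Prop := forall n x, ex_derive_n f n x.

Lemma Derive_n_S (f : R -> R) n x : Derive_n f (S n) x = Derive_n (Derive f) n x.
Proof.
  replace (S n) with (n + 1)%nat by lia.
  now rewrite <- (Derive_n_comp f n 1).
Qed.

Lemma ex_derive_n_Derive (f : R -> R) n x :
  ex_derive_n f (S n) x -> ex_derive_n (Derive f) n x.
Proof.
  destruct n as [|n]; [easy|simpl; intros H].
  apply (ex_derive_ext (Derive (Derive_n f n))); [|exact H].
  intros t. exact (Derive_n_S f n t).
Qed.

Lemma ex_derive_n_S (f : R -> R) n x :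
  (forall y, ex_derive f y) -> ex_derive_n (Derive f) n x -> ex_derive_n f (S n) x.
Proof.
  destruct n as [|n]; simpl; [intros H _; apply H|intros _ H].
  apply (ex_derive_ext (Derive_n (Derive f) n)); [|exact H].
  intros t. symmetry. exact (Derive_n_S f n t).
Qed.

Lemma rsmooth_ex_derive f : rsmooth f -> forall x, ex_derive f x.
Proof. intros H x. exact (H 1%nat x). Qed.

Lemma rsmooth_Derive f : rsmooth f -> rsmooth (Derive f).
Proof. intros H n x. apply ex_derive_n_Derive, H. Qed.

Lemma rsmooth_continuous f : rsmooth f -> forall x, continuous f x.
Proof. intros H x. now apply (@ex_derive_continuous _ _ f), rsmooth_ex_derive. Qed.

Lemma rsmooth_plus f g : rsmooth f -> rsmooth g -> rsmooth (fun x => f x + g x).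
Proof. intros Hf Hg n x. apply ex_derive_n_plus; now apply filter_forall. Qed.

Lemma rsmooth_opp f : rsmooth f -> rsmooth (fun x => - f x).
Proof. intros Hf n x. now apply ex_derive_n_opp. Qed.

Lemma rsmooth_minus f g : rsmooth f -> rsmooth g -> rsmooth (fun x => f x - g x).
Proof. intros Hf Hg. exact (rsmooth_plus _ _ Hf (rsmooth_opp _ Hg)). Qed.

Lemma rsmooth_const c : rsmooth (fun _ => c).
Proof.
  intros n x. destruct n as [|n]; [easy|]. apply ex_derive_n_S.
  - intros y. apply @ex_derive_const.
  - apply (ex_derive_n_ext (fun _ => 0)).
    + intros t. now rewrite Derive_const.
    + apply ex_derive_n_const.
Qed.

Lemma rsmooth_mult f g : rsmooth f -> rsmooth g -> rsmooth (fun x => f x * g x).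
Proof.
  intros Hf Hg n.
  assert (H : forall m f g, rsmooth f -> rsmooth g -> forall k (x : R), (k <= m)%nat ->
            ex_derive_n (fun x => f x * g x) k x);
    [|intros x; exact (H n f g Hf Hg n x (le_n n))].
  clear. induction m as [|m IH]; intros f g Hf Hg k x Hk.
  - now replace k with 0%nat by lia.
  - destruct k as [|k]; [easy|]. apply ex_derive_n_S.
    + intros y. apply @ex_derive_mult; now apply rsmooth_ex_derive.
    + apply (ex_derive_n_ext (fun y => Derive f y * g y + f y * Derive g y)).
      * intros t. rewrite Derive_mult; trivial; now apply rsmooth_ex_derive.
      * apply ex_derive_n_plus; apply filter_forall; intros y j Hj;
          apply IH; trivial; try lia; now apply rsmooth_Derive.
Qed.

Lemma rsmooth_shift f h : rsmooth f -> rsmooth (fun x => f (x + h)).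
Proof. intros Hf n x. now apply ex_derive_n_comp_trans. Qed.

Definition ex_Cderive_n (f : R -> C) (n : nat) (x : R) : Prop :=
  ex_derive_n (fun t => Re (f t)) n x /\ ex_derive_n (fun t => Im (f t)) n x.

Definition Cderive_n (f : R -> C) (n : nat) (x : R) : C :=
  (Derive_n (fun t => Re (f t)) n x, Derive_n (fun t => Im (f t)) n x).

Definition is_smooth (f : R -> C) : Prop := forall n x, ex_Cderive_n f n x.

Lemma is_smooth_comp f :
  rsmooth (fun t => Re (f t)) -> rsmooth (fun t => Im (f t)) -> is_smooth f.
Proof. intros H1 H2 n x. split; auto. Qed.

Lemma is_smooth_Re f : is_smooth f -> rsmooth (fun t => Re (f t)).
Proof. intros H n x. apply H. Qed.

Lemma is_smooth_Im f : is_smooth f -> rsmooth (fun t => Im (f t)).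
Proof. intros H n x. apply H. Qed.

Lemma is_smooth_plus f g :
  is_smooth f -> is_smooth g -> is_smooth (fun x => f x + g x)%C.
Proof.
  intros Hf Hg. apply is_smooth_comp; simpl;
    apply rsmooth_plus; auto using is_smooth_Re, is_smooth_Im.
Qed.

Lemma is_smooth_mult f g :
  is_smooth f -> is_smooth g -> is_smooth (fun x => f x * g x)%C.
Proof.
  intros Hf Hg. apply is_smooth_comp; simpl;
    [apply rsmooth_minus|apply rsmooth_plus]; apply rsmooth_mult;
      auto using is_smooth_Re, is_smooth_Im.
Qed.

Lemma is_smooth_const c : is_smooth (fun _ => c).
Proof. apply is_smooth_comp; apply rsmooth_const. Qed.

Lemma is_smooth_shift f h : is_smooth f -> is_smooth (fun x => f (x + h)).
Proof.
  intros Hf. apply is_smooth_comp.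
  - exact (rsmooth_shift _ h (is_smooth_Re f Hf)).
  - exact (rsmooth_shift _ h (is_smooth_Im f Hf)).
Qed.

Lemma is_smooth_Cderive f : is_smooth f -> is_smooth (Cderive_n f 1).
Proof.
  intros Hf. apply is_smooth_comp.
  - exact (rsmooth_Derive _ (is_smooth_Re f Hf)).
  - exact (rsmooth_Derive _ (is_smooth_Im f Hf)).
Qed.

Lemma Ccontinuous_comp (f : R -> C) x :
  continuous (fun t => Re (f t)) x -> continuous (fun t => Im (f t)) x ->
  continuous f x.
Proof.
  intros H1 H2.
  apply (continuous_ext (fun t => (Re (f t), Im (f t)))).
  - intros t. now destruct (f t).
  - intros P [eps HP].
    specialize (H1 _ (locally_ball (T := R_UniformSpace) _ eps)).
    specialize (H2 _ (locally_ball (T := R_UniformSpace) _ eps)).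
    unfold filtermap in *.
    generalize (filter_and _ _ H1 H2). apply filter_imp.
    intros y [Hy1 Hy2]. apply HP. now split.
Qed.

Lemma is_smooth_continuous f : is_smooth f -> forall x, continuous f x.
Proof.
  intros H x. apply Ccontinuous_comp;
    [apply (rsmooth_continuous _ (is_smooth_Re f H))
    |apply (rsmooth_continuous _ (is_smooth_Im f H))].
Qed.

Record smooth := Smooth { smooth_fun :> R -> C; smoothP : is_smooth smooth_fun }.

Definition compact_support (f : R -> C) : Prop :=
  exists M, forall x, M < Rabs x -> f x = 0%C.

Record test := Test {
  test_fun :> R -> C;
  test_smooth : is_smooth test_fun;
  test_compact : compact_support test_fun }.

Lemma test_ext (t u : test) : (forall x, t x = u x) -> t = u.
Proof.
  destruct t as [t Ht Kt], u as [u Hu Ku]. simpl. intros E.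
  apply functional_extensionality in E. subst u.
  now rewrite (proof_irrelevance _ Ht Hu), (proof_irrelevance _ Kt Ku).
Qed.

Definition tadd (t u : test) : test.
Proof.
  refine (Test (fun x => t x + u x)%C (is_smooth_plus _ _ (test_smooth t) (test_smooth u)) _).
  destruct (test_compact t) as [M HM], (test_compact u) as [N HN].
  exists (Rmax M N). intros x Hx. rewrite HM, HN.
  - now rewrite Cplus_0_l.
  - apply Rle_lt_trans with (2 := Hx), Rmax_r.
  - apply Rle_lt_trans with (2 := Hx), Rmax_l.
Defined.

Definition tmul (f : smooth) (t : test) : test.
Proof.
  refine (Test (fun x => f x * t x)%C (is_smooth_mult _ _ (smoothP f) (test_smooth t)) _).
  destruct (test_compact t) as [M HM].
  exists M. intros x Hx. rewrite HM; trivial. apply Cmult_0_r.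
Defined.

Definition csmooth (c : C) : smooth := Smooth (fun _ => c) (is_smooth_const c).

Definition tscal (c : C) (t : test) : test := tmul (csmooth c) t.

(** [(tshift h t) x = t (x - h)] *)
Definition tshift (h : R) (t : test) : test.
Proof.
  refine (Test (fun x => t (x - h)) (is_smooth_shift _ (- h) (test_smooth t)) _).
  destruct (test_compact t) as [M HM].
  exists (M + Rabs h). intros x Hx. apply HM.
  assert (H := Rabs_triang (x - h) h).
  replace (x - h + h) with x in H by ring. lra.
Defined.

Lemma Derive_n_compact (f : R -> R) M n :
  (forall x, M < Rabs x -> f x = 0) -> forall x, M < Rabs x -> Derive_n f n x = 0.
Proof.
  intros H x Hx.
  rewrite (Derive_n_ext_loc f (fun _ => 0)).
  - destruct n as [|n]; [easy|]. apply Derive_n_const.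
  - assert (Hp : 0 < Rabs x - M) by lra. exists (mkposreal _ Hp). intros y Hy. apply H.
    change (Rabs (y - x) < Rabs x - M) in Hy.
    assert (T := Rabs_triang_inv x y). rewrite Rabs_minus_sym in T. lra.
Qed.

Lemma Cderive_n_compact (f : R -> C) M n :
  (forall x, M < Rabs x -> f x = 0%C) ->
  forall x, M < Rabs x -> Cderive_n f n x = 0%C.
Proof.
  intros H x Hx. unfold Cderive_n.
  rewrite (Derive_n_compact (fun t => Re (f t)) M),
    (Derive_n_compact (fun t => Im (f t)) M); trivial; intros y Hy; now rewrite H.
Qed.

Definition tderiv (t : test) : test.
Proof.
  refine (Test (Cderive_n t 1) (is_smooth_Cderive _ (test_smooth t)) _).
  destruct (test_compact t) as [M HM].
  exists M. now apply Cderive_n_compact.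
Defined.

(** [t k -> 0] in the space of test functions. *)
Definition test_cvg0 (t : nat -> test) : Prop :=
  (exists M, forall k x, M < Rabs x -> t k x = 0%C) /\
  (forall n eps, 0 < eps ->
     exists N, forall k, (N <= k)%nat -> forall x, Cmod (Cderive_n (t k) n x) < eps).

Definition Ccvg0 (u : nat -> C) : Prop :=
  filterlim u eventually (@locally C_UniformSpace (RtoC 0)).

(** For linear functionals on test functions, sequential continuity at [0] is
    the same as continuity. *)
Record distr := Distr {
  distr_fun :> test -> C;
  distr_add : forall t u, distr_fun (tadd t u) = (distr_fun t + distr_fun u)%C;
  distr_scal : forall c t, distr_fun (tscal c t) = (c * distr_fun t)%C;
  distr_cont : forall t, test_cvg0 t -> Ccvg0 (fun k => distr_fun (t k)) }.

Lemma distr_ext (S T : distr) : (forall t, S t = T t) -> S = T.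
Proof.
  destruct S as [S S1 S2 S3], T as [T T1 T2 T3]. simpl. intros E.
  apply functional_extensionality in E. subst T.
  now rewrite (proof_irrelevance _ S1 T1), (proof_irrelevance _ S2 T2),
    (proof_irrelevance _ S3 T3).
Qed.

Lemma Ccvg0_eps (u : nat -> C) :
  Ccvg0 u <-> forall eps, 0 < eps -> exists N, forall k, (N <= k)%nat -> Cmod (u k) < eps.
Proof.
  unfold Ccvg0. split.
  - intros H eps Heps.
    assert (Hp : 0 < eps / sqrt 2).
    { apply Rdiv_lt_0_compat; [easy|]. apply sqrt_lt_R0. lra. }
    destruct (proj1 (filterlim_locally _ _) H (mkposreal _ Hp)) as [N HN].
    exists N. intros k Hk. specialize (HN k Hk).
    destruct HN as [H1 H2]. simpl in H1, H2.
    change (Rabs (fst (u k) - 0) < eps / sqrt 2) in H1.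
    change (Rabs (snd (u k) - 0) < eps / sqrt 2) in H2.
    rewrite Rminus_0_r in H1, H2.
    apply Rle_lt_trans with (1 := Cmod_2Rmax (u k)).
    apply Rlt_le_trans with (sqrt 2 * (eps / sqrt 2)).
    + apply Rmult_lt_compat_l; [apply sqrt_lt_R0; lra|].
      now apply Rmax_lub_lt.
    + right. field. apply Rgt_not_eq, sqrt_lt_R0. lra.
  - intros H. apply filterlim_locally. intros eps.
    destruct (H eps (cond_pos eps)) as [N HN].
    exists N. intros k Hk. specialize (HN k Hk).
    assert (A := Rmax_Cmod (u k)).
    split.
    + change (Rabs (fst (u k) - 0) < eps). rewrite Rminus_0_r.
      apply Rle_lt_trans with (2 := HN), Rle_trans with (2 := A), Rmax_l.
    + change (Rabs (snd (u k) - 0) < eps). rewrite Rminus_0_r.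
      apply Rle_lt_trans with (2 := HN), Rle_trans with (2 := A), Rmax_r.
Qed.

Definition dzero : distr.
Proof.
  refine (Distr (fun _ => 0%C) _ _ _).
  - intros t u. now rewrite Cplus_0_l.
  - intros c t. now rewrite Cmult_0_r.
  - intros t _. apply Ccvg0_eps. intros eps Heps. exists 0%nat.
    intros k _. now rewrite Cmod_0.
Defined.

Definition dadd (S T : distr) : distr.
Proof.
  refine (Distr (fun t => S t + T t)%C _ _ _).
  - intros t u. rewrite !distr_add. ring.
  - intros c t. rewrite !distr_scal. ring.
  - intros t Ht. apply Ccvg0_eps. intros eps Heps.
    assert (Hp : 0 < eps / 2) by lra.
    destruct (proj1 (Ccvg0_eps _) (distr_cont S t Ht) _ Hp) as [N HN].
    destruct (proj1 (Ccvg0_eps _) (distr_cont T t Ht) _ Hp) as [P HP].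
    exists (N + P)%nat. intros k Hk.
    apply Rle_lt_trans with (1 := Cmod_triangle _ _).
    specialize (HN k ltac:(lia)). specialize (HP k ltac:(lia)). lra.
Defined.

Definition dscal (c : C) (T : distr) : distr.
Proof.
  refine (Distr (fun t => c * T t)%C _ _ _).
  - intros t u. rewrite !distr_add. ring.
  - intros d t. rewrite !distr_scal. ring.
  - intros t Ht. apply Ccvg0_eps. intros eps Heps.
    assert (Hc : 0 < Cmod c + 1) by (assert (H := Cmod_ge_0 c); lra).
    assert (Hp : 0 < eps / (Cmod c + 1)) by now apply Rdiv_lt_0_compat.
    destruct (proj1 (Ccvg0_eps _) (distr_cont T t Ht) _ Hp) as [N HN].
    exists N. intros k Hk. specialize (HN k Hk). rewrite Cmod_mult.
    apply Rle_lt_trans with ((Cmod c + 1) * Cmod (T (t k))).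
    + apply Rmult_le_compat_r; [apply Cmod_ge_0|lra].
    + apply Rlt_le_trans with ((Cmod c + 1) * (eps / (Cmod c + 1))).
      * now apply Rmult_lt_compat_l.
      * right. field. lra.
Defined.

(** [dsum T n = T 0 + ... + T n] *)
Fixpoint dsum (T : nat -> distr) (n : nat) : distr :=
  match n with O => T O | S m => dadd (dsum T m) (T (S m)) end.

Lemma Cderive_n_S (f : R -> C) n x :
  Cderive_n (Cderive_n f 1) n x = Cderive_n f (S n) x.
Proof. unfold Cderive_n. now rewrite !Derive_n_S. Qed.

Lemma Cderive_n_plus (f g : R -> C) n x : is_smooth f -> is_smooth g ->
  Cderive_n (fun y => f y + g y)%C n x = (Cderive_n f n x + Cderive_n g n x)%C.
Proof.
  intros Hf Hg. unfold Cderive_n. simpl.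
  unfold Cplus; simpl; f_equal; apply Derive_n_plus; apply filter_forall;
    intros y k _; solve [apply Hf|apply Hg].
Qed.

Lemma Cderive_1_mult (f g : R -> C) x : is_smooth f -> is_smooth g ->
  Cderive_n (fun y => f y * g y)%C 1 x
  = (Cderive_n f 1 x * g x + f x * Cderive_n g 1 x)%C.
Proof.
  intros Hf Hg.
  assert (f1 := rsmooth_ex_derive _ (is_smooth_Re f Hf) x).
  assert (f2 := rsmooth_ex_derive _ (is_smooth_Im f Hf) x).
  assert (g1 := rsmooth_ex_derive _ (is_smooth_Re g Hg) x).
  assert (g2 := rsmooth_ex_derive _ (is_smooth_Im g Hg) x).
  unfold Cderive_n, Cplus, Cmult. simpl.
  change (fun t : R => fst (f t)) with (fun t : R => Re (f t)).
  change (fun t : R => snd (f t)) with (fun t : R => Im (f t)).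
  f_equal; (rewrite Derive_minus || rewrite Derive_plus);
    try (apply @ex_derive_mult; assumption);
    rewrite !Derive_mult by assumption; unfold Re, Im; ring.
Qed.

Lemma Cderive_n_ext (f g : R -> C) n x :
  (forall y, f y = g y) -> Cderive_n f n x = Cderive_n g n x.
Proof.
  intros E. unfold Cderive_n. f_equal; apply Derive_n_ext; intros t; now rewrite E.
Qed.

Lemma test_cvg0_deriv (t : nat -> test) :
  test_cvg0 t -> test_cvg0 (fun k => tderiv (t k)).
Proof.
  intros [[M HM] Ht]. split.
  - exists M. intros k. exact (Cderive_n_compact (t k) M 1 (HM k)).
  - intros n e He. destruct (Ht (S n) e He) as [N HN]. exists N.
    intros k Hk x. simpl. rewrite Cderive_n_S. now apply HN.
Qed.

Definition dderiv (T : distr) : distr.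
Proof.
  refine (Distr (fun t => - T (tderiv t))%C _ _ _).
  - intros t u. transitivity (- (T (tderiv t) + T (tderiv u)))%C; [|ring].
    rewrite <- distr_add. do 2 f_equal. apply test_ext. intros x. apply Cderive_n_plus; apply test_smooth.
  - intros c t. transitivity (- (c * T (tderiv t)))%C; [|ring].
    rewrite <- distr_scal. do 2 f_equal. apply test_ext. intros x.
    refine (eq_trans (Cderive_1_mult (fun _ => c) t x (is_smooth_const c) (test_smooth t)) _).
    unfold Cderive_n at 1. simpl. rewrite !Derive_const. simpl.
    change (RtoC 0 * t x + c * Cderive_n t 1 x = c * Cderive_n t 1 x)%C. ring.
  - intros t Ht. apply Ccvg0_eps. intros eps Heps.
    destruct (proj1 (Ccvg0_eps _) (distr_cont T _ (test_cvg0_deriv t Ht)) eps Heps) as [N HN].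
    exists N. intros k Hk. rewrite Cmod_opp. now apply HN.
Defined.

Definition dderiv_n (n : nat) (T : distr) : distr := Nat.iter n dderiv T.

Lemma Cderive_n_0 (f : R -> C) x : Cderive_n f 0 x = f x.
Proof. unfold Cderive_n. simpl. now destruct (f x). Qed.

Lemma smooth_bounded (f : R -> C) M : is_smooth f ->
  exists B, 0 < B /\ forall x, Rabs x <= M -> Cmod (f x) <= B.
Proof.
  intros Hf.
  destruct (@ex_RInt_ub C_R_NormedModule f (- M) M) as [B HB].
  - apply (@ex_RInt_continuous C_R_CompleteNormedModule). intros z _. now apply is_smooth_continuous.
  - exists (Rabs B + 1). split; [assert (H := Rabs_pos B); lra|].
    intros x Hx. apply Rabs_le_between in Hx.
    apply Rle_trans with B; [|assert (H := Rle_abs B); lra].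
    rewrite Cmod_norm. apply (HB x).
    rewrite Rmin_left, Rmax_right; lra.
Qed.

Lemma test_cvg0_mul (t : nat -> test) : test_cvg0 t ->
  forall f : smooth, test_cvg0 (fun k => tmul f (t k)).
Proof.
  intros Ht f. split.
  - destruct Ht as [[M HM] _]. exists M. intros k x Hx. simpl. rewrite HM by easy. ring.
  - intros n. revert t Ht f. induction n as [|n IH]; intros t Ht f eps Heps.
    + destruct Ht as [[M HM] Ht].
      destruct (smooth_bounded f M (smoothP f)) as [B [HB0 HB]].
      destruct (Ht 0%nat (eps / B)) as [N HN]; [now apply Rdiv_lt_0_compat|].
      exists N. intros k Hk x. specialize (HN k Hk x).
      rewrite Cderive_n_0 in *. simpl.
      destruct (Rle_lt_dec (Rabs x) M) as [Hx|Hx].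
      * rewrite Cmod_mult. apply Rle_lt_trans with (B * Cmod (t k x)).
        -- apply Rmult_le_compat_r; [apply Cmod_ge_0|auto].
        -- apply Rlt_le_trans with (B * (eps / B)); [now apply Rmult_lt_compat_l|].
           right. field. lra.
      * now rewrite HM, Cmult_0_r, Cmod_0.
    + assert (Hp : 0 < eps / 2) by lra.
      destruct (IH t Ht (Smooth _ (is_smooth_Cderive f (smoothP f))) _ Hp) as [N HN].
      destruct (IH _ (test_cvg0_deriv t Ht) f _ Hp) as [P HP].
      exists (N + P)%nat. intros k Hk x.
      specialize (HN k ltac:(lia) x). specialize (HP k ltac:(lia) x).
      rewrite <- Cderive_n_S. simpl.
      rewrite (Cderive_n_ext _ (fun y => Cderive_n f 1 y * t k y
        + f y * Cderive_n (t k) 1 y)%C)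
        by (intros y; apply Cderive_1_mult; [apply smoothP|apply test_smooth]).
      rewrite Cderive_n_plus.
      * apply Rle_lt_trans with (1 := Cmod_triangle _ _).
        simpl in HN, HP. lra.
      * apply is_smooth_mult; [apply is_smooth_Cderive, smoothP|apply test_smooth].
      * apply is_smooth_mult; [apply smoothP|apply is_smooth_Cderive, test_smooth].
Qed.

Definition dmul (f : smooth) (T : distr) : distr.
Proof.
  refine (Distr (fun t => T (tmul f t)) _ _ _).
  - intros t u. rewrite <- distr_add. f_equal. apply test_ext. intros x. simpl. ring.
  - intros c t. rewrite <- distr_scal. f_equal. apply test_ext. intros x. simpl. ring.
  - intros t Ht. apply (distr_cont T (fun k => tmul f (t k))). now apply test_cvg0_mul.
Defined.

Lemma Cderive_n_shift (f : R -> C) h n x :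
  Cderive_n (fun y => f (y - h)) n x = Cderive_n f n (x - h).
Proof.
  unfold Cderive_n. f_equal.
  - apply (Derive_n_comp_trans (fun y => Re (f y)) n x (- h)).
  - apply (Derive_n_comp_trans (fun y => Im (f y)) n x (- h)).
Qed.

(** The translate [T(x + h)]. *)
Definition dshift (h : R) (T : distr) : distr.
Proof.
  refine (Distr (fun t => T (tshift h t)) _ _ _).
  - intros t u. rewrite <- distr_add. f_equal. now apply test_ext.
  - intros c t. rewrite <- distr_scal. f_equal. now apply test_ext.
  - intros t Ht. apply (distr_cont T (fun k => tshift h (t k))).
    destruct Ht as [[M HM] Ht]. split.
    + exists (M + Rabs h). intros k x Hx. simpl. apply HM.
      assert (H := Rabs_triang (x - h) h).
      replace (x - h + h) with x in H by ring. lra.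
    + intros n e He. destruct (Ht n e He) as [N HN]. exists N. intros k Hk x.
      simpl. rewrite Cderive_n_shift. now apply HN.
Defined.

Definition ddelta (x0 : R) : distr.
Proof.
  refine (Distr (fun t => t x0) _ _ _); [easy|easy|].
  intros t [_ Ht]. apply Ccvg0_eps. intros eps Heps.
  destruct (Ht 0%nat eps Heps) as [N HN]. exists N. intros k Hk.
  specialize (HN k Hk x0). now rewrite Cderive_n_0 in HN.
Defined.

(** [C_p^oo]; the values of [f] at the exceptional points are irrelevant. *)
Definition is_pwsmooth (f : R -> C) : Prop :=
  exists l : list R,
    (forall x, ~ In x l -> forall n, ex_Cderive_n f n x) /\
    (forall x, In x l -> forall n,
       (exists L, filterlim (Cderive_n f n) (at_left x) (@locally C_UniformSpace L)) /\
       (exists L, filterlim (Cderive_n f n) (at_right x) (@locally C_UniformSpace L))).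

Record pwsmooth := Pwsmooth { pw_fun :> R -> C; pwP : is_pwsmooth pw_fun }.

Definition pw_of_smooth (f : smooth) : pwsmooth.
Proof.
  refine (Pwsmooth f _). exists nil. split; [|easy].
  intros x _ n. apply smoothP.
Defined.

Lemma at_left_locally x (P : R -> Prop) : locally x P -> at_left x P.
Proof. unfold at_left, at_right, within. apply filter_imp. auto. Qed.

Lemma at_right_locally x (P : R -> Prop) : locally x P -> at_right x P.
Proof. unfold at_left, at_right, within. apply filter_imp. auto. Qed.

Definition lims_at (f : R -> C) (x : R) : Prop :=
  (exists L, filterlim f (at_left x) (@locally C_UniformSpace L)) /\
  (exists L, filterlim f (at_right x) (@locally C_UniformSpace L)).

Lemma continuous_lims_at (f : R -> C) x : continuous f x -> lims_at f x.
Proof.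
  intros H. split; exists (f x); intros P HP.
  - apply at_left_locally. now apply H.
  - apply at_right_locally. now apply H.
Qed.

Lemma pw_continuous (f : R -> C) x : ex_Cderive_n f 1 x -> continuous f x.
Proof.
  intros [H1 H2]. apply Ccontinuous_comp; now apply @ex_derive_continuous.
Qed.

Lemma pw_spec (f : R -> C) : is_pwsmooth f ->
  (exists l, forall x, ~ In x l -> continuous f x) /\ (forall x, lims_at f x).
Proof.
  intros [l [H1 H2]]. split.
  - exists l. intros x Hx. now apply pw_continuous, H1.
  - intros x. destruct (in_dec Req_EM_T x l) as [Hx|Hx].
    + destruct (H2 x Hx 0%nat) as [[L HL] [L' HL']]. split; [exists L|exists L'].
      * apply filterlim_ext with (2 := HL). intros y. apply Cderive_n_0.
      * apply filterlim_ext with (2 := HL'). intros y. apply Cderive_n_0.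
    + now apply continuous_lims_at, pw_continuous, H1.
Qed.

Lemma pw_ex_RInt l : forall (f : R -> C) a b, a <= b ->
  (forall x, a < x < b -> ~ In x l -> continuous f x) -> (forall x, lims_at f x) ->
  @ex_RInt C_R_NormedModule f a b.
Proof.
  induction l as [|p l IH]; intros f a b Hab Hc Hl.
  - destruct Hab as [Hab|Hab].
    + destruct (Hl a) as [_ [La HLa]]. destruct (Hl b) as [[Lb HLb] _].
      destruct (@C0_extension_lt C_UniformSpace f La Lb a b Hab) as [g [Hg [Eg _]]];
        trivial.
      * intros c Hc'. now apply Hc.
      * apply ex_RInt_ext with g.
        -- intros x. rewrite Rmin_left, Rmax_right by lra. apply Eg.
        -- apply (@ex_RInt_continuous C_R_CompleteNormedModule). intros z _. apply Hg.
    + subst b. apply ex_RInt_point.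
  - destruct (Rle_lt_dec p a) as [Hp|Hp]; [|destruct (Rle_lt_dec b p) as [Hp'|Hp']].
    + apply IH; trivial. intros x Hx Hin. apply Hc; trivial.
      intros [->|Hx']; [lra|auto].
    + apply IH; trivial. intros x Hx Hin. apply Hc; trivial.
      intros [->|Hx']; [lra|auto].
    + apply ex_RInt_Chasles with p; apply IH; trivial; try lra;
        intros x Hx Hin; apply Hc; try lra; intros [->|Hx']; [lra|auto|lra|auto].
Qed.

Lemma Cfilterlim_pair (F : (R -> Prop) -> Prop) {FF : Filter F} (f : R -> C) (L : C) :
  filterlim (fun t => fst (f t)) F (locally (fst L)) ->
  filterlim (fun t => snd (f t)) F (locally (snd L)) ->
  filterlim f F (@locally C_UniformSpace L).
Proof.
  intros H1 H2 P [eps HP].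
  specialize (H1 _ (locally_ball (T := R_UniformSpace) _ eps)).
  specialize (H2 _ (locally_ball (T := R_UniformSpace) _ eps)).
  unfold filtermap in *.
  generalize (filter_and _ _ H1 H2). apply filter_imp.
  intros y [Hy1 Hy2]. apply HP. now split.
Qed.

Lemma Cfilterlim_fst (F : (R -> Prop) -> Prop) {FF : Filter F} (f : R -> C) (L : C) :
  filterlim f F (@locally C_UniformSpace L) ->
  filterlim (fun t => fst (f t)) F (locally (fst L)).
Proof.
  intros H P [eps HP]. apply (H (fun z => P (fst z))). exists eps. intros y Hy.
  apply HP, Hy.
Qed.

Lemma Cfilterlim_snd (F : (R -> Prop) -> Prop) {FF : Filter F} (f : R -> C) (L : C) :
  filterlim f F (@locally C_UniformSpace L) ->
  filterlim (fun t => snd (f t)) F (locally (snd L)).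
Proof.
  intros H P [eps HP]. apply (H (fun z => P (snd z))). exists eps. intros y Hy.
  apply HP, Hy.
Qed.

Lemma Cfilterlim_mult (F : (R -> Prop) -> Prop) {FF : Filter F} (f g : R -> C) (L K : C) :
  filterlim f F (@locally C_UniformSpace L) ->
  filterlim g F (@locally C_UniformSpace K) ->
  filterlim (fun t => f t * g t)%C F (@locally C_UniformSpace (L * K)%C).
Proof.
  intros Hf Hg.
  assert (M : forall (u v : R -> R) a b, filterlim u F (locally a) ->
    filterlim v F (locally b) -> filterlim (fun t => u t * v t) F (locally (a * b))).
  { intros u v a b Hu Hv.
    apply (filterlim_comp_2 u v Rmult Hu Hv).
    exact (@filterlim_mult R_AbsRing a b). }
  assert (P : forall (u v : R -> R) a b, filterlim u F (locally a) ->
    filterlim v F (locally b) -> filterlim (fun t => u t + v t) F (locally (a + b))).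
  { intros u v a b Hu Hv.
    apply (filterlim_comp_2 u v Rplus Hu Hv).
    exact (@filterlim_plus R_AbsRing R_NormedModule a b). }
  assert (O : forall (u : R -> R) a, filterlim u F (locally a) ->
    filterlim (fun t => - u t) F (locally (- a))).
  { intros u a Hu. apply (filterlim_comp _ _ _ u Ropp _ _ _ Hu).
    exact (@filterlim_opp R_AbsRing R_NormedModule a). }
  assert (f1 := Cfilterlim_fst F f L Hf). assert (f2 := Cfilterlim_snd F f L Hf).
  assert (g1 := Cfilterlim_fst F g K Hg). assert (g2 := Cfilterlim_snd F g K Hg).
  apply Cfilterlim_pair; trivial; simpl; auto.
  apply P; auto.
Qed.

Lemma lims_at_mult (f g : R -> C) x :
  lims_at f x -> lims_at g x -> lims_at (fun y => f y * g y)%C x.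
Proof.
  intros [[L1 H1] [L2 H2]] [[K1 G1] [K2 G2]].
  split; eexists; apply Cfilterlim_mult; eauto; apply within_filter, locally_filter.
Qed.

Lemma Ccontinuous_mult (f g : R -> C) x :
  continuous f x -> continuous g x -> continuous (fun y => f y * g y)%C x.
Proof. intros Hf Hg. apply (Cfilterlim_mult (locally x)); trivial. Qed.

Lemma reg_ex_RInt (f : pwsmooth) (g : R -> C) a b : a <= b ->
  (forall x, continuous g x) ->
  @ex_RInt C_R_NormedModule (fun x => f x * g x)%C a b.
Proof.
  intros Hab Hg. destruct (pw_spec f (pwP f)) as [[l Hl] Hlim].
  apply (pw_ex_RInt l); trivial.
  - intros x _ Hx. apply Ccontinuous_mult; auto.
  - intros x. apply lims_at_mult; auto. now apply continuous_lims_at.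
Qed.

Definition reg_fun (f : pwsmooth) (t : test) : C :=
  @RInt_gen C_R_CompleteNormedModule (fun x => f x * t x)%C
    (Rbar_locally m_infty) (Rbar_locally p_infty).

Lemma reg_fun_is_RInt (f : pwsmooth) (t : test) M : 0 <= M ->
  (forall x, M < Rabs x -> t x = 0%C) ->
  @is_RInt C_R_NormedModule (fun x => f x * t x)%C (- M) M (reg_fun f t).
Proof.
  intros HM Ht.
  destruct (reg_ex_RInt f t (- M) M) as [I HI]; [lra|..].
  { intros x. apply is_smooth_continuous, test_smooth. }
  assert (Z : forall a b, a <= b -> (b <= - M \/ M <= a) ->
    @is_RInt C_R_NormedModule (fun x => f x * t x)%C a b zero).
  { intros a b Hab Hd. apply is_RInt_ext with (fun _ => zero).
    - intros x. rewrite Rmin_left, Rmax_right by lra. intros Hx.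
      rewrite Ht; [symmetry; apply Cmult_0_r|].
      apply Rlt_le_trans with (Rmax x (- x)).
      + destruct Hd; [apply Rlt_le_trans with (2 := Rmax_r _ _)
                     |apply Rlt_le_trans with (2 := Rmax_l _ _)]; lra.
      + apply Rmax_lub; [apply Rle_abs|rewrite <- Rabs_Ropp; apply Rle_abs].
    - assert (H := @is_RInt_const C_R_NormedModule a b zero).
      now rewrite @scal_zero_r in H. }
  replace (reg_fun f t) with I; [exact HI|].
  symmetry. unfold reg_fun.
  apply (@is_RInt_gen_unique C_R_CompleteNormedModule);
    try (apply Proper_StrongProper, Rbar_locally_filter).
  intros P HP. unfold filtermapi.
  exists (fun a => a < - M) (fun b => M < b).
  - exists (- M). auto.
  - exists M. auto.
  - intros a b Ha Hb. exists I. split; [|now apply locally_singleton].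
    simpl. replace I with (plus (G := C_R_NormedModule) zero I) by apply @plus_zero_l.
    apply @is_RInt_Chasles with (- M); [apply Z; lra|].
    replace I with (plus (G := C_R_NormedModule) I zero) by apply @plus_zero_r.
    apply @is_RInt_Chasles with M; [exact HI|apply Z; lra].
Qed.

Lemma test_bound (t : test) : exists M, 0 <= M /\ forall x, M < Rabs x -> t x = 0%C.
Proof.
  destruct (test_compact t) as [M HM]. exists (Rmax M 0). split; [apply Rmax_r|].
  intros x Hx. apply HM. apply Rle_lt_trans with (2 := Hx), Rmax_l.
Qed.

Lemma is_RInt_Cscal (f : R -> C) a b (c I : C) :
  @is_RInt C_R_NormedModule f a b I ->
  @is_RInt C_R_NormedModule (fun x => c * f x)%C a b (c * I)%C.
Proof.
  intros H.
  assert (H1 := @is_RInt_fct_extend_fst R_NormedModule R_NormedModule f a b I H).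
  assert (H2 := @is_RInt_fct_extend_snd R_NormedModule R_NormedModule f a b I H).
  apply (@is_RInt_fct_extend_pair R_NormedModule R_NormedModule); simpl.
  - apply @is_RInt_minus; now apply @is_RInt_scal.
  - apply @is_RInt_plus; now apply @is_RInt_scal.
Qed.

Definition reg (f : pwsmooth) : distr.
Proof.
  refine (Distr (reg_fun f) _ _ _).
  - intros t u. destruct (test_bound t) as [M [HM Ht]], (test_bound u) as [N [HN Hu]].
    assert (Ht' : forall x, Rmax M N < Rabs x -> t x = 0%C).
    { intros x Hx. apply Ht, Rle_lt_trans with (2 := Hx), Rmax_l. }
    assert (Hu' : forall x, Rmax M N < Rabs x -> u x = 0%C).
    { intros x Hx. apply Hu, Rle_lt_trans with (2 := Hx), Rmax_r. }
    assert (HMN : 0 <= Rmax M N) by (apply Rle_trans with (1 := HM), Rmax_l).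
    assert (It := reg_fun_is_RInt f t _ HMN Ht').
    assert (Iu := reg_fun_is_RInt f u _ HMN Hu').
    assert (Itu := reg_fun_is_RInt f (tadd t u) _ HMN ltac:(
      intros x Hx; simpl; rewrite Ht', Hu' by trivial; apply Cplus_0_l)).
    rewrite <- (@is_RInt_unique C_R_CompleteNormedModule _ _ _ _ Itu).
    apply (@is_RInt_unique C_R_CompleteNormedModule).
    apply @is_RInt_ext with (2 := @is_RInt_plus _ _ _ _ _ _ _ It Iu).
    intros x _. symmetry. apply Cmult_plus_distr_l.
  - intros c t. destruct (test_bound t) as [M [HM Ht]].
    assert (It := reg_fun_is_RInt f t _ HM Ht).
    assert (Ict := reg_fun_is_RInt f (tscal c t) _ HM ltac:(
      intros x Hx; simpl; rewrite Ht by trivial; apply Cmult_0_r)).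
    rewrite <- (@is_RInt_unique C_R_CompleteNormedModule _ _ _ _ Ict).
    apply (@is_RInt_unique C_R_CompleteNormedModule).
    apply @is_RInt_ext with (2 := is_RInt_Cscal _ _ _ c _ It).
    intros x _. simpl. ring.
  - intros t [[M0 HM0] Ht]. apply Ccvg0_eps. intros eps Heps.
    set (M := Rmax M0 1).
    assert (HM1 : 1 <= M) by apply Rmax_r.
    assert (HM : forall k x, M < Rabs x -> t k x = 0%C).
    { intros k x Hx. apply HM0, Rle_lt_trans with (2 := Hx), Rmax_l. }
    destruct (@ex_RInt_ub C_R_NormedModule f (- M) M) as [B HB].
    { destruct (pw_spec f (pwP f)) as [[l Hl] Hlim].
      apply (pw_ex_RInt l); auto. lra. }
    rewrite Rmin_left, Rmax_right in HB by lra.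
    assert (HB0 : 0 < Rabs B + 1) by (assert (H := Rabs_pos B); lra).
    set (e := eps / (2 * (2 * M) * (Rabs B + 1))).
    assert (He : 0 < e) by (apply Rdiv_lt_0_compat; [|apply Rmult_lt_0_compat]; lra).
    destruct (Ht 0%nat e He) as [N HN].
    exists N. intros k Hk.
    apply Rle_lt_trans with ((M - - M) * ((Rabs B + 1) * e)).
    + rewrite Cmod_norm.
      refine (@norm_RInt_le_const C_R_NormedModule _ (- M) M _ _ _ _
        (reg_fun_is_RInt f (t k) M _ (HM k))); [lra| |lra].
      intros x Hx. rewrite <- Cmod_norm. rewrite Cmod_mult.
      apply Rmult_le_compat; try apply Cmod_ge_0.
      * rewrite Cmod_norm. apply Rle_trans with (1 := HB x Hx).
        assert (H := Rle_abs B). lra.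
      * specialize (HN k Hk x). rewrite Cderive_n_0 in HN. lra.
    + unfold e. replace (_ * _) with (eps / 2); [lra|]. field. lra.
Defined.

Definition heaviside (x : R) : R := if Rle_dec 0 x then 1 else 0.

Lemma step_pwsmooth (xi : R) (f : R -> C) (c d : C) :
  (forall x, x < xi -> f x = c) -> (forall x, xi < x -> f x = d) -> is_pwsmooth f.
Proof.
  intros Hc Hd.
  assert (Lc : forall x, x < xi -> locally x (fun y => f y = c)).
  { intros x Hx. assert (Hp : 0 < xi - x) by lra. exists (mkposreal _ Hp).
    intros y Hy. apply Hc. apply Rabs_lt_between in Hy.
    unfold minus, plus, opp in Hy. simpl in Hy. lra. }
  assert (Ld : forall x, xi < x -> locally x (fun y => f y = d)).
  { intros x Hx. assert (Hp : 0 < x - xi) by lra. exists (mkposreal _ Hp).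
    intros y Hy. apply Hd. apply Rabs_lt_between in Hy.
    unfold minus, plus, opp in Hy. simpl in Hy. lra. }
  assert (E : forall k x n, locally x (fun y => f y = k) ->
    ex_Cderive_n f n x /\ Cderive_n f n x = Cderive_n (fun _ => k) n 0).
  { intros k x n L.
    assert (L1 : locally x (fun y => Re k = Re (f y)))
      by (revert L; apply filter_imp; now intros y ->).
    assert (L2 : locally x (fun y => Im k = Im (f y)))
      by (revert L; apply filter_imp; now intros y ->).
    split.
    - split; [apply ex_derive_n_ext_loc with (1 := L1)
             |apply ex_derive_n_ext_loc with (1 := L2)]; apply rsmooth_const.
    - transitivity (Cderive_n (fun _ => k) n x).
      { unfold Cderive_n. f_equal; symmetry.
        - exact (Derive_n_ext_loc _ _ n x L1).
        - exact (Derive_n_ext_loc _ _ n x L2). }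
      unfold Cderive_n. destruct n as [|n]; [reflexivity|now rewrite !Derive_n_const]. }
  exists (xi :: nil). split.
  - intros x Hx n. destruct (Rtotal_order x xi) as [H|[H|H]].
    + now apply (E c), Lc.
    + elim Hx. now left.
    + now apply (E d), Ld.
  - intros x [<-|[]] n. split.
    + exists (Cderive_n (fun _ => c) n 0).
      apply filterlim_ext_loc with (fun _ => Cderive_n (fun _ => c) n 0);
        [|apply filterlim_const].
      exists (mkposreal _ Rlt_0_1). intros y _ Hy. symmetry. now apply E, Lc.
    + exists (Cderive_n (fun _ => d) n 0).
      apply filterlim_ext_loc with (fun _ => Cderive_n (fun _ => d) n 0);
        [|apply filterlim_const].
      exists (mkposreal _ Rlt_0_1). intros y _ Hy. symmetry. now apply E, Ld.
Qed.

(** [H(xi - x)] *)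
Definition H_left (xi : R) : pwsmooth.
Proof.
  refine (Pwsmooth (fun x => RtoC (heaviside (xi - x))) (step_pwsmooth xi _ 1%R 0%R _ _));
    intros x Hx; unfold heaviside; destruct (Rle_dec 0 (xi - x)); trivial; lra.
Defined.

(** [H(x - xi)] *)
Definition H_right (xi : R) : pwsmooth.
Proof.
  refine (Pwsmooth (fun x => RtoC (heaviside (x - xi))) (step_pwsmooth xi _ 0%R 1%R _ _));
    intros x Hx; unfold heaviside; destruct (Rle_dec 0 (x - xi)); trivial; lra.
Defined.

(** Closed under sums, since [reg f] is the derivative of [reg g] for a primitive
    [g] of [f]. *)
Definition Aspace (F : distr) : Prop :=
  exists (f : pwsmooth) (n : nat), F = dderiv_n n (reg f).

(** The support of [t] is a subset of the open interval [(a,b)]. *)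
Definition supp_in (t : test) (a b : R) : Prop :=
  exists c d, a < c /\ d < b /\ forall x, t x <> 0%C -> c <= x <= d.

(** [S = T] on the open interval [(a,b)]. *)
Definition eq_on (a b : R) (S T : distr) : Prop :=
  forall t : test, supp_in t a b -> S t = T t.

(** [P] is the product of [F] and [G]: near every point one of the factors is
    smooth, and there [P] is the product of the other factor by that smooth
    function. *)
Definition is_hprod (F G P : distr) : Prop :=
  forall x, exists a b, a < x < b /\
    ((exists f : smooth, eq_on a b F (reg (pw_of_smooth f)) /\ eq_on a b P (dmul f G)) \/
     (exists g : smooth, eq_on a b G (reg (pw_of_smooth g)) /\ eq_on a b P (dmul g F))).

(** [P] is the weak limit of [F(x) . G(x + eps)] as [eps] decreases to [0]. *)
Definition is_star (F G P : distr) : Prop :=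
  exists Q : R -> distr,
    at_right 0 (fun eps => is_hprod F (dshift eps G) (Q eps)) /\
    forall t, filterlim (fun eps => Q eps t) (at_right 0) (@locally C_UniformSpace (P t)).

(** [F * G]; a junk value if the limit does not exist, which does not happen for
    [F] and [G] in [A]. *)
Definition star (F G : distr) : distr := epsilon (inhabits dzero) (is_star F G).

(** [fm H(xi - x) + fp H(x - xi) + sum_(j <= n) c_j delta_xi^(j)] *)
Definition coeff (xi : R) (fm fp : smooth) (c : nat -> C) (n : nat) : distr :=
  dadd (dadd (dmul fm (reg (H_left xi))) (dmul fp (reg (H_right xi))))
    (dsum (fun j => dscal (c j) (dderiv_n j (ddelta xi))) n).

Definition ode_lhs (a b : nat -> distr) (w : C) (phi : distr) : distr :=
  dadd
    (dsum (fun i => dscal (RtoC (Binomial.C 2 i))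
       (dadd (star (dderiv_n i (a 0%nat)) (dderiv_n (4 - i) phi))
             (star (dderiv_n (4 - i) phi) (dderiv_n i (a 1%nat))))) 2)
    (dscal (- (w ^ 2))%C (dadd (star (b 0%nat) phi) (star phi (b 1%nat)))).

From HB Require Import structures.
From mathcomp Require Import all_boot all_algebra boolp.

(** Coquelicot's [C] is made a MathComp field so that [\det] applies to it. *)
HB.instance Definition _ := gen_eqMixin C.
HB.instance Definition _ := gen_choiceMixin C.
HB.instance Definition _ :=
  GRing.isZmodule.Build C Cplus_assoc Cplus_comm Cplus_0_l
    (fun z => eq_trans (Cplus_comm (- z)%C z) (Cplus_opp_r z)).

Lemma C_one_neq_zero : (RtoC 1 : C) != RtoC 0.
Proof. apply/eqP => E. injection E => E1. now apply R1_neq_R0. Qed.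

HB.instance Definition _ :=
  GRing.Zmodule_isComNzRing.Build C Cmult_assoc Cmult_comm Cmult_1_l
    (fun x y z => Cmult_plus_distr_r x y z) C_one_neq_zero.

Lemma C_mulVf (z : C) : z != RtoC 0 -> (/ z * z)%C = RtoC 1.
Proof. move/eqP => Hz. exact (Cinv_l z Hz). Qed.

Lemma C_inv0 : (/ RtoC 0)%C = RtoC 0.
Proof. unfold Cinv, RtoC. simpl. f_equal; unfold Rdiv; ring. Qed.

HB.instance Definition _ := GRing.ComNzRing_isField.Build C C_mulVf C_inv0.

Definition satisfies_bc (x0 : R) (Cbar : 'cV[C]_4) (phi : distr) : Prop :=
  exists al be, al < x0 < be /\
    exists f : smooth, eq_on al be phi (reg (pw_of_smooth f)) /\
      forall i : 'I_4, Cderive_n f i x0 = Cbar i ord0.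

Definition mx4 (rows : seq (seq C)) : 'M[C]_4 :=
  (\matrix_(i, j) nth (RtoC R0) (nth [::] rows i) j)%R.

Section Matrices.
Local Open Scope C_scope.

Variables (am ap : nat -> smooth) (A B : nat -> nat -> C) (w : C).

Definition fun_a (x : R) : C := am 0%nat x + ap 1%nat x.
Definition fun_am (x : R) : C := am 0%nat x + am 1%nat x.
Definition fun_ap (x : R) : C := ap 0%nat x + ap 1%nat x.

Let a := fun_a.
Let a' := Cderive_n a 1.
Let a_m := fun_am.
Let a_m' := Cderive_n a_m 1.
Let a_p := fun_ap.
Let a_p' := Cderive_n a_p 1.

Definition matA (x : R) : 'M[C]_4 := mx4
  [:: [:: B 1 0 * w^2; - B 1 1 * w^2; a_m' x + B 1 2 * w^2; a_m x - B 1 3 * w^2];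
      [:: B 1 1 * w^2; - 2 * B 1 2 * w^2; a_m x + 3 * B 1 3 * w^2; RtoC 0];
      [:: - a' x + B 1 2 * w^2; a x - 3 * B 1 3 * w^2; - A 1 0; A 1 1];
      [:: a x + B 1 3 * w^2; RtoC 0; - A 1 1; RtoC 0]].

Definition matB (x : R) : 'M[C]_4 := mx4
  [:: [:: - B 0 0 * w^2; B 0 1 * w^2; a_p' x - B 0 2 * w^2; a_p x + B 0 3 * w^2];
      [:: - B 0 1 * w^2; 2 * B 0 2 * w^2; a_p x - 3 * B 0 3 * w^2; RtoC 0];
      [:: - a' x - B 0 2 * w^2; a x + 3 * B 0 3 * w^2; A 0 0; - A 0 1];
      [:: a x - B 0 3 * w^2; RtoC 0; A 0 1; RtoC 0]].

End Matrices.

(* Main.v *)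
(** For [F = fm] on [x < xi] and [G = gp] on [xi < x], with [fm] and [gp] smooth on the whole line, the
    product of [F] and [G(x + eps)] is [gp(x + eps) (F - fm) + fm G(x + eps)], so that
    [F * G = gp (F - fm) + fm G]. For a general [G] in the algebra, Borel's lemma provides a smooth
    function [gp] which represents [G] on some interval to the right of [xi]; hence the limit exists,
    and away from [xi] it is the product by the smooth coefficient.

    On each side of [xi] a solution [phi] therefore satisfies
    [(a phi'')'' - w^2 b phi = 0] with a nonvanishing smooth [a] equal to [a_-] or [a_+]. Multiplying
    the first order system by a fundamental matrix of its adjoint gives a distribution with zero
    derivative, so [phi] is there a classical solution [u] (left) or [v] (right), and both extend to
    the whole line. As [phi] is a derivative of a piecewise smooth function, it differs from [u] and
    [v] glued at [xi] by derivatives of Dirac measures at [xi]; these vanish because the coefficient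
    [a_(0-) + a_(1+)] of the leading one does not vanish at [xi].

    Since [v'' (a_0 - a_(0-)) + u'' (a_1 - a_(1+)) + (a_(0-) + a_(1+)) phi''] has at [xi] at most
    [delta] and [delta'], and the equation says that its second derivative is [w^2] times the
    corresponding expression for [b], what remains is four equations, the coefficients of
    [delta] and of its first three derivatives. They read [B V = A U] for the jets [U] of [u] and [V]
    of [v] at [xi]. The boundary condition fixes [u] (or [v]), and the other jet is the unique
    solution of a linear system if and only if the determinant of its matrix is nonzero. *)

Require Import Defs.
From Stdlib Require Import Reals Lra Lia List ClassicalEpsilon ProofIrrelevance FunctionalExtensionality.
From Coquelicot Require Import Coquelicot.
From mathcomp Require all_boot all_algebra.

Open Scope R_scope.

(** * Smooth functions of a real variable *)

(** The product is a limit that has to be exhibited before it can be computed with. For a general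
    factor in the algebra a smooth representative next to [xi] is available only up to the next
    singular point, whereas the difference between a coefficient and its left function persists on
    the whole right half-line. Off [xi] the left function is therefore replaced by a smooth function
    that passes from one side of the coefficient to the other within that distance. The formula with
    the plain left function becomes valid once both factors have smooth representatives on the two
    entire half-lines. The product is thus needed twice: off [xi] for every element of the algebra,
    which gives the one-sided equations and the shape of [phi], and then explicitly for that shape.
    The binomial weights of the equation are those of the Leibniz formula, which is what turns the
    terms in the coefficients [a] into a second derivative. No solvability condition on [Cbar]
    appears because a singular matrix destroys uniqueness for every right-hand side. *)

Lemma geometric_tail (u : nat -> R) K N :
  (forall n, (N <= n)%nat -> Rabs (u (S n) - u n) <= K * (/ 2) ^ n) ->
  forall n p, (N <= n)%nat -> Rabs (u (n + p)%nat - u n) <= 2 * K * (/ 2) ^ n.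
Proof.
  intros H n p Hn.
  assert (HK : 0 <= K).
  { specialize (H N (le_n N)). assert (0 < (/ 2) ^ N) by (apply pow_lt; lra).
    assert (A := Rabs_pos (u (S N) - u N)). nra. }
  (* The subtracted term makes the bound telescope in [p]. *)
  enough (Rabs (u (n + p)%nat - u n) <= 2 * K * ((/ 2) ^ n - (/ 2) ^ (n + p))).
  { assert (0 < (/ 2) ^ (n + p)) by (apply pow_lt; lra). nra. }
  induction p as [|p IH].
  - replace (n + 0)%nat with n by lia. rewrite !Rminus_diag, Rabs_R0. lra.
  - replace (n + S p)%nat with (S (n + p)) by lia.
    replace (u (S (n + p)) - u n) with
      ((u (S (n + p)) - u (n + p)%nat) + (u (n + p)%nat - u n)) by ring.
    apply Rle_trans with (1 := Rabs_triang _ _).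
    specialize (H (n + p)%nat ltac:(lia)). simpl. lra.
Qed.

Lemma geometric_CVU_cauchy (f : nat -> R -> R) (D : R -> Prop) K N :
  (forall n x, D x -> (N <= n)%nat -> Rabs (f (S n) x - f n x) <= K * (/ 2) ^ n) ->
  CVU_cauchy f D.
Proof.
  intros H eps.
  destruct (pow_lt_1_zero (/ 2) ltac:(rewrite Rabs_pos_eq; lra)
    (eps / (4 * (Rabs K + 1)))) as [M HM].
  { apply Rdiv_lt_0_compat; [apply cond_pos|]. assert (A := Rabs_pos K). lra. }
  exists (N + M)%nat.
  assert (T : forall n x, D x -> (N + M <= n)%nat -> forall p,
    Rabs (f (n + p)%nat x - f n x) < eps).
  { intros n x Hx Hn p.
    apply Rle_lt_trans with (1 := geometric_tail (fun n => f n x) K N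
      (fun n Hn => H n x Hx Hn) n p ltac:(lia)).
    specialize (HM n ltac:(lia)). rewrite Rabs_pos_eq in HM by (apply pow_le; lra).
    assert (A := Rabs_pos K). assert (B := Rle_abs K).
    assert (P : 0 < (/ 2) ^ n) by (apply pow_lt; lra).
    apply Rle_lt_trans with (2 * (Rabs K + 1) * (/ 2) ^ n); [nra|].
    apply Rlt_le_trans with (2 * (Rabs K + 1) * (eps / (4 * (Rabs K + 1)))).
    - apply Rmult_lt_compat_l; lra.
    - assert (C := cond_pos eps).
      replace (2 * (Rabs K + 1) * (eps / (4 * (Rabs K + 1)))) with (eps / 2) by (field; lra).
      lra. }
  intros n m x Hx Hn Hm. destruct (Nat.le_ge_cases n m) as [L|L].
  - rewrite Rabs_minus_sym. replace m with (n + (m - n))%nat by lia. now apply T.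
  - replace n with (m + (n - m))%nat by lia. now apply T.
Qed.

(** Geometric control of both sequences gives uniform convergence, so limit and derivative may be
    exchanged. The starting index [N] serves Borel's series, whose derivatives of order [i] are
    controlled only for the terms beyond [i]; the Picard iterates use it with [N = 0]. *)
Lemma termwise_derive (f g : nat -> R -> R) a b K N :
  (forall n x, a < x < b -> is_derive (f n) x (g n x)) ->
  (forall n x, a < x < b -> continuous (g n) x) ->
  (forall n x, a < x < b -> (N <= n)%nat -> Rabs (f (S n) x - f n x) <= K * (/ 2) ^ n) ->
  (forall n x, a < x < b -> (N <= n)%nat -> Rabs (g (S n) x - g n x) <= K * (/ 2) ^ n) ->
  forall x, a < x < b ->
  is_derive (fun y => real (Lim_seq (fun n => f n y))) x (real (Lim_seq (fun n => g n x))).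
Proof.
  intros Hd Hc Hf Hg x Hx.
  assert (E : forall n y, a < y < b -> Derive (f n) y = g n y).
  { intros n y Hy. now apply is_derive_unique, Hd. }
  rewrite (Lim_seq_ext (fun n => g n x) (fun n => Derive (f n) x))
    by (intros n; now rewrite E).
  apply (CVU_Derive f (fun y => a < y < b)).
  - apply open_and; [apply open_gt|apply open_lt].
  - intros c d y [Hc1 Hc2] [Hd1 Hd2] Hy. lra.
  - apply CVU_dom_cauchy. now apply geometric_CVU_cauchy with K N.
  - intros n y Hy. exists (g n y). now apply Hd.
  - intros n y Hy. apply continuity_pt_filterlim.
    apply (continuous_ext_loc _ (g n)); [|now apply Hc].
    apply filter_imp with (fun z => a < z < b); [intros z Hz; now rewrite E|].
    apply (open_and _ _ (open_gt a) (open_lt b) y Hy).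
  - apply CVU_dom_cauchy. apply geometric_CVU_cauchy with K N.
    intros n y Hy Hn. rewrite !E by trivial. auto.
  - trivial.
Qed.

Lemma geometric_is_lim (u : nat -> R) K N :
  (forall n, (N <= n)%nat -> Rabs (u (S n) - u n) <= K * (/ 2) ^ n) ->
  is_lim_seq u (real (Lim_seq u)).
Proof.
  intros H. apply Lim_seq_correct', ex_lim_seq_cauchy_corr.
  assert (C := geometric_CVU_cauchy (fun n _ => u n) (fun _ => True) K N
    (fun n _ _ => H n)).
  intros eps. destruct (C eps) as [M HM]. exists M. intros n m Hn Hm. now apply (HM n m 0).
Qed.

(** A class in which every member has a derivative belonging to the class can be differentiated
    indefinitely. This replaces formulas for the [n]-th derivative: it suffices to name a class
    closed under differentiation. *)
Lemma rsmooth_ind (S : (R -> R) -> Prop) :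
  (forall f, S f -> exists g, S g /\ forall x, is_derive f x (g x)) ->
  forall f, S f -> rsmooth f.
Proof.
  intros H f Hf n. revert f Hf. induction n as [|n IH]; intros f Hf x; [easy|].
  destruct (H f Hf) as [g [Hg D]]. apply ex_derive_n_S.
  - intros y. now exists (g y).
  - apply (ex_derive_n_ext g); [|now apply IH].
    intros y. symmetry. now apply is_derive_unique.
Qed.

(** The functions [g f^(-k)] with smooth [g] are closed under differentiation: the derivative is
    [(g' f - k g f') f^(-k-1)]. *)
Lemma rsmooth_inv f : rsmooth f -> (forall x, f x <> 0) -> rsmooth (fun x => / f x).
Proof.
  intros Hf H0.
  apply (rsmooth_ind (fun h => exists g k, rsmooth g /\ forall x, h x = g x * (/ f x) ^ k)).
  - intros h [g [k [Hg E]]].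
    exists (fun x => (Derive g x * f x - INR k * (g x * Derive f x)) * (/ f x) ^ S k).
    split.
    + do 2 eexists. split; [|reflexivity].
      apply rsmooth_minus; [|apply rsmooth_mult; [apply rsmooth_const|]];
        apply rsmooth_mult; trivial; now apply rsmooth_Derive.
    + intros x. apply (is_derive_ext (fun x => g x * (/ f x) ^ k)); [easy|].
      assert (Df := Derive_correct _ _ (rsmooth_ex_derive f Hf x)).
      assert (Dg := Derive_correct _ _ (rsmooth_ex_derive g Hg x)).
      evar_last.
      { refine (is_derive_mult g (fun x => (/ f x) ^ k) x _ _ Dg _ _).
        - apply (is_derive_pow (fun x => / f x) k x).
          apply (is_derive_inv f x (Derive f x)); [exact Df|apply H0].
        - intros n m. apply Rmult_comm. }
      unfold plus, mult. simpl. destruct k as [|k]; simpl pred.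
      * simpl. field. apply H0.
      * rewrite S_INR. simpl. field. apply H0.
  - exists (fun _ => 1), 1%nat. split; [apply rsmooth_const|]. intros x. ring.
Qed.

(** By the mean value theorem, it is enough to know the derivative off the point. *)
Lemma is_derive_at_limit (f g : R -> R) p :
  continuous f p -> continuous g p -> (forall x, x <> p -> is_derive f x (g x)) ->
  is_derive f p (g p).
Proof.
  intros Cf Cg D. split; [apply is_linear_scal_l|].
  intros x Hx. replace x with p by (symmetry; apply eq_sym, is_filter_lim_locally_unique, Hx).
  clear x Hx. intros eps.
  destruct (proj1 (filterlim_locally _ _) Cg eps) as [d Hd].
  exists d. intros y Hy.
  assert (Cf' : forall x, continuous f x).
  { intros x. destruct (Req_dec x p) as [->|Hx]; trivial.
    apply @ex_derive_continuous. exists (g x). now apply D. }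
  assert (M : exists c, Rmin p y <= c <= Rmax p y /\ f y - f p = g c * (y - p)).
  { destruct (Req_dec y p) as [->|Hy'].
    - exists p. rewrite Rmin_left, Rmax_left by lra. split; lra.
    - apply (MVT_gen f p y g).
      + intros x Hx. apply D. intros ->. revert Hx. unfold Rmin, Rmax. destruct Rle_dec; lra.
      + intros x _. apply continuity_pt_filterlim, Cf'. }
  destruct M as [c [Hc E]].
  assert (Bc : ball p d c).
  { change (Rabs (c - p) < d). change (Rabs (y - p) < d) in Hy.
    revert Hc Hy. unfold Rmin, Rmax, Rabs. repeat destruct Rle_dec; repeat destruct Rcase_abs; lra. }
  specialize (Hd c Bc). change (Rabs (g c - g p) < eps) in Hd.
  change (Rabs ((f y - f p) - (y - p) * g p) <= eps * Rabs (y - p)).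
  replace (f y - f p - (y - p) * g p) with ((g c - g p) * (y - p)) by (rewrite E; ring).
  rewrite Rabs_mult. apply Rmult_le_compat_r; [apply Rabs_pos|lra].
Qed.

(** * Flat functions and smooth cutoffs *)

Definition flat (k : nat) (x : R) : R := if Rle_dec x 0 then 0 else (/ x) ^ k * exp (- / x).

Lemma flat_nonpos k x : x <= 0 -> flat k x = 0.
Proof. intros H. unfold flat. now destruct (Rle_dec x 0). Qed.

Lemma flat_pos k x : 0 < x -> 0 < flat k x.
Proof.
  intros H. unfold flat. destruct (Rle_dec x 0); [lra|].
  apply Rmult_lt_0_compat; [apply pow_lt, Rinv_0_lt_compat, H|apply exp_pos].
Qed.

(** With [n = k + 1], [exp y = exp (y / n)^n >= (y / n)^n]. *)
Lemma pow_exp_le k y : 0 < y -> y ^ S k * exp (- y) <= INR (S k) ^ S k.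
Proof.
  intros Hy. set (n := S k). assert (Hn : 0 < INR n) by (apply lt_0_INR; unfold n; lia).
  assert (E : exp y = exp (y / INR n) ^ n).
  { rewrite <- Rpower_pow by apply exp_pos. unfold Rpower. rewrite ln_exp.
    f_equal. field. lra. }
  assert (P : (y / INR n) ^ n <= exp y).
  { rewrite E. apply pow_incr. split.
    - apply Rlt_le, Rdiv_lt_0_compat; lra.
    - assert (A := exp_ineq1_le (y / INR n)). lra. }
  rewrite exp_Ropp. apply Rmult_le_reg_r with (exp y); [apply exp_pos|].
  rewrite Rmult_assoc, Rinv_l by (apply Rgt_not_eq, exp_pos).
  unfold Rdiv in P. rewrite Rpow_mult_distr, pow_inv in P.
  assert (Q : 0 < INR n ^ n) by now apply pow_lt.
  apply (Rmult_le_compat_l (INR n ^ n)) in P; [|lra].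
  replace (INR n ^ n * (y ^ n * / INR n ^ n)) with (y ^ n) in P by (field; lra). lra.
Qed.

Lemma continuous_flat_0 k : continuous (flat k) 0.
Proof.
  apply filterlim_locally. intros eps.
  set (K := INR (S k) ^ S k).
  assert (HK : 0 < K) by (apply pow_lt, lt_0_INR; lia).
  assert (Hd : 0 < eps / (K + 1)) by (apply Rdiv_lt_0_compat; [apply cond_pos|lra]).
  exists (mkposreal _ Hd). intros x Hx.
  change (Rabs (x - 0) < eps / (K + 1)) in Hx. rewrite Rminus_0_r in Hx.
  change (Rabs (flat k x - flat k 0) < eps).
  rewrite (flat_nonpos k 0), Rminus_0_r by lra.
  destruct (Rle_dec x 0) as [Hx0|Hx0].
  - rewrite flat_nonpos, Rabs_R0 by trivial. apply cond_pos.
  - rewrite Rabs_pos_eq by (apply Rlt_le, flat_pos; lra).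
    rewrite Rabs_pos_eq in Hx by lra.
    assert (P := pow_exp_le k (/ x) ltac:(apply Rinv_0_lt_compat; lra)). fold K in P.
    unfold flat. destruct (Rle_dec x 0); [lra|]. simpl in P.
    set (z := (/ x) ^ k * exp (- / x)) in *.
    (* One factor [/ x] in the bound of [pow_exp_le] is traded for a factor [x], which tends to
       0. *)
    assert (z <= K * x).
    { replace z with (/ x * (/ x) ^ k * exp (- / x) * x) by (unfold z; field; lra).
      apply Rmult_le_compat_r; lra. }
    apply Rle_lt_trans with (1 := H).
    apply Rle_lt_trans with (K * (eps / (K + 1))); [apply Rmult_le_compat_l; lra|].
    assert (E := cond_pos eps).
    apply Rmult_lt_reg_r with (K + 1); [lra|].
    replace (K * (eps / (K + 1)) * (K + 1)) with (K * eps) by (field; lra). lra.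
Qed.

Lemma is_derive_flat k x :
  is_derive (flat k) x (- INR k * flat (S k) x + flat (S (S k)) x).
Proof.
  assert (D : forall x, x <> 0 ->
    is_derive (flat k) x (- INR k * flat (S k) x + flat (S (S k)) x)).
  { intros y Hy. destruct (Rle_dec y 0) as [H|H].
    - rewrite !flat_nonpos by trivial.
      apply (is_derive_ext_loc (fun _ => 0)).
      + apply filter_imp with (fun z => z < 0); [|apply open_lt; lra].
        intros z Hz. rewrite flat_nonpos; lra.
      + evar_last; [apply @is_derive_const|]. unfold zero. simpl. ring.
    - apply (is_derive_ext_loc (fun z => (/ z) ^ k * exp (- / z))).
      + apply filter_imp with (fun z => 0 < z); [|apply open_gt; lra].
        intros z Hz. unfold flat. destruct (Rle_dec z 0); lra.
      + unfold flat. destruct (Rle_dec y 0); [lra|].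
        auto_derive; [repeat split; trivial|]. destruct k as [|k]; simpl pred.
        * simpl. field. trivial.
        * rewrite !S_INR. simpl. field. trivial. }
  destruct (Req_dec x 0) as [->|Hx]; [|now apply D].
  apply (is_derive_at_limit (flat k)
    (fun x => - INR k * flat (S k) x + flat (S (S k)) x)); trivial.
  - apply continuous_flat_0.
  - apply @continuous_plus; [apply @continuous_mult; [apply continuous_const|]|];
      apply continuous_flat_0.
Qed.

(** Differentiating [exp (- / x)] produces powers of [/ x], so the family of all [flat k] is taken
    together with its combinations: a class closed under differentiation, as [rsmooth_ind]
    requires. *)
Inductive flat_span : (R -> R) -> Prop :=
| flat_span_flat k : flat_span (flat k)
| flat_span_lin c f g : flat_span f -> flat_span g -> flat_span (fun x => c * f x + g x).

Lemma rsmooth_flat k : rsmooth (flat k).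
Proof.
  apply (rsmooth_ind flat_span); [|constructor].
  intros f Hf. induction Hf as [j|c f g _ [f' [Hf Df]] _ [g' [Hg Dg]]].
  - eexists. split; [|apply is_derive_flat]. repeat constructor.
  - exists (fun x => c * f' x + g' x). split; [now constructor|]. intros x.
    apply @is_derive_plus; [now apply @is_derive_scal|trivial].
Qed.

Lemma rsmooth_comp_opp f : rsmooth f -> rsmooth (fun x => f (- x)).
Proof. intros Hf n x. apply ex_derive_n_comp_opp. apply filter_forall. auto. Qed.

Lemma rsmooth_comp_scal f a : rsmooth f -> rsmooth (fun x => f (a * x)).
Proof. intros Hf n x. apply ex_derive_n_comp_scal. apply filter_forall. auto. Qed.

(** The usual smooth transition from 0 to 1 on the unit interval; the denominator is positive since
    [x] and [1 - x] are not both nonpositive. *)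
Definition step (x : R) : R := flat 0 x / (flat 0 x + flat 0 (1 - x)).

Lemma step_denom_pos x : 0 < flat 0 x + flat 0 (1 - x).
Proof.
  destruct (Rle_dec x 0) as [H|H].
  - rewrite (flat_nonpos 0 x) by trivial. assert (A := flat_pos 0 (1 - x)). lra.
  - assert (A := flat_pos 0 x). destruct (Rle_dec (1 - x) 0) as [H'|H'].
    + rewrite (flat_nonpos 0 (1 - x)) by trivial. lra.
    + assert (B := flat_pos 0 (1 - x)). lra.
Qed.

Lemma rsmooth_step : rsmooth step.
Proof.
  assert (H : rsmooth (fun x => flat 0 (1 - x))).
  { intros n x. apply (ex_derive_n_ext (fun x => flat 0 (- (x + - 1)))).
    - intros t. f_equal. ring.
    - apply (rsmooth_shift (fun x => flat 0 (- x)) (- 1)), rsmooth_comp_opp, rsmooth_flat. }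
  apply rsmooth_mult; [apply rsmooth_flat|]. apply rsmooth_inv.
  - apply rsmooth_plus; trivial. apply rsmooth_flat.
  - intros x. apply Rgt_not_eq, step_denom_pos.
Qed.

Lemma step_0 x : x <= 0 -> step x = 0.
Proof. intros H. unfold step. rewrite (flat_nonpos 0 x) by trivial. apply Rmult_0_l. Qed.

Lemma step_1 x : 1 <= x -> step x = 1.
Proof.
  intros H. unfold step. rewrite (flat_nonpos 0 (1 - x)) by lra. rewrite Rplus_0_r.
  apply Rinv_r, Rgt_not_eq, flat_pos. lra.
Qed.

Definition ramp (a b x : R) : R := step ((x - a) / (b - a)).

Lemma rsmooth_ramp a b : rsmooth (ramp a b).
Proof.
  intros n x. apply (ex_derive_n_ext (fun x => step (/ (b - a) * (x + - a)))).
  - intros t. unfold ramp. f_equal. unfold Rdiv. ring.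
  - apply (rsmooth_shift (fun x => step (/ (b - a) * x)) (- a)), rsmooth_comp_scal, rsmooth_step.
Qed.

Lemma ramp_0 a b x : a < b -> x <= a -> ramp a b x = 0.
Proof.
  intros H Hx. apply step_0. apply Rmult_le_reg_r with (b - a); [lra|].
  unfold Rdiv. rewrite Rmult_assoc, Rinv_l; lra.
Qed.

Lemma ramp_1 a b x : a < b -> b <= x -> ramp a b x = 1.
Proof.
  intros H Hx. apply step_1. apply Rmult_le_reg_r with (b - a); [lra|].
  unfold Rdiv. rewrite Rmult_assoc, Rinv_l; lra.
Qed.

Definition plateau (a b r x : R) : R := ramp (a - r) a x * (1 - ramp b (b + r) x).

Lemma rsmooth_plateau a b r : rsmooth (plateau a b r).
Proof.
  apply rsmooth_mult; [apply rsmooth_ramp|].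
  apply rsmooth_minus; [apply rsmooth_const|apply rsmooth_ramp].
Qed.

Lemma plateau_1 a b r x : 0 < r -> a <= x <= b -> plateau a b r x = 1.
Proof. intros Hr Hx. unfold plateau. rewrite ramp_1, ramp_0; lra. Qed.

Lemma plateau_0 a b r x : 0 < r -> x <= a - r \/ b + r <= x -> plateau a b r x = 0.
Proof.
  intros Hr [Hx|Hx]; unfold plateau.
  - rewrite ramp_0; lra.
  - rewrite (ramp_1 b (b + r)); lra.
Qed.

(** * Borel's lemma and one-sided germs *)

Lemma choice_function (S T : Type) (P : S -> T -> Prop) :
  (forall n, exists y, P n y) -> exists f, forall n, P n (f n).
Proof.
  intros H. exists (fun n => proj1_sig (ClassicalEpsilon.constructive_indefinite_description _ (H n))).
  intros n. now destruct ClassicalEpsilon.constructive_indefinite_description.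
Qed.

Lemma rsmooth_id : rsmooth (fun x => x).
Proof. intros n x. apply (ex_derive_n_ext (fun x => x ^ 1)); [intros; ring|]. apply ex_derive_n_pow. Qed.

Lemma rsmooth_pow f k : rsmooth f -> rsmooth (fun x => f x ^ k).
Proof.
  intros Hf. induction k as [|k IH]; simpl; [apply rsmooth_const|now apply rsmooth_mult].
Qed.

Lemma rsmooth_Derive_n f n : rsmooth f -> rsmooth (Derive_n f n).
Proof. intros Hf. induction n as [|n IH]; [easy|]. exact (rsmooth_Derive _ IH). Qed.

Lemma rsmooth_bounded f M : rsmooth f ->
  exists B, 0 < B /\ forall x, Rabs x <= M -> Rabs (f x) <= B.
Proof.
  intros Hf. destruct (smooth_bounded (fun x => RtoC (f x)) M) as [B [HB H]].
  - apply is_smooth_comp; simpl; [exact Hf|apply rsmooth_const].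
  - exists B. split; trivial. intros x Hx. rewrite <- Cmod_R. now apply H.
Qed.

Lemma rsmooth_bounded_upto f M n : rsmooth f ->
  exists B, 0 < B /\ forall i x, (i <= n)%nat -> Rabs x <= M -> Rabs (Derive_n f i x) <= B.
Proof.
  intros Hf. induction n as [|n [B [HB IH]]].
  - destruct (rsmooth_bounded f M Hf) as [B [HB H]]. exists B. split; trivial.
    intros i x Hi Hx. replace i with 0%nat by lia. now apply H.
  - destruct (rsmooth_bounded _ M (rsmooth_Derive_n f (S n) Hf)) as [B' [HB' H]].
    exists (B + B'). split; [lra|]. intros i x Hi Hx.
    destruct (Nat.eq_dec i (S n)) as [->|Hi'].
    + specialize (H x Hx). simpl in *. lra.
    + specialize (IH i x ltac:(lia) Hx). lra.
Qed.

Section Borel.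
Variable c : nat -> R.

Let phi (k : nat) (x : R) : R := c k / INR (Factorial.fact k) * (x ^ k * plateau (-1) 1 1 x).

Let phi_smooth k : rsmooth (phi k).
Proof.
  apply rsmooth_mult; [apply rsmooth_const|].
  apply rsmooth_mult; [|apply rsmooth_plateau]. apply (rsmooth_pow _ k rsmooth_id).
Qed.

Let phi_bound k : exists B, 0 < B /\
  forall i x, (i <= k)%nat -> Rabs (Derive_n (phi k) i x) <= B.
Proof.
  destruct (rsmooth_bounded_upto (phi k) 2 k (phi_smooth k)) as [B [HB H]].
  exists B. split; trivial. intros i x Hi. destruct (Rle_lt_dec (Rabs x) 2) as [Hx|Hx]; auto.
  rewrite (Derive_n_compact (phi k) 2); trivial.
  - rewrite Rabs_R0. lra.
  - intros y Hy. unfold phi. rewrite plateau_0; [ring|lra|].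
    revert Hy. unfold Rabs. destruct Rcase_abs; lra.
Qed.

Let phi_0 k i : Derive_n (phi k) i 0 = if Nat.eq_dec i k then c k else 0.
Proof.
  rewrite (Derive_n_ext_loc _ (fun x => c k / INR (Factorial.fact k) * x ^ k)).
  - rewrite Derive_n_scal_l, Derive_n_pow.
    destruct (Compare_dec.le_dec i k); destruct (Nat.eq_dec i k) as [->|]; try lia; try ring.
    + rewrite Nat.sub_diag. simpl. field. apply INR_fact_neq_0.
    + rewrite pow_i by lia. ring.
  - exists (mkposreal _ Rlt_0_1). intros y Hy. apply Rabs_lt_between in Hy.
    unfold minus, plus, opp in Hy. simpl in Hy.
    unfold phi. rewrite plateau_1; [ring|lra|lra].
Qed.

(** The function is the sum over [k] of [la_k^(-k) phi_k (la_k x)], where [phi_k] is [c_k x^k / k!]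
    near 0 and has compact support. The scaling keeps the jet at 0 but multiplies the derivative of
    order [i < k] by [la_k^(i-k) <= 1 / la_k], so that large [la_k] make every differentiated series
    converge uniformly. *)
Lemma Borel : exists B, rsmooth B /\ forall n, Derive_n B n 0 = c n.
Proof.
  destruct (choice_function _ _ _ phi_bound) as [M HM].
  (* [M k] bounds the derivatives of [phi k] up to order [k]; this choice gives
     [M k / la k <= 2^(-k)] and [la k >= 1]. *)
  set (la := fun k => 2 ^ k * (M k + 1)).
  assert (Hla : forall k, 1 <= la k).
  { intros k. unfold la. assert (A := pow_R1_Rle 2 k). destruct (HM k). nra. }
  (* [v k i] is the [i]-th derivative of the rescaled [k]-th term; [f i n] below is that of a
     partial sum. *)
  set (v := fun k i x => (/ la k) ^ k * (la k) ^ i * Derive_n (phi k) i (la k * x)).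
  assert (Dv : forall k i x, is_derive (v k i) x (v k (S i) x)).
  { intros k i x. unfold v.
    replace ((/ la k) ^ k * (la k) ^ S i * Derive_n (phi k) (S i) (la k * x)) with
      ((/ la k) ^ k * (la k) ^ i * (la k * Derive_n (phi k) (S i) (la k * x))) by (simpl; ring).
    apply @is_derive_scal.
    apply (is_derive_comp (Derive_n (phi k) i) (fun x => la k * x)).
    - apply Derive_correct. exact (rsmooth_ex_derive _ (rsmooth_Derive_n _ i (phi_smooth k)) _).
    - auto_derive; trivial. ring. }
  assert (Bv : forall k i x, (i < k)%nat -> Rabs (v k i x) <= (/ 2) ^ k).
  { intros k i x Hi. unfold v. specialize (Hla k). destruct (HM k) as [HM0 HM1].
    specialize (HM1 i (la k * x) ltac:(lia)).
    replace ((/ la k) ^ k * la k ^ i) with ((/ la k) ^ (k - i)).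
    2:{ replace ((/ la k) ^ k) with ((/ la k) ^ (k - i) * (/ la k) ^ i)
          by (rewrite <- pow_add; f_equal; lia).
        rewrite Rmult_assoc, <- Rpow_mult_distr, Rinv_l, pow1; lra. }
    assert (I1 : 0 < / la k) by (apply Rinv_0_lt_compat; lra).
    rewrite Rabs_mult, (Rabs_pos_eq (_ ^ _)) by (apply pow_le; lra).
    assert (P1 : (/ la k) ^ (k - i) <= / la k).
    { replace (k - i)%nat with (S (k - i - 1)) by lia. simpl.
      assert ((/ la k) ^ (k - i - 1) <= 1).
      { rewrite <- (pow1 (k - i - 1)). apply pow_incr. split; [lra|].
        rewrite <- Rinv_1. apply Rinv_le_contravar; lra. }
      nra. }
    apply Rle_trans with (/ la k * M k).
    - apply Rmult_le_compat; trivial; [apply pow_le; lra|apply Rabs_pos].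
    - unfold la. rewrite Rinv_mult, pow_inv.
      assert (0 < / 2 ^ k) by (apply Rinv_0_lt_compat, pow_lt; lra).
      rewrite Rmult_assoc. assert (/ (M k + 1) * M k <= 1); [|nra].
      apply Rmult_le_reg_l with (M k + 1); [lra|].
      rewrite <- Rmult_assoc, Rinv_r; lra. }
  set (f := fun i n x => sum_f_R0 (fun k => v k i x) n).
  set (B := fun i x => real (Lim_seq (fun n => f i n x))).
  assert (Df : forall i n x, is_derive (f i n) x (f (S i) n x)).
  { intros i n x. unfold f. induction n as [|n IH]; simpl; [apply Dv|].
    apply @is_derive_plus; [apply IH|apply Dv]. }
  assert (Gf : forall i n x, (i <= n)%nat -> Rabs (f i (S n) x - f i n x) <= 1 * (/ 2) ^ n).
  { intros i n x Hn. unfold f. simpl.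
    replace (_ + _ - _) with (v (S n) i x) by ring.
    apply Rle_trans with (1 := Bv (S n) i x ltac:(lia)). simpl.
    assert (0 < (/ 2) ^ n) by (apply pow_lt; lra). lra. }
  assert (DB : forall i x, is_derive (B i) x (B (S i) x)).
  { intros i x. apply (termwise_derive (f i) (f (S i)) (x - 1) (x + 1) 1 (S i)).
    - intros n y _. apply Df.
    - intros n y _. apply @ex_derive_continuous. eexists. apply Df.
    - intros n y _ Hn. apply Gf. lia.
    - intros n y _ Hn. apply Gf. lia.
    - lra. }
  exists (B 0%nat). split.
  - apply (rsmooth_ind (fun g => exists i, g = B i)); [|now exists 0%nat].
    intros g [i ->]. exists (B (S i)). split; eauto.
  - intros n. transitivity (B n 0).
    + assert (E : forall x, Derive_n (B 0%nat) n x = B n x).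
      { induction n as [|n IH]; [easy|]. intros x. simpl.
        rewrite (Derive_ext _ (B n)) by trivial. now apply is_derive_unique. }
      apply E.
    + unfold B. rewrite (Lim_seq_ext_loc _ (fun _ => c n)); [now rewrite Lim_seq_const|].
      assert (V : forall k, v k n 0 = if Nat.eq_dec n k then c k else 0).
      { intros k. unfold v. rewrite Rmult_0_r, phi_0. destruct Nat.eq_dec as [->|]; [|ring].
        rewrite <- Rpow_mult_distr, Rinv_l, pow1; [ring|]. specialize (Hla k). lra. }
      assert (F : forall m, f n m 0 = if Compare_dec.le_dec n m then c n else 0).
      { induction m as [|m IH]; unfold f in *; simpl; rewrite V.
        - destruct Nat.eq_dec as [->|]; destruct Compare_dec.le_dec; trivial; lia.
        - rewrite IH. destruct Nat.eq_dec as [->|]; repeat destruct Compare_dec.le_dec; try lia; try lra. }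
      exists n. intros m Hm. rewrite F. now destruct Compare_dec.le_dec.
Qed.
End Borel.

Lemma Borel_at (p : R) (c : nat -> R) : exists B, rsmooth B /\ forall n, Derive_n B n p = c n.
Proof.
  destruct (Borel c) as [B [HB E]]. exists (fun x => B (x + - p)). split.
  - now apply rsmooth_shift.
  - intros n. rewrite (Derive_n_comp_trans B), <- E. f_equal. ring.
Qed.

(** To the right of [p] the function continues as a Borel function whose jet consists of the limits.
    Every derivative is then continuous at [p], and [is_derive_at_limit] gives differentiability
    there. *)
Lemma extend_from_left (h : R -> R) p (l : nat -> R) :
  (forall x n, x < p -> ex_derive_n h n x) ->
  (forall n, filterlim (Derive_n h n) (at_left p) (locally (l n))) ->
  exists g, rsmooth g /\ forall x, x < p -> g x = h x.
Proof.
  intros Hs Hl. destruct (Borel_at p l) as [B [HB EB]].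
  set (G := fun n x => if Rlt_dec x p then Derive_n h n x else Derive_n B n x).
  assert (C : forall n, continuous (G n) p).
  { intros n. assert (E : G n p = l n) by (unfold G; destruct Rlt_dec; [lra|apply EB]).
    intros P HP. rewrite E in HP. destruct (Hl n P HP) as [d1 H1].
    assert (CB := rsmooth_continuous _ (rsmooth_Derive_n _ n HB) p).
    rewrite <- EB in HP. destruct (CB P HP) as [d2 H2].
    assert (Hd : 0 < Rmin d1 d2) by (apply Rmin_pos; apply cond_pos).
    exists (mkposreal _ Hd). intros y Hy. change (Rabs (y - p) < Rmin d1 d2) in Hy.
    unfold G. destruct Rlt_dec as [Hyp|Hyp].
    - apply H1; trivial. apply Rlt_le_trans with (1 := Hy), Rmin_l.
    - apply H2. apply Rlt_le_trans with (1 := Hy), Rmin_r. }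
  assert (D : forall n x, is_derive (G n) x (G (S n) x)).
  { intros n. assert (D : forall x, x <> p -> is_derive (G n) x (G (S n) x)).
    { intros x Hx. unfold G at 2. destruct Rlt_dec as [Hxp|Hxp].
      - apply (is_derive_ext_loc (Derive_n h n)).
        + apply filter_imp with (fun y => y < p); [|now apply open_lt].
          intros y Hy. unfold G. now destruct Rlt_dec.
        + apply Derive_correct. now apply (Hs x (S n)).
      - apply (is_derive_ext_loc (Derive_n B n)).
        + apply filter_imp with (fun y => p < y); [|apply open_gt; lra].
          intros y Hy. unfold G. destruct Rlt_dec; lra.
        + apply Derive_correct, (HB (S n) x). }
    intros x. destruct (Req_dec x p) as [->|Hx]; [|now apply D].
    now apply is_derive_at_limit. }
  exists (G 0%nat). split.
  - apply (rsmooth_ind (fun g => exists i, g = G i)); [|now exists 0%nat].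
    intros g [i ->]. exists (G (S i)). split; eauto.
  - intros x Hx. unfold G. now destruct Rlt_dec.
Qed.

Definition rsmooth_on (U : R -> Prop) (f : R -> R) : Prop := forall n x, U x -> ex_derive_n f n x.

Lemma rsmooth_on_Derive U f : rsmooth_on U f -> rsmooth_on U (Derive f).
Proof. intros H n x Hx. apply ex_derive_n_Derive. now apply H. Qed.

Lemma rsmooth_on_mult U f g : open U ->
  rsmooth_on U f -> rsmooth_on U g -> rsmooth_on U (fun x => f x * g x).
Proof.
  intros HU Hf Hg n.
  assert (H : forall m f g, rsmooth_on U f -> rsmooth_on U g -> forall k (x : R),
            (k <= m)%nat -> U x -> ex_derive_n (fun x => f x * g x) k x);
    [|intros x; exact (H n f g Hf Hg n x (le_n n))].
  clear f g Hf Hg n. induction m as [|m IH]; intros f g Hf Hg k x Hk Hx.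
  - now replace k with 0%nat by lia.
  - destruct k as [|[|k]]; [easy| |].
    + apply @ex_derive_mult; [now apply (Hf 1%nat)|now apply (Hg 1%nat)].
    + assert (E : ex_derive_n (Derive (fun x => f x * g x)) (S k) x).
      { apply (ex_derive_n_ext_loc (fun y => Derive f y * g y + f y * Derive g y)).
        * apply filter_imp with (2 := HU x Hx). intros t Ht.
          rewrite Derive_mult; trivial; [now apply (Hf 1%nat)|now apply (Hg 1%nat)].
        * apply ex_derive_n_plus; apply filter_imp with (2 := HU x Hx); intros y Hy j Hj;
            apply IH; trivial; try lia; now apply rsmooth_on_Derive. }
      simpl in E |- *. apply (ex_derive_ext (Derive_n (Derive (fun x => f x * g x)) k)); trivial.
      intros t. symmetry. exact (Derive_n_S _ k t).
Qed.

Lemma left_germ (f : R -> R) p r (l : nat -> R) : 0 < r ->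
  rsmooth_on (fun x => p - 2 * r < x < p) f ->
  (forall n, filterlim (Derive_n f n) (at_left p) (locally (l n))) ->
  exists g, rsmooth g /\ forall x, p - r < x < p -> g x = f x.
Proof.
  intros Hr Hf Hl.
  (* The cutoff rises between [a] and [p - r], inside the interval on which [f] is smooth, so that
     the product extends by 0 to the left. *)
  set (a := p - 3 / 2 * r).
  destruct (extend_from_left (fun x => f x * ramp a (p - r) x) p l) as [g [Hg E]].
  - intros x n Hx. destruct (Rlt_le_dec x a) as [Ha|Ha].
    + apply (ex_derive_n_ext_loc (fun _ => 0)).
      * apply filter_imp with (fun y => y < a); [|now apply open_lt].
        intros y Hy. rewrite ramp_0; unfold a in *; lra.
      * apply rsmooth_const.
    + apply (rsmooth_on_mult (fun x => p - 2 * r < x < p)).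
      * apply open_and; [apply open_gt|apply open_lt].
      * exact Hf.
      * intros m y _. apply rsmooth_ramp.
      * unfold a in Ha. lra.
  - intros n. apply filterlim_ext_loc with (2 := Hl n).
    exists (mkposreal r Hr). intros y Hy Hyp. apply Rabs_lt_between in Hy.
    unfold minus, plus, opp in Hy. simpl in Hy.
    apply Derive_n_ext_loc. apply filter_imp with (fun z => p - r < z); [|apply open_gt; lra].
    intros z Hz. rewrite ramp_1; unfold a; lra.
  - exists g. split; trivial. intros x Hx. rewrite E by lra. rewrite ramp_1; unfold a; lra.
Qed.

Lemma filterlim_opp_at_left p : filterlim Ropp (at_left p) (at_right (- p)).
Proof.
  intros P [d Hd]. exists d. intros y Hy Hyp. apply Hd; [|lra].
  change (Rabs (- y - - p) < d). change (Rabs (y - p) < d) in Hy.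
  replace (- y - - p) with (- (y - p)) by ring. now rewrite Rabs_Ropp.
Qed.

(** Reflection of [left_germ]; the factor [(-1)^n] on the limits comes from differentiating
    [f (- x)]. *)
Lemma right_germ (f : R -> R) p r (l : nat -> R) : 0 < r ->
  rsmooth_on (fun x => p < x < p + 2 * r) f ->
  (forall n, filterlim (Derive_n f n) (at_right p) (locally (l n))) ->
  exists g, rsmooth g /\ forall x, p < x < p + r -> g x = f x.
Proof.
  intros Hr Hf Hl.
  assert (L : forall y, - p - 2 * r < y < - p ->
    locally (- y) (fun z => forall k : nat, ex_derive_n f k z)).
  { intros y Hy. apply filter_imp with (fun z => p < z < p + 2 * r).
    - intros z Hz k. now apply Hf.
    - apply (open_and _ _ (open_gt p) (open_lt (p + 2 * r))). lra. }
  destruct (left_germ (fun x => f (- x)) (- p) r (fun n => (-1) ^ n * l n)) as [g [Hg E]]; trivial.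
  - intros n x Hx. apply ex_derive_n_comp_opp.
    apply filter_imp with (2 := L x Hx). auto.
  - intros n. apply (filterlim_ext_loc (fun y => (-1) ^ n * Derive_n f n (- y))).
    + assert (H2 : 0 < 2 * r) by lra.
      exists (mkposreal _ H2). intros y Hy Hyp. apply Rabs_lt_between in Hy.
      unfold minus, plus, opp in Hy. simpl in Hy. symmetry. apply Derive_n_comp_opp.
      apply filter_imp with (2 := L y ltac:(lra)). auto.
    + apply (filterlim_comp _ _ _ (fun y => Derive_n f n (- y)) (fun z => (-1) ^ n * z)
        (at_left (- p)) (locally (l n)) (locally ((-1) ^ n * l n))).
      * apply (filterlim_comp _ _ _ Ropp (Derive_n f n) (at_left (- p)) (at_right p) _); trivial.
        replace p with (- - p) at 2 by ring. apply filterlim_opp_at_left.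
      * apply (filterlim_scal_r ((-1) ^ n) (l n)).
  - exists (fun x => g (- x)). split; [now apply rsmooth_comp_opp|].
    intros x Hx. rewrite E by lra. f_equal. ring.
Qed.

Lemma isolated (l : list R) p : exists r, 0 < r /\ forall x, In x l -> x <> p -> r <= Rabs (x - p).
Proof.
  induction l as [|y l [r [Hr IH]]].
  - exists 1. split; [lra|easy].
  - destruct (Req_dec y p) as [->|Hy].
    + exists r. split; trivial. intros x [<-|Hx] Hp; [easy|auto].
    + assert (A : 0 < Rabs (y - p)) by (apply Rabs_pos_lt; lra).
      exists (Rmin r (Rabs (y - p))). split; [now apply Rmin_pos|].
      intros x [<-|Hx] Hp; [apply Rmin_r|].
      apply Rle_trans with (1 := Rmin_l _ _). auto.
Qed.

(** At a point outside the exceptional list continuity supplies the one-sided limits, so [p] is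
    arbitrary. Real and imaginary parts are extended separately. *)
Lemma pw_germs (f : pwsmooth) p : exists r (gm gp : smooth), 0 < r /\
  (forall x, p - r < x < p -> f x = gm x) /\ (forall x, p < x < p + r -> f x = gp x).
Proof.
  destruct (pwP f) as [l [H1 H2]].
  destruct (isolated l p) as [r0 [Hr0 Hr]].
  (* Half the gap to the other exceptional points, since the germ lemmas ask for smoothness on a
     length [2 r]. *)
  set (r := r0 / 2).
  assert (Hr' : 0 < r) by (unfold r; lra).
  assert (Sm : forall x, x <> p -> Rabs (x - p) < 2 * r -> ~ In x l).
  { intros x Hx Hd Hin. specialize (Hr x Hin Hx). unfold r in Hd. lra. }
  assert (Lim : forall n,
    (exists L, filterlim (Cderive_n f n) (at_left p) (@locally C_UniformSpace L)) /\
    (exists L, filterlim (Cderive_n f n) (at_right p) (@locally C_UniformSpace L))).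
  { intros n. destruct (in_dec Req_EM_T p l) as [Hp|Hp]; [now apply H2|].
    assert (Cn : continuous (Cderive_n f n) p).
    { destruct (H1 p Hp (S n)). apply Ccontinuous_comp; now apply @ex_derive_continuous. }
    apply (continuous_lims_at _ _ Cn). }
  destruct (choice_function nat C (fun n L => filterlim (Cderive_n f n) (at_left p)
    (@locally C_UniformSpace L)) (fun n => proj1 (Lim n))) as [lm Hm].
  destruct (choice_function nat C (fun n L => filterlim (Cderive_n f n) (at_right p)
    (@locally C_UniformSpace L)) (fun n => proj2 (Lim n))) as [lp Hp].
  destruct (left_germ (fun x => Re (f x)) p r (fun n => fst (lm n))) as [g1 [G1 E1]]; trivial.
  { intros n x Hx. apply H1, Sm; [lra|]. unfold Rabs. destruct Rcase_abs; lra. }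
  { intros n. apply (Cfilterlim_fst (at_left p) _ _ (Hm n)). }
  destruct (left_germ (fun x => Im (f x)) p r (fun n => snd (lm n))) as [g2 [G2 E2]]; trivial.
  { intros n x Hx. apply H1, Sm; [lra|]. unfold Rabs. destruct Rcase_abs; lra. }
  { intros n. apply (Cfilterlim_snd (at_left p) _ _ (Hm n)). }
  destruct (right_germ (fun x => Re (f x)) p r (fun n => fst (lp n))) as [g3 [G3 E3]]; trivial.
  { intros n x Hx. apply H1, Sm; [lra|]. unfold Rabs. destruct Rcase_abs; lra. }
  { intros n. apply (Cfilterlim_fst (at_right p) _ _ (Hp n)). }
  destruct (right_germ (fun x => Im (f x)) p r (fun n => snd (lp n))) as [g4 [G4 E4]]; trivial.
  { intros n x Hx. apply H1, Sm; [lra|]. unfold Rabs. destruct Rcase_abs; lra. }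
  { intros n. apply (Cfilterlim_snd (at_right p) _ _ (Hp n)). }
  exists r, (Smooth (fun x => (g1 x, g2 x)) (is_smooth_comp (fun x => (g1 x, g2 x)) G1 G2)),
    (Smooth (fun x => (g3 x, g4 x)) (is_smooth_comp (fun x => (g3 x, g4 x)) G3 G4)).
  repeat split; trivial; intros x Hx; simpl.
  - rewrite E1, E2 by trivial. now destruct (f x).
  - rewrite E3, E4 by trivial. now destruct (f x).
Qed.

(** * Smooth complex functions and regular distributions *)

Lemma smooth_ext (f g : smooth) : (forall x, f x = g x) -> f = g.
Proof.
  destruct f as [f Hf], g as [g Hg]. simpl. intros E.
  apply functional_extensionality in E. subst g. now rewrite (proof_irrelevance _ Hf Hg).
Qed.

Definition is_cderive (f g : R -> C) : Prop := forall x,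
  is_derive (fun t => Re (f t)) x (Re (g x)) /\ is_derive (fun t => Im (f t)) x (Im (g x)).

Lemma is_cderive_unique f g x : is_cderive f g -> Cderive_n f 1 x = g x.
Proof.
  intros H. destruct (H x) as [H1 H2].
  apply injective_projections; [exact (is_derive_unique _ _ _ H1)|exact (is_derive_unique _ _ _ H2)].
Qed.

Lemma is_cderive_smooth f : is_smooth f -> is_cderive f (Cderive_n f 1).
Proof. intros H x. split; apply Derive_correct, (H 1%nat x). Qed.

Lemma is_smooth_ind (S : (R -> C) -> Prop) :
  (forall f, S f -> exists g, S g /\ is_cderive f g) -> forall f, S f -> is_smooth f.
Proof.
  intros H f Hf. apply is_smooth_comp.
  - apply (rsmooth_ind (fun u => exists f, S f /\ u = fun t => Re (f t))); [|now exists f].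
    intros u [h [Hh ->]]. destruct (H h Hh) as [g [Hg D]].
    exists (fun t => Re (g t)). split; [now exists g|]. intros x. apply D.
  - apply (rsmooth_ind (fun u => exists f, S f /\ u = fun t => Im (f t))); [|now exists f].
    intros u [h [Hh ->]]. destruct (H h Hh) as [g [Hg D]].
    exists (fun t => Im (g t)). split; [now exists g|]. intros x. apply D.
Qed.

Definition sadd (f g : smooth) : smooth :=
  Smooth (fun x => f x + g x)%C (is_smooth_plus _ _ (smoothP f) (smoothP g)).
Definition smul (f g : smooth) : smooth :=
  Smooth (fun x => f x * g x)%C (is_smooth_mult _ _ (smoothP f) (smoothP g)).
(** Encoded as a product with a constant, so that [dmul_reg] and [dmul_const] turn it into a scalar
    multiple of a distribution. *)
Definition sopp (f : smooth) : smooth := smul (csmooth (- (1))%C) f.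
Definition sder (f : smooth) : smooth :=
  Smooth (Cderive_n f 1) (is_smooth_Cderive _ (smoothP f)).
Definition sshift (h : R) (f : smooth) : smooth :=
  Smooth (fun x => f (x + h)) (is_smooth_shift _ h (smoothP f)).
Definition stest (t : test) : smooth := Smooth t (test_smooth t).
Definition sreal (f : R -> R) (Hf : rsmooth f) : smooth :=
  Smooth (fun x => RtoC (f x)) (is_smooth_comp (fun x => RtoC (f x)) Hf (rsmooth_const 0)).

Lemma is_smooth_Cinv f : is_smooth f -> (forall x, f x <> 0%C) -> is_smooth (fun x => / f x)%C.
Proof.
  intros Hf H0.
  assert (H1 := is_smooth_Re _ Hf). assert (H2 := is_smooth_Im _ Hf).
  assert (N : rsmooth (fun x => / (Re (f x) * Re (f x) + Im (f x) * Im (f x)))).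
  { apply rsmooth_inv; [apply rsmooth_plus; now apply rsmooth_mult|].
    intros x E. apply (H0 x). destruct (f x) as [a b]. simpl in E.
    apply injective_projections; simpl; nra. }
  apply is_smooth_comp.
  - assert (S := rsmooth_mult _ _ H1 N). intros n x.
    apply (ex_derive_n_ext _ _ n x) with (2 := S n x).
    intros t. unfold Cinv, Re, Im. simpl. unfold Rdiv. f_equal. f_equal. ring.
  - assert (S := rsmooth_mult _ _ (rsmooth_opp _ H2) N). intros n x.
    apply (ex_derive_n_ext _ _ n x) with (2 := S n x).
    intros t. unfold Cinv, Re, Im. simpl. unfold Rdiv. f_equal. f_equal. ring.
Qed.

Lemma sder_correct (f : smooth) : is_cderive f (sder f).
Proof. apply is_cderive_smooth, smoothP. Qed.

Lemma sder_add f g : sder (sadd f g) = sadd (sder f) (sder g).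
Proof. apply smooth_ext. intros x. apply Cderive_n_plus; apply smoothP. Qed.

Lemma sder_mul f g : sder (smul f g) = sadd (smul (sder f) g) (smul f (sder g)).
Proof. apply smooth_ext. intros x. apply Cderive_1_mult; apply smoothP. Qed.

Lemma sder_const c : sder (csmooth c) = csmooth 0.
Proof.
  apply smooth_ext. intros x. apply (is_cderive_unique _ (fun _ => 0%C)).
  intros y. split; simpl; apply @is_derive_const.
Qed.

Lemma sder_opp f : sder (sopp f) = sopp (sder f).
Proof.
  unfold sopp. rewrite sder_mul, sder_const. apply smooth_ext. intros x. simpl. ring.
Qed.

Lemma sder_shift h f : sder (sshift h f) = sshift h (sder f).
Proof.
  apply smooth_ext. intros x. unfold sder, sshift. simpl. unfold Cderive_n.
  f_equal; [apply (Derive_n_comp_trans (fun y => Re (f y)) 1 x h)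
           |apply (Derive_n_comp_trans (fun y => Im (f y)) 1 x h)].
Qed.

Lemma Cderive_n_sder (f : smooth) n x : Cderive_n f n x = Nat.iter n sder f x.
Proof.
  revert f. induction n as [|n IH]; intros f; [apply Cderive_n_0|].
  rewrite Nat.iter_succ_r, <- IH. symmetry. apply Cderive_n_S.
Qed.

Lemma sder_ext_at (f g : smooth) a b x : a < x < b ->
  (forall y, a < y < b -> f y = g y) -> sder f x = sder g x.
Proof.
  intros Hx E. simpl. unfold Cderive_n. simpl.
  assert (L : locally x (fun y => a < y < b))
    by apply (open_and _ _ (open_gt a) (open_lt b) x Hx).
  f_equal; apply Derive_ext_loc; apply filter_imp with (2 := L);
    intros y Hy; now rewrite E.
Qed.

Lemma sder_n_ext_on (f g : smooth) a b n :
  (forall y, a < y < b -> f y = g y) ->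
  forall y, a < y < b -> Nat.iter n sder f y = Nat.iter n sder g y.
Proof.
  intros E. induction n as [|n IH]; [exact E|]. intros y Hy. now apply sder_ext_at with a b.
Qed.

Lemma is_smooth_prim (f : smooth) :
  is_cderive (fun x => (RInt (fun t => Re (f t)) 0 x, RInt (fun t => Im (f t)) 0 x)) f.
Proof.
  assert (P : forall g, rsmooth g -> forall x, is_derive (fun x => RInt g 0 x) x (g x)).
  { intros g Hg x. apply (is_derive_RInt g _ 0).
    - apply filter_forall. intros y. apply (@RInt_correct R_CompleteNormedModule), (@ex_RInt_continuous R_CompleteNormedModule).
      intros z _. now apply rsmooth_continuous.
    - now apply rsmooth_continuous. }
  intros x. split; apply P; [apply is_smooth_Re|apply is_smooth_Im]; apply smoothP.
Qed.

Definition sprim (f : smooth) : smooth.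
Proof.
  (* The primitive together with all smooth functions forms a class closed under differentiation. *)
  refine (Smooth _ (is_smooth_ind (fun h => h = _ \/ is_smooth h) _
    (fun x => (RInt (fun t => Re (f t)) 0 x, RInt (fun t => Im (f t)) 0 x)) (or_introl eq_refl))).
  intros h [->|Hh].
  - exists f. split; [right; apply smoothP|apply is_smooth_prim].
  - exists (Cderive_n h 1). split; [right; now apply is_smooth_Cderive|now apply is_cderive_smooth].
Defined.

Lemma sder_prim f : sder (sprim f) = f.
Proof. apply smooth_ext. intros x. apply is_cderive_unique, is_smooth_prim. Qed.

Lemma smooth_const_on (f : smooth) a b : a <= b ->
  (forall x, a <= x <= b -> sder f x = 0%C) -> f a = f b.
Proof.
  intros [Hab| ->] H; [|easy]. assert (D := sder_correct f).
  apply injective_projections.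
  - apply (eq_is_derive (fun t => Re (f t)) a b); trivial. intros t Ht.
    destruct (D t) as [Dt _]. now rewrite H in Dt.
  - apply (eq_is_derive (fun t => Im (f t)) a b); trivial. intros t Ht.
    destruct (D t) as [_ Dt]. now rewrite H in Dt.
Qed.

Lemma is_RInt_sder (f : smooth) a b :
  @is_RInt C_R_NormedModule (sder f) a b (f b - f a)%C.
Proof.
  assert (D := sder_correct f). assert (S := smoothP (sder f)).
  apply (@is_RInt_fct_extend_pair R_NormedModule R_NormedModule).
  - apply (is_RInt_derive (fun t => Re (f t)) (fun t => Re (sder f t))); intros x _.
    + exact (proj1 (D x)).
    + apply (rsmooth_continuous _ (is_smooth_Re _ S)).
  - apply (is_RInt_derive (fun t => Im (f t)) (fun t => Im (sder f t))); intros x _.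
    + exact (proj2 (D x)).
    + apply (rsmooth_continuous _ (is_smooth_Im _ S)).
Qed.

Lemma test_bound_above (t : test) m : exists M, m < M /\ forall x, M <= Rabs x -> t x = 0%C.
Proof.
  destruct (test_compact t) as [M HM]. exists (Rmax M m + 1). split.
  - assert (A := Rmax_r M m). lra.
  - intros x Hx. apply HM. assert (A := Rmax_l M m). lra.
Qed.

(** Expresses the integral through values of primitives [P] and [Q]. Identities between regular
    distributions then reduce to identities between derivatives of primitives, without further work
    on integrals. *)
Lemma reg_sides (f : pwsmooth) p (gm gp P Q : smooth) (t : test) M :
  (forall x, x < p -> f x = gm x) -> (forall x, p < x -> f x = gp x) ->
  sder P = smul gm (stest t) -> sder Q = smul gp (stest t) ->
  Rabs p < M -> (forall x, M <= Rabs x -> t x = 0%C) ->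
  reg f t = ((P p - P (- M)%R) + (Q M - Q p))%C.
Proof.
  intros Hm Hp HP HQ HM Ht.
  assert (HM' : - M < p < M) by now apply Rabs_lt_between.
  assert (I := reg_fun_is_RInt f t M ltac:(lra) (fun x Hx => Ht x (Rlt_le _ _ Hx))).
  simpl. rewrite <- (@is_RInt_unique C_R_CompleteNormedModule _ _ _ _ I).
  apply (@is_RInt_unique C_R_CompleteNormedModule).
  apply (@is_RInt_Chasles C_R_NormedModule _ _ p).
  - apply is_RInt_ext with (sder P); [|apply is_RInt_sder].
    intros x. rewrite Rmin_left, Rmax_right by lra. intros Hx.
    rewrite HP, Hm by lra. reflexivity.
  - apply is_RInt_ext with (sder Q); [|apply is_RInt_sder].
    intros x. rewrite Rmin_left, Rmax_right by lra. intros Hx.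
    rewrite HQ, Hp by lra. reflexivity.
Qed.

Lemma reg_smooth_eval (f P : smooth) (t : test) M :
  sder P = smul f (stest t) -> 0 < M -> (forall x, M <= Rabs x -> t x = 0%C) ->
  reg (pw_of_smooth f) t = (P M - P (- M)%R)%C.
Proof.
  intros HP HM Ht.
  rewrite (reg_sides (pw_of_smooth f) 0 f f P P t M); trivial; [ring|now rewrite Rabs_R0].
Qed.

Lemma reg_two_sides (f : pwsmooth) p (gm gp : smooth) :
  (forall x, x < p -> f x = gm x) -> (forall x, p < x -> f x = gp x) ->
  reg f = dadd (dmul gm (reg (H_left p))) (dmul gp (reg (H_right p))).
Proof.
  intros Hm Hp. apply distr_ext. intros t.
  destruct (test_bound_above t (Rabs p)) as [M [HM Ht]].
  set (P := sprim (smul gm (stest t))). set (Q := sprim (smul gp (stest t))).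
  set (Z := csmooth 0).
  rewrite (reg_sides f p gm gp P Q t M); trivial; try apply sder_prim.
  change (dadd ?S ?T t) with (S t + T t)%C. change (dmul ?g ?S t) with (S (tmul g t)).
  rewrite (reg_sides (H_left p) p (csmooth 1) Z P Z (tmul gm t) M); trivial.
  - rewrite (reg_sides (H_right p) p Z (csmooth 1) Z Q (tmul gp t) M); trivial.
    + simpl. ring.
    + intros x Hx. simpl. unfold heaviside. destruct Rle_dec; [lra|easy].
    + intros x Hx. simpl. unfold heaviside. destruct Rle_dec; [easy|lra].
    + unfold Z. rewrite sder_const. apply smooth_ext. intros x. simpl. ring.
    + unfold Q. rewrite sder_prim. apply smooth_ext. intros x. simpl. ring.
    + intros x Hx. simpl. rewrite Ht by trivial. ring.
  - intros x Hx. simpl. unfold heaviside. destruct Rle_dec; [easy|lra].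
  - intros x Hx. simpl. unfold heaviside. destruct Rle_dec; [lra|easy].
  - unfold P. rewrite sder_prim. apply smooth_ext. intros x. simpl. ring.
  - unfold Z. rewrite sder_const. apply smooth_ext. intros x. simpl. ring.
  - intros x Hx. simpl. rewrite Ht by trivial. ring.
Qed.

Lemma reg_smooth_split p (f : smooth) :
  reg (pw_of_smooth f) = dadd (dmul f (reg (H_left p))) (dmul f (reg (H_right p))).
Proof. now apply reg_two_sides. Qed.

Lemma dderiv_dmul f T : dderiv (dmul f T) = dadd (dmul (sder f) T) (dmul f (dderiv T)).
Proof.
  apply distr_ext. intros t.
  change (- T (tmul f (tderiv t)) = T (tmul (sder f) t) + - T (tderiv (tmul f t)))%C.
  replace (tderiv (tmul f t)) with (tadd (tmul (sder f) t) (tmul f (tderiv t))).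
  - rewrite distr_add. ring.
  - apply test_ext. intros x. symmetry. exact (Cderive_1_mult f t x (smoothP f) (test_smooth t)).
Qed.

Lemma tderiv_bound_above (t : test) m : exists M, m < M /\
  forall x, M <= Rabs x -> t x = 0%C /\ tderiv t x = 0%C.
Proof.
  destruct (test_bound_above t m) as [M1 [HM1 H1]], (test_bound_above (tderiv t) m) as [M2 [HM2 H2]].
  exists (Rmax M1 M2). split; [apply Rlt_le_trans with (1 := HM1), Rmax_l|].
  intros x Hx. split; [apply H1|apply H2]; apply Rle_trans with (2 := Hx); [apply Rmax_l|apply Rmax_r].
Qed.

Lemma dderiv_H_left p : dderiv (reg (H_left p)) = dscal (- (1))%C (ddelta p).
Proof.
  apply distr_ext. intros t. destruct (tderiv_bound_above t (Rabs p)) as [M [HM Ht]].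
  assert (HM0 := Rabs_pos p).
  change (- reg (H_left p) (tderiv t) = - (1) * t p)%C.
  rewrite (reg_sides (H_left p) p (csmooth 1) (csmooth 0) (stest t) (csmooth 0) (tderiv t) M); trivial.
  - change (stest t p) with (t p). change (stest t (- M)%R) with (t (- M)%R).
    destruct (Ht (- M)) as [-> _]; [rewrite Rabs_Ropp, Rabs_pos_eq; lra|]. simpl. ring.
  - intros x Hx. simpl. unfold heaviside. destruct Rle_dec; [easy|lra].
  - intros x Hx. simpl. unfold heaviside. destruct Rle_dec; [lra|easy].
  - apply smooth_ext. intros x. simpl. ring.
  - rewrite sder_const. apply smooth_ext. intros x. simpl. ring.
  - intros x Hx. now apply Ht.
Qed.

Lemma dderiv_H_right p : dderiv (reg (H_right p)) = ddelta p.
Proof.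
  apply distr_ext. intros t. destruct (tderiv_bound_above t (Rabs p)) as [M [HM Ht]].
  assert (HM0 := Rabs_pos p).
  change (- reg (H_right p) (tderiv t) = t p)%C.
  rewrite (reg_sides (H_right p) p (csmooth 0) (csmooth 1) (csmooth 0) (stest t) (tderiv t) M); trivial.
  - change (stest t p) with (t p). change (stest t M) with (t M).
    destruct (Ht M) as [-> _]; [rewrite Rabs_pos_eq; lra|]. simpl. ring.
  - intros x Hx. simpl. unfold heaviside. destruct Rle_dec; [lra|easy].
  - intros x Hx. simpl. unfold heaviside. destruct Rle_dec; [easy|lra].
  - rewrite sder_const. apply smooth_ext. intros x. simpl. ring.
  - apply smooth_ext. intros x. simpl. ring.
  - intros x Hx. now apply Ht.
Qed.

Lemma dderiv_reg f : dderiv (reg (pw_of_smooth f)) = reg (pw_of_smooth (sder f)).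
Proof.
  apply distr_ext. intros t. destruct (tderiv_bound_above t 0) as [M [HM Ht]].
  change (- reg (pw_of_smooth f) (tderiv t) = reg (pw_of_smooth (sder f)) t)%C.
  set (P := sprim (smul (sder f) (stest t))).
  rewrite (reg_smooth_eval (sder f) P t M); trivial; [|apply sder_prim|intros x Hx; now apply Ht].
  (* Integration by parts: [f t'] has the primitive [f t - P], and [f t] vanishes at both ends. *)
  rewrite (reg_smooth_eval f (sadd (smul f (stest t)) (sopp P)) (tderiv t) M); trivial.
  - change (- ((f M * t M + - (1) * P M) - (f (-M)%R * t (-M)%R + - (1) * P (-M)%R)) = P M - P (-M)%R)%C.
    destruct (Ht M) as [-> _]; [rewrite Rabs_pos_eq; lra|].
    destruct (Ht (-M)) as [-> _]; [rewrite Rabs_Ropp, Rabs_pos_eq; lra|]. ring.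
  - unfold P. rewrite sder_add, sder_mul, sder_opp, sder_prim. apply smooth_ext. intros x. simpl. ring.
  - intros x Hx. now apply Ht.
Qed.

Lemma dmul_reg f g : dmul f (reg (pw_of_smooth g)) = reg (pw_of_smooth (smul f g)).
Proof.
  apply distr_ext. intros t. destruct (test_bound_above t 0) as [M [HM Ht]].
  set (P := sprim (smul (smul f g) (stest t))).
  change (reg (pw_of_smooth g) (tmul f t) = reg (pw_of_smooth (smul f g)) t).
  rewrite (reg_smooth_eval (smul f g) P t M); trivial; [|apply sder_prim].
  apply reg_smooth_eval; trivial.
  - unfold P. rewrite sder_prim. apply smooth_ext. intros x. simpl. ring.
  - intros x Hx. simpl. rewrite Ht by trivial. ring.
Qed.

Lemma dadd_eval S T t : dadd S T t = (S t + T t)%C.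
Proof. reflexivity. Qed.

Lemma dscal_eval c T t : dscal c T t = (c * T t)%C.
Proof. reflexivity. Qed.

Lemma dmul_eval f T t : dmul f T t = T (tmul f t).
Proof. reflexivity. Qed.

Lemma dderiv_eval T t : dderiv T t = (- T (tderiv t))%C.
Proof. reflexivity. Qed.

Lemma dzero_eval t : dzero t = 0%C.
Proof. reflexivity. Qed.

Ltac deval := repeat first [rewrite dadd_eval | rewrite dscal_eval | rewrite dmul_eval
  | rewrite dderiv_eval | rewrite dzero_eval].

(** * Local equality of distributions *)

(** Local equality on an arbitrary set, such as a half-line, with the support enclosed in a compact
    interval contained in [U]. On open intervals it coincides with [eq_on]. *)
Definition agree (U : R -> Prop) (S T : distr) : Prop :=
  forall (t : test) c d, (forall x, c <= x <= d -> U x) ->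
    (forall x, t x <> 0%C -> c <= x <= d) -> S t = T t.

Lemma agree_refl U S : agree U S S.
Proof. now intros t c d _ _. Qed.

Lemma agree_sym U S T : agree U S T -> agree U T S.
Proof. intros H t c d Hc Ht. symmetry. now apply (H t c d). Qed.

Lemma agree_trans U S T V : agree U S T -> agree U T V -> agree U S V.
Proof. intros H1 H2 t c d Hc Ht. rewrite (H1 t c d Hc Ht). now apply (H2 t c d). Qed.

Lemma agree_sub (U V : R -> Prop) S T : (forall x, V x -> U x) -> agree U S T -> agree V S T.
Proof. intros H A t c d Hc Ht. apply (A t c d); auto. Qed.

Lemma agree_dadd U S S' T T' : agree U S S' -> agree U T T' -> agree U (dadd S T) (dadd S' T').
Proof. intros H1 H2 t c d Hc Ht. simpl. now rewrite (H1 t c d Hc Ht), (H2 t c d Hc Ht). Qed.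

Lemma agree_dscal U k S S' : agree U S S' -> agree U (dscal k S) (dscal k S').
Proof. intros H1 t c d Hc Ht. simpl. now rewrite (H1 t c d Hc Ht). Qed.

Lemma tmul_supp (f : smooth) (t : test) x : tmul f t x <> 0%C -> t x <> 0%C.
Proof. intros H E. apply H. simpl. rewrite E. ring. Qed.

Lemma agree_dmul U f S S' : agree U S S' -> agree U (dmul f S) (dmul f S').
Proof. intros H1 t c d Hc Ht. apply (H1 _ c d Hc). intros x Hx. apply Ht. revert Hx. apply tmul_supp. Qed.

Lemma agree_dmul_fun U (f g : smooth) S : (forall x, U x -> f x = g x) -> agree U (dmul f S) (dmul g S).
Proof.
  intros H t c d Hc Ht. change (S (tmul f t) = S (tmul g t)). f_equal. apply test_ext. intros x. simpl.
  destruct (excluded_middle_informative (t x = 0%C)) as [E|E].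
  - rewrite E. ring.
  - rewrite H; auto.
Qed.

Lemma tderiv_supp (t : test) c d : (forall x, t x <> 0%C -> c <= x <= d) ->
  forall x, tderiv t x <> 0%C -> c <= x <= d.
Proof.
  intros Ht x Hx.
  assert (Z : forall y, y < c \/ d < y -> t y = 0%C).
  { intros y Hy. destruct (excluded_middle_informative (t y = 0%C)) as [E|E]; trivial.
    specialize (Ht y E). lra. }
  assert (E : forall a b, a < x < b -> (forall y, a < y < b -> t y = 0%C) -> False).
  { intros a b Hab E. apply Hx. change (sder (stest t) x = 0%C).
    rewrite (sder_ext_at (stest t) (csmooth 0) a b x Hab); [now rewrite sder_const|exact E]. }
  split; apply Rnot_lt_le; intros H.
  - apply (E (x - 1) c); [lra|]. intros y Hy. apply Z. lra.
  - apply (E d (x + 1)); [lra|]. intros y Hy. apply Z. lra.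
Qed.

Lemma agree_dderiv U S S' : agree U S S' -> agree U (dderiv S) (dderiv S').
Proof.
  intros H1 t c d Hc Ht. change (- S (tderiv t) = - S' (tderiv t))%C. f_equal.
  apply (H1 _ c d Hc). now apply tderiv_supp.
Qed.

Lemma agree_dderiv_n U n S S' : agree U S S' -> agree U (dderiv_n n S) (dderiv_n n S').
Proof. intros H. induction n as [|n IH]; [exact H|]. now apply agree_dderiv. Qed.

Lemma test_supp (t : test) : exists c d, c <= d /\ forall x, t x <> 0%C -> c <= x <= d.
Proof.
  destruct (test_bound t) as [M [HM H]]. exists (- M), M. split; [lra|]. intros x Hx.
  apply Rabs_le_between, Rnot_lt_le. intros Hlt. now apply Hx, H.
Qed.

Lemma agree_all S T : agree (fun _ => True) S T -> S = T.
Proof.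
  intros H. apply distr_ext. intros t. destruct (test_supp t) as [c [d [_ Ht]]].
  now apply (H t c d).
Qed.

Lemma distr_zero (S : distr) (t : test) : (forall x, t x = 0%C) -> S t = 0%C.
Proof.
  intros H. replace t with (tscal 0 t).
  - rewrite distr_scal. ring.
  - apply test_ext. intros x. simpl. rewrite H. ring.
Qed.

Lemma agree_eq_on a b S T : agree (fun x => a < x < b) S T <-> eq_on a b S T.
Proof.
  split.
  - intros H t [c [d [Hc [Hd Ht]]]]. apply (H t c d); trivial. intros x Hx. lra.
  - intros H t c d Hc Ht. destruct (Rle_lt_dec c d) as [L|L].
    + apply H. exists c, d. assert (A := Hc c). assert (B := Hc d). repeat split; try lra; now apply Ht.
    + assert (Z : forall x, t x = 0%C).
      { intros x. destruct (excluded_middle_informative (t x = 0%C)) as [E|E]; trivial.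
        specialize (Ht x E). lra. }
      now rewrite !distr_zero.
Qed.

Definition sramp a b : smooth := sreal (ramp a b) (rsmooth_ramp a b).
Definition splateau a b r : smooth := sreal (plateau a b r) (rsmooth_plateau a b r).

Lemma distr_split (S : distr) (f : smooth) (t : test) :
  S t = (S (tmul f t) + S (tmul (sadd (csmooth 1) (sopp f)) t))%C.
Proof. rewrite <- distr_add. f_equal. apply test_ext. intros x. simpl. ring. Qed.

(** Instead of a partition of unity, a supremum argument: let [m] be the supremum of the [y] such
    that [S] and [T] agree on test functions supported in [[c, y]]. Agreement near [m] pushes the
    bound past [m] unless [d] is already reached. *)
Lemma agree_local (U : R -> Prop) S T :
  (forall x, U x -> exists a b, a < x < b /\ agree (fun y => a < y < b) S T) -> agree U S T.
Proof.
  intros H t c d HU Ht. destruct (Rle_lt_dec c d) as [L|L].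
  2:{ rewrite !distr_zero; trivial; intros x;
      destruct (excluded_middle_informative (t x = 0%C)) as [E|E]; trivial; specialize (Ht x E); lra. }
  set (P := fun y => c <= y <= d /\ forall s : test, (forall x, s x <> 0%C -> c <= x <= y) -> S s = T s).
  assert (Pc : P c).
  { split; [lra|]. intros s Hs. destruct (H c (HU c ltac:(lra))) as [a [b [Hab A]]].
    apply (A s c c); trivial. intros x Hx. lra. }
  destruct (completeness P) as [m [Hm1 Hm2]].
  { exists d. intros y [Hy _]. lra. }
  { now exists c. }
  assert (Hcm : c <= m <= d).
  { split; [now apply Hm1|]. apply Hm2. intros y [Hy _]. lra. }
  destruct (H m (HU m Hcm)) as [a [b [Hab A]]].
  assert (E : exists y, P y /\ a < y <= m).
  { apply Classical_Prop.NNPP. intros N. assert (m <= a); [|lra]. apply Hm2. intros y Hy.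
    apply Rnot_lt_le. intros Hay. apply N. exists y. repeat split; try apply Hy; trivial. now apply Hm1. }
  destruct E as [y [[Hy Py] Hay]].
  (* A cutoff rising between [a'] and [y] splits a test function supported in [[c, z]] into one
     supported near [m] and one supported in [[c, y]]. *)
  assert (Q : forall z, c <= z <= d -> z < b -> P z).
  { intros z Hz Hzb. split; trivial. intros s Hs.
    set (a' := (a + y) / 2). set (f := sramp a' y).
    rewrite (distr_split S f s), (distr_split T f s). f_equal.
    - apply (A _ a' z); [intros x Hx; unfold a' in *; lra|].
      intros x Hx. assert (Hx' := Hs x (tmul_supp _ _ _ Hx)). split; [|lra].
      apply Rnot_lt_le. intros Hlt. apply Hx. simpl. rewrite ramp_0; unfold a' in *; try lra. ring.
    - apply Py. intros x Hx. assert (Hx' := Hs x (tmul_supp _ _ _ Hx)). split; [lra|].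
      apply Rnot_lt_le. intros Hlt. apply Hx. simpl. rewrite ramp_1; unfold a'; try lra. ring. }
  destruct (Rlt_le_dec d b) as [Hdb|Hdb].
  - now apply (Q d).
  - assert (P ((m + b) / 2)) by (apply Q; lra). specialize (Hm1 _ H0). lra.
Qed.

Arguments reg : simpl never.

(** Equal real parts at the ends would make the monotone real part constant in between, against the
    positive derivative at [x]. *)
Lemma increasing_strict (P : smooth) a b x : a < x < b ->
  (forall y, 0 <= Re (sder P y)) -> 0 < Re (sder P x) -> Re (P a) < Re (P b).
Proof.
  intros Hx Hpos Hp. assert (D := sder_correct P).
  assert (I : forall u v, u <= v -> Re (P u) <= Re (P v)).
  { intros u v Huv.
    destruct (MVT_gen (fun t => Re (P t)) u v (fun t => Re (sder P t))) as [c [_ E]].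
    - intros y _. exact (proj1 (D y)).
    - intros y _. apply continuity_pt_filterlim, (@ex_derive_continuous _ _ (fun t => Re (P t))).
      exists (Re (sder P y)). exact (proj1 (D y)).
    - specialize (Hpos c). nra. }
  destruct (Rle_lt_or_eq_dec _ _ (I a b ltac:(lra))) as [H|H]; trivial. exfalso.
  enough (Re (sder P x) = 0) by lra.
  destruct (D x) as [Dx _]. rewrite <- (is_derive_unique _ _ _ Dx).
  rewrite (Derive_ext_loc _ (fun _ => Re (P a))); [apply Derive_const|].
  apply filter_imp with (fun y => a < y < b);
    [|apply (open_and _ _ (open_gt a) (open_lt b)); trivial].
  intros y Hy. assert (A := I a y ltac:(lra)). assert (B := I y b ltac:(lra)). lra.
Qed.

Lemma smooth_eq_left_closure (f g : smooth) a c : a < c ->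
  (forall x, a < x < c -> f x = g x) -> f c = g c.
Proof.
  intros Hac E.
  apply (@filterlim_locally_unique R R_AbsRing C_R_NormedModule (at_left c) _ g).
  - apply filterlim_ext_loc with f.
    + assert (Hd : 0 < c - a) by lra. exists (mkposreal _ Hd). intros y Hy Hyc.
      apply Rabs_lt_between in Hy. unfold minus, plus, opp in Hy. simpl in Hy. apply E. lra.
    + intros P HP. apply at_left_locally. exact (is_smooth_continuous f (smoothP f) c P HP).
  - intros P HP. apply at_left_locally. exact (is_smooth_continuous g (smoothP g) c P HP).
Qed.

Lemma smooth_eq_right_closure (f g : smooth) c b : c < b ->
  (forall x, c < x < b -> f x = g x) -> f c = g c.
Proof.
  intros Hac E.
  apply (@filterlim_locally_unique R R_AbsRing C_R_NormedModule (at_right c) _ g).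
  - apply filterlim_ext_loc with f.
    + assert (Hd : 0 < b - c) by lra. exists (mkposreal _ Hd). intros y Hy Hyc.
      apply Rabs_lt_between in Hy. unfold minus, plus, opp in Hy. simpl in Hy. apply E. lra.
    + intros P HP. apply at_right_locally. exact (is_smooth_continuous f (smoothP f) c P HP).
  - intros P HP. apply at_right_locally. exact (is_smooth_continuous g (smoothP g) c P HP).
Qed.

Lemma plateau_supp a b r x : 0 < r -> plateau a b r x <> 0 -> a - r <= x <= b + r.
Proof.
  intros Hr Hx. split; apply Rnot_lt_le; intros H; apply Hx, plateau_0; trivial; lra.
Qed.

Lemma splateau_compact a b r : 0 < r -> compact_support (splateau a b r).
Proof.
  intros Hr. exists (Rabs a + Rabs b + r). intros x Hx. simpl. f_equal. apply plateau_0; trivial.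
  revert Hx. unfold Rabs. repeat destruct Rcase_abs; lra.
Qed.

Definition bump (a b : R) (r : posreal) : test :=
  Test (splateau a b r) (smoothP _) (splateau_compact a b r (cond_pos r)).

(** Tested against its conjugate times a squared cutoff, [h] gives an integrand with nonnegative
    real part, positive at [x] if [h x] is nonzero. The square makes the sign evident. *)
Lemma smooth_zero_on (h : smooth) a b :
  agree (fun x => a < x < b) (reg (pw_of_smooth h)) dzero -> forall x, a < x < b -> h x = 0%C.
Proof.
  intros H x Hx. destruct (excluded_middle_informative (h x = 0%C)) as [E|E]; trivial. exfalso.
  assert (Hr : 0 < Rmin (x - a) (b - x) / 2) by (apply Rdiv_lt_0_compat; [apply Rmin_pos|]; lra).
  set (r := mkposreal _ Hr).
  assert (Hr1 : 2 * r <= x - a) by (simpl; assert (A := Rmin_l (x - a) (b - x)); lra).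
  assert (Hr2 : 2 * r <= b - x) by (simpl; assert (A := Rmin_r (x - a) (b - x)); lra).
  assert (Hc : is_smooth (fun y => Cconj (h y))).
  { apply is_smooth_comp; simpl; [apply is_smooth_Re, smoothP|].
    apply rsmooth_opp, is_smooth_Im, smoothP. }
  set (t := tmul (Smooth _ Hc) (tmul (splateau x x r) (bump x x r))).
  assert (Hs : forall y, t y <> 0%C -> x - r <= y <= x + r).
  { intros y Hy. apply plateau_supp; [apply cond_pos|]. intros E'. apply Hy. simpl in E' |- *. rewrite E'. ring. }
  assert (Z : reg (pw_of_smooth h) t = 0%C).
  { apply (H t (x - r) (x + r)); trivial. assert (A := cond_pos r). intros y Hy. lra. }
  destruct (test_bound_above t (Rabs x)) as [M [HM Ht]].
  assert (HM0 := Rabs_pos x). assert (HM1 := proj1 (Rabs_lt_between _ _) HM).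
  set (P := sprim (smul h (stest t))).
  rewrite (reg_smooth_eval h P t M) in Z; trivial; try lra; [|apply sder_prim].
  assert (D : forall y, Re (sder P y) = (Re (h y) ^ 2 + Im (h y) ^ 2) * (plateau x x r y) ^ 2).
  { intros y. unfold P. rewrite sder_prim. simpl. unfold Re, Im. ring. }
  assert (L : Re (P (- M)) < Re (P M)).
  { apply increasing_strict with x; trivial.
    - intros y. rewrite D. apply Rmult_le_pos; [|apply pow2_ge_0].
      apply Rplus_le_le_0_compat; apply pow2_ge_0.
    - rewrite D, plateau_1 by (try apply cond_pos; lra).
      enough (0 < Re (h x) ^ 2 + Im (h x) ^ 2) by lra.
      assert (A := pow2_ge_0 (Re (h x))). assert (B := pow2_ge_0 (Im (h x))).
      destruct (Req_dec (Re (h x)) 0) as [E1|E1].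
      + destruct (Req_dec (Im (h x)) 0) as [E2|E2].
        * elim E. now apply injective_projections.
        * assert (C := pow2_gt_0 _ E2). lra.
      + assert (C := pow2_gt_0 _ E1). lra. }
  apply (f_equal Re) in Z. change (Re (P M) + - Re (P (- M)) = 0) in Z. lra.
Qed.

Lemma reg_add f g : reg (pw_of_smooth (sadd f g)) = dadd (reg (pw_of_smooth f)) (reg (pw_of_smooth g)).
Proof.
  apply distr_ext. intros t. destruct (test_bound_above t 0) as [M [HM Ht]].
  set (P := sprim (smul f (stest t))). set (Q := sprim (smul g (stest t))).
  change (reg (pw_of_smooth (sadd f g)) t = reg (pw_of_smooth f) t + reg (pw_of_smooth g) t)%C.
  rewrite (reg_smooth_eval f P t M), (reg_smooth_eval g Q t M), (reg_smooth_eval _ (sadd P Q) t M);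
    trivial; try apply sder_prim.
  - simpl. ring.
  - rewrite sder_add. unfold P, Q. rewrite !sder_prim. apply smooth_ext. intros x. simpl. ring.
Qed.

Lemma dmul_const c T : dmul (csmooth c) T = dscal c T.
Proof. apply distr_ext. intros t. exact (distr_scal T c t). Qed.

Lemma dmul_dmul f g T : dmul f (dmul g T) = dmul (smul f g) T.
Proof.
  apply distr_ext. intros t. change (T (tmul g (tmul f t)) = T (tmul (smul f g) t)).
  f_equal. apply test_ext. intros x. simpl. ring.
Qed.

Lemma dmul_sadd f g T : dmul (sadd f g) T = dadd (dmul f T) (dmul g T).
Proof.
  apply distr_ext. intros t. change (T (tmul (sadd f g) t) = T (tmul f t) + T (tmul g t))%C.
  rewrite <- distr_add. f_equal. apply test_ext. intros x. simpl. ring.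
Qed.

Lemma smooth_agree_on (f g : smooth) a b :
  agree (fun x => a < x < b) (reg (pw_of_smooth f)) (reg (pw_of_smooth g)) ->
  forall x, a < x < b -> f x = g x.
Proof.
  intros H x Hx. enough (E : sadd f (sopp g) x = 0%C).
  { simpl in E. replace (f x) with (f x + - (1) * g x + g x)%C by ring. rewrite E. ring. }
  apply (smooth_zero_on _ a b); trivial.
  intros t c d Hc Ht. unfold sopp. rewrite reg_add, <- dmul_reg, dmul_const.
  deval. rewrite (H t c d Hc Ht). ring.
Qed.

Lemma agree_reg U (f g : smooth) : (forall x, U x -> f x = g x) ->
  agree U (reg (pw_of_smooth f)) (reg (pw_of_smooth g)).
Proof.
  intros E. assert (R : forall h, reg (pw_of_smooth h) = dmul h (reg (pw_of_smooth (csmooth 1)))).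
  { intros h. rewrite dmul_reg. do 2 f_equal. apply smooth_ext. intros x. simpl. ring. }
  rewrite (R f), (R g). now apply agree_dmul_fun.
Qed.

(** * Distributions with zero or smooth derivative *)

Definition convex (U : R -> Prop) : Prop := forall c d x, U c -> U d -> c <= x <= d -> U x.

(** A test function with zero integral is the derivative of a test function, hence is annihilated by
    [T]. Every [t] differs from a multiple of a fixed [rho0] with nonzero integral by such a
    function, so [T t] is proportional to the integral of [t]. The ball gives room for [rho0], and
    convexity keeps the support of the primitive in [U]. *)
Lemma derivative_zero U x0 (r : posreal) T : convex U -> (forall x, Rabs (x - x0) <= r -> U x) ->
  agree U (dderiv T) dzero -> exists c, agree U T (reg (pw_of_smooth (csmooth c))).
Proof.
  intros HU Hx0 HT.
  set (I := reg (pw_of_smooth (csmooth 1))).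
  set (b := bump x0 x0 r). set (rho0 := tmul (splateau x0 x0 r) b).
  assert (Hs0 : forall y, rho0 y <> 0%C -> x0 - r <= y <= x0 + r).
  { intros y Hy. apply plateau_supp; [apply cond_pos|]. intros E'. apply Hy. simpl in E' |- *. rewrite E'. ring. }
  assert (I0 : I rho0 <> 0%C).
  { destruct (test_bound_above rho0 (Rabs x0)) as [M [HM Ht]].
    assert (HM0 := Rabs_pos x0). assert (HM1 := proj1 (Rabs_lt_between _ _) HM).
    set (P := sprim (smul (csmooth 1) (stest rho0))). unfold I.
    rewrite (reg_smooth_eval _ P rho0 M); trivial; try lra; [|apply sder_prim].
    assert (D : forall y, Re (sder P y) = (plateau x0 x0 r y) ^ 2).
    { intros y. unfold P. rewrite sder_prim. simpl. ring. }
    assert (L : Re (P (- M)) < Re (P M)).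
    { apply increasing_strict with x0; trivial.
      - intros y. rewrite D. apply pow2_ge_0.
      - rewrite D, plateau_1 by (try apply cond_pos; lra). lra. }
    intros E. apply (f_equal Re) in E. change (Re (P M) + - Re (P (- M)) = 0) in E. lra. }
  set (c := (T rho0 / I rho0)%C). exists c.
  intros t c0 d0 Hc Ht.
  replace (reg (pw_of_smooth (csmooth c)) t) with (c * I t)%C.
  2:{ unfold I. rewrite <- (distr_scal (reg (pw_of_smooth (csmooth 1)))).
      change (dmul (csmooth c) (reg (pw_of_smooth (csmooth 1))) t = reg (pw_of_smooth (csmooth c)) t).
      rewrite dmul_reg. do 3 f_equal. apply smooth_ext. intros x. simpl. ring. }
  destruct (Rle_lt_dec c0 d0) as [L|L].
  2:{ assert (Z : forall x, t x = 0%C).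
      { intros x. destruct (excluded_middle_informative (t x = 0%C)) as [E|E]; trivial.
        specialize (Ht x E). lra. }
      rewrite !distr_zero by trivial. ring. }
  set (k := (- (I t / I rho0))%C). set (s := tadd t (tscal k rho0)).
  assert (Is : I s = 0%C).
  { unfold s. rewrite distr_add, distr_scal. unfold k. field. trivial. }
  set (c1 := Rmin c0 (x0 - r)). set (d1 := Rmax d0 (x0 + r)).
  assert (Hr := cond_pos r).
  assert (H1 : c1 <= c0 /\ c1 <= x0 - r) by (split; [apply Rmin_l|apply Rmin_r]).
  assert (H2 : d0 <= d1 /\ x0 + r <= d1) by (split; [apply Rmax_l|apply Rmax_r]).
  assert (Hs : forall x, x <= c1 \/ d1 <= x -> x <> c1 -> x <> d1 -> s x = 0%C).
  { intros x Hx N1 N2. simpl.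
    destruct (excluded_middle_informative (t x = 0%C)) as [->|E]; [|specialize (Ht x E); lra].
    destruct (excluded_middle_informative (rho0 x = 0%C)) as [E'|E']; [|specialize (Hs0 x E'); lra].
    simpl in E'. rewrite E'. ring. }
  (* At the end points [c1] and [d1], which the closed supports may reach, [s] vanishes by
     continuity. *)
  assert (Hs1 : forall x, x <= c1 \/ d1 <= x -> s x = 0%C).
  { intros x Hx. destruct (Req_dec x c1) as [->|N1].
    - apply (smooth_eq_left_closure (stest s) (csmooth 0) (c1 - 1)); [lra|].
      intros y Hy. apply Hs; lra.
    - destruct (Req_dec x d1) as [->|N2]; [|now apply Hs].
      apply (smooth_eq_right_closure (stest s) (csmooth 0) d1 (d1 + 1)); [lra|].
      intros y Hy. apply Hs; lra. }
  set (P := sprim (stest s)).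
  assert (P1 : forall x, x <= c1 -> P x = P c1).
  { intros x Hx. apply smooth_const_on; trivial. intros y Hy. unfold P. rewrite sder_prim.
    apply Hs1. lra. }
  assert (P2 : forall x, d1 <= x -> P x = P d1).
  { intros x Hx. symmetry. apply smooth_const_on; trivial. intros y Hy. unfold P. rewrite sder_prim.
    apply Hs1. lra. }
  assert (E : P c1 = P d1).
  { destruct (test_bound_above s (Rabs c1 + Rabs d1)) as [M [HM HsM]].
    assert (A := Rabs_pos c1). assert (B := Rabs_pos d1).
    unfold I in Is. rewrite (reg_smooth_eval _ P s M) in Is; trivial; try lra.
    - assert (A1 := Rle_abs d1). assert (A2 := Rle_abs (- c1)). rewrite Rabs_Ropp in A2.
      rewrite (P1 (- M)), (P2 M) in Is by lra.
      replace (P d1) with (P d1 - P c1 + P c1)%C by ring. rewrite Is. ring.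
    - unfold P. rewrite sder_prim. apply smooth_ext. intros x. simpl. ring. }
  (* The primitive of [s] vanishing up to [c1]; as the integral of [s] is 0, it also vanishes from
     [d1] on and is a test function. *)
  set (q := sadd P (csmooth (- P c1)%C)).
  assert (Hq : forall x, x <= c1 \/ d1 <= x -> q x = 0%C).
  { intros x Hx. change (P x + - P c1 = 0)%C.
    destruct Hx as [Hx|Hx]; [rewrite P1 by trivial|rewrite P2, <- E by trivial]; ring. }
  assert (Kq : compact_support q).
  { exists (Rabs c1 + Rabs d1). intros x Hx. apply Hq. revert Hx.
    unfold Rabs. repeat destruct Rcase_abs; lra. }
  set (tq := Test q (smoothP q) Kq).
  assert (Dq : tderiv tq = s).
  { apply test_ext. intros x. change (sder q x = s x). unfold q, P.
    rewrite sder_add, sder_prim, sder_const. simpl. ring. }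
  assert (Z : T s = 0%C).
  { rewrite <- Dq. replace (T (tderiv tq)) with (- (dderiv T tq))%C by (deval; ring).
    rewrite (HT tq c1 d1); [deval; ring| |].
    - intros x Hx. apply (HU c1 d1); trivial.
      + unfold c1, Rmin. destruct Rle_dec; [apply Hc; lra|].
        apply Hx0. unfold Rabs. destruct Rcase_abs; lra.
      + unfold d1, Rmax. destruct Rle_dec; [|apply Hc; lra].
        apply Hx0. unfold Rabs. destruct Rcase_abs; lra.
    - intros x Hx. split; apply Rnot_lt_le; intros Hlt; apply Hx, Hq; lra. }
  unfold s in Z. rewrite distr_add, distr_scal in Z.
  replace (T t) with (T t + k * T rho0 - k * T rho0)%C by ring. rewrite Z.
  unfold k, c. field. trivial.
Qed.

Lemma regular_antiderivative U x0 (r : posreal) T (f : smooth) :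
  convex U -> (forall x, Rabs (x - x0) <= r -> U x) ->
  agree U (dderiv T) (reg (pw_of_smooth f)) ->
  exists g, sder g = f /\ agree U T (reg (pw_of_smooth g)).
Proof.
  intros HU Hx0 HT.
  destruct (derivative_zero U x0 r (dadd T (reg (pw_of_smooth (sopp (sprim f))))) HU Hx0) as [c Hc].
  - apply agree_trans with (dadd (reg (pw_of_smooth f)) (reg (pw_of_smooth (sopp f)))).
    + replace (reg (pw_of_smooth (sopp f))) with (dderiv (reg (pw_of_smooth (sopp (sprim f)))))
        by (now rewrite dderiv_reg, sder_opp, sder_prim).
      intros t c d Hc Ht. specialize (HT t c d Hc Ht). deval. rewrite <- HT, dderiv_eval. ring.
    + rewrite <- reg_add. intros t c d _ _. unfold sopp.
      rewrite reg_add, <- dmul_reg, dmul_const. deval. ring.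
  - exists (sadd (sprim f) (csmooth c)). split.
    + rewrite sder_add, sder_prim, sder_const. apply smooth_ext. intros x. simpl. ring.
    + rewrite reg_add. intros t c0 d Hc0 Ht. specialize (Hc t c0 d Hc0 Ht).
      unfold sopp in Hc. rewrite <- dmul_reg, dmul_const in Hc. revert Hc. deval. intros <-. ring.
Qed.

(** * Translations and the product *)

Lemma sder_n_add n f g : Nat.iter n sder (sadd f g) = sadd (Nat.iter n sder f) (Nat.iter n sder g).
Proof. induction n as [|n IH]; [easy|]. simpl Nat.iter. now rewrite IH, sder_add. Qed.

Lemma sder_n_scal n c f :
  Nat.iter n sder (smul (csmooth c) f) = smul (csmooth c) (Nat.iter n sder f).
Proof.
  induction n as [|n IH]; [easy|]. simpl Nat.iter. rewrite IH, sder_mul, sder_const.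
  apply smooth_ext. intros x. simpl. ring.
Qed.

Lemma sder_n_shift n h f : Nat.iter n sder (sshift h f) = sshift h (Nat.iter n sder f).
Proof. induction n as [|n IH]; [easy|]. simpl Nat.iter. now rewrite IH, sder_shift. Qed.

Definition tsub (s t : test) : test := tadd s (tscal (- (1)) t).

Lemma distr_tsub (T : distr) s t : T (tsub s t) = (T s - T t)%C.
Proof. unfold tsub. rewrite distr_add, distr_scal. ring. Qed.

Lemma Cmod_le_sum (z : C) : Cmod z <= Rabs (Re z) + Rabs (Im z).
Proof.
  destruct z as [a b]. unfold Cmod. simpl.
  assert (A := Rabs_pos a). assert (B := Rabs_pos b).
  rewrite <- (sqrt_Rsqr (Rabs a + Rabs b)) by lra. apply sqrt_le_1_alt.
  unfold Rsqr. assert (E1 := Rabs_mult a a). assert (E2 := Rabs_mult b b).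
  rewrite Rabs_pos_eq in E1, E2 by nra. nra.
Qed.

Lemma Cmod_components (z : C) : Rabs (Re z) <= Cmod z /\ Rabs (Im z) <= Cmod z.
Proof.
  assert (Z := Rmax_Cmod z). split; apply Rle_trans with (2 := Z); [apply Rmax_l|apply Rmax_r].
Qed.

Lemma test_bounded (t : test) n : exists B, 0 < B /\ forall x, Cmod (Cderive_n t n x) <= B.
Proof.
  destruct (test_compact t) as [M HM].
  destruct (smooth_bounded (Nat.iter n sder (stest t)) M (smoothP _)) as [B [HB H]].
  exists B. split; trivial. intros x. destruct (Rle_lt_dec (Rabs x) M) as [Hx|Hx].
  - change (Cderive_n t n x) with (Cderive_n (stest t) n x). rewrite Cderive_n_sder. auto.
  - rewrite (Cderive_n_compact t M); trivial. rewrite Cmod_0. lra.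
Qed.

Lemma Lipschitz_smooth (f : smooth) B : (forall x, Cmod (sder f x) <= B) ->
  forall x y, Cmod (f x - f y)%C <= 2 * B * Rabs (x - y).
Proof.
  intros H x y. assert (D := sder_correct f).
  apply Rle_trans with (1 := Cmod_le_sum _).
  assert (L : forall u v : R -> R, (forall z, is_derive u z (v z)) -> (forall z, Rabs (v z) <= B) ->
    Rabs (u x - u y) <= B * Rabs (x - y)).
  { intros u v Du Hv. destruct (MVT_gen u y x v) as [c [_ E]].
    - intros z _. apply Du.
    - intros z _. apply continuity_pt_filterlim, (@ex_derive_continuous _ _ u). eexists. apply Du.
    - rewrite E, Rabs_mult. apply Rmult_le_compat_r; [apply Rabs_pos|apply Hv]. }
  assert (L1 := L (fun t => Re (f t)) (fun t => Re (sder f t)) (fun z => proj1 (D z))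
    (fun z => Rle_trans _ _ _ (proj1 (Cmod_components _)) (H z))).
  assert (L2 := L (fun t => Im (f t)) (fun t => Im (sder f t)) (fun z => proj2 (D z))
    (fun z => Rle_trans _ _ _ (proj2 (Cmod_components _)) (H z))).
  change (Rabs (Re (f x) - Re (f y)) + Rabs (Im (f x) - Im (f y)) <= 2 * B * Rabs (x - y)). lra.
Qed.

(** By the mean value theorem the derivative of order [n] of the difference is at most [2 B |e k|],
    with [B] a bound for the derivative of order [n + 1]; the 2 comes from treating real and
    imaginary parts separately. *)
Lemma tshift_cvg0 (t : test) (e : nat -> R) : (forall n, Rabs (e n) < / INR (S n)) ->
  test_cvg0 (fun n => tsub (tshift (e n) t) t).
Proof.
  intros He. split.
  - destruct (test_compact t) as [M HM]. exists (M + 1). intros k x Hx. simpl.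
    assert (E : Rabs (e k) < 1).
    { apply Rlt_le_trans with (1 := He k). rewrite <- Rinv_1. apply Rinv_le_contravar; [lra|].
      rewrite S_INR. assert (A := pos_INR k). lra. }
    rewrite !HM; [ring|lra|]. assert (A := Rabs_triang_inv x (e k)). lra.
  - intros n eps Heps. destruct (test_bounded t (S n)) as [B [HB H]].
    destruct (archimed_cor1 (eps / (2 * B))) as [N [HN HN0]].
    { apply Rdiv_lt_0_compat; lra. }
    exists N. intros k Hk x.
    set (f := Nat.iter n sder (stest t)).
    replace (Cderive_n (tsub (tshift (e k) t) t) n x) with (f (x - e k)%R - f x)%C.
    + apply Rle_lt_trans with (2 * B * Rabs (x - e k - x)).
      * apply Lipschitz_smooth. intros y. specialize (H y).
        change (Cderive_n t (S n) y) with (Cderive_n (stest t) (S n) y) in H.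
        now rewrite Cderive_n_sder in H.
      * replace (x - e k - x) with (- e k) by ring. rewrite Rabs_Ropp.
        apply Rlt_le_trans with (2 * B * (eps / (2 * B))); [|right; field; lra].
        apply Rmult_lt_compat_l; [lra|].
        apply Rlt_le_trans with (1 := He k). apply Rle_trans with (/ INR N); [|lra].
        apply Rinv_le_contravar; [apply lt_0_INR; lia|apply le_INR; lia].
    + transitivity (Cderive_n (sadd (sshift (- e k) (stest t)) (smul (csmooth (- (1))) (stest t))) n x);
        [|reflexivity].
      rewrite Cderive_n_sder, sder_n_add, sder_n_scal, sder_n_shift. fold f. simpl.
      unfold Rminus. ring.
Qed.

(** Continuity of a distribution is sequential by definition, so a failure of the limit is first
    turned into a sequence of translations tending to 0, to which [tshift_cvg0] applies. *)
Lemma tshift_continuous (T : distr) (t : test) :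
  filterlim (fun h => T (tshift h t)) (locally 0) (@locally C_UniformSpace (T t)).
Proof.
  apply Classical_Prop.NNPP. intros N.
  assert (E : exists eps, 0 < eps /\ forall d, 0 < d -> exists h, Rabs h < d /\
    eps <= Cmod (T (tshift h t) - T t)%C).
  { apply Classical_Prop.NNPP. intros N'. apply N. apply filterlim_locally. intros eps.
    apply Classical_Prop.NNPP. intros N2. apply N'. exists eps. split; [apply cond_pos|].
    intros d Hd. apply Classical_Prop.NNPP. intros N3. apply N2. exists (mkposreal d Hd).
    intros h Hh. change (Rabs (h - 0) < d) in Hh. rewrite Rminus_0_r in Hh.
    assert (L : Cmod (T (tshift h t) - T t)%C < eps).
    { apply Rnot_le_lt. intros N4. apply N3. now exists h. }
    assert (Z := Rmax_Cmod (T (tshift h t) - T t)%C).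
    split.
    - change (Rabs (fst (T (tshift h t) - T t)%C) < eps).
      apply Rle_lt_trans with (2 := L), Rle_trans with (2 := Z), Rmax_l.
    - change (Rabs (snd (T (tshift h t) - T t)%C) < eps).
      apply Rle_lt_trans with (2 := L), Rle_trans with (2 := Z), Rmax_r. }
  destruct E as [eps [Heps E]].
  assert (E' : forall n, exists h, Rabs h < / INR (S n) /\ eps <= Cmod (T (tshift h t) - T t)%C).
  { intros n. apply E, Rinv_0_lt_compat, lt_0_INR. lia. }
  destruct (choice_function _ _ _ E') as [e He].
  destruct (proj1 (Ccvg0_eps _) (distr_cont T _ (tshift_cvg0 t e (fun n => proj1 (He n)))) eps Heps)
    as [N' HN'].
  specialize (HN' N' (le_n _)). rewrite distr_tsub in HN'.
  destruct (He N') as [_ H]. lra.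
Qed.

Lemma filterlim_at_right_0 (u : R -> C) l :
  filterlim u (locally 0) (@locally C_UniformSpace l) ->
  filterlim u (at_right 0) (@locally C_UniformSpace l).
Proof. intros H P HP. apply at_right_locally. exact (H P HP). Qed.

(** The roles are exchanged: with [G] a compactly supported copy of [g], the function
    [g (x + h) t x] is a translate of [G] multiplied by [t]. Continuity of translations is then
    applied to the distribution [t T] and the test function [G]. The cutoff equals 1 one unit beyond
    the support bound of [t], which leaves room for [|h| < 1]. *)
Lemma smul_shift_continuous (T : distr) (g : smooth) (t : test) :
  filterlim (fun h => T (tmul (sshift h g) t)) (at_right 0) (@locally C_UniformSpace (T (tmul g t))).
Proof.
  destruct (test_bound t) as [M [HM Ht]].
  set (G := tmul g (bump (- M - 1) (M + 1) (mkposreal _ Rlt_0_1))).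
  assert (E : forall h, Rabs h < 1 -> tmul (sshift h g) t = tmul (stest t) (tshift (- h) G)).
  { intros h Hh. apply test_ext. intros x. simpl. unfold Rminus. rewrite Ropp_involutive.
    destruct (Rle_lt_dec (Rabs x) M) as [Hx|Hx].
    - rewrite plateau_1; [ring|lra|]. apply Rabs_le_between in Hx. apply Rabs_lt_between in Hh. lra.
    - rewrite Ht by trivial. ring. }
  replace (T (tmul g t)) with (dmul (stest t) T G).
  2:{ deval. f_equal. apply test_ext. intros x. simpl.
      destruct (Rle_lt_dec (Rabs x) M) as [Hx|Hx].
      - rewrite plateau_1; [ring|lra|]. apply Rabs_le_between in Hx. lra.
      - rewrite Ht by trivial. ring. }
  apply filterlim_at_right_0.
  apply (filterlim_ext_loc (fun h => dmul (stest t) T (tshift (- h) G))).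
  - exists (mkposreal _ Rlt_0_1). intros h Hh. change (Rabs (h - 0) < 1) in Hh.
    rewrite Rminus_0_r in Hh. deval. now rewrite E.
  - apply (filterlim_comp _ _ _ Ropp (fun h => dmul (stest t) T (tshift h G)) (locally 0) (locally 0)).
    + rewrite <- Ropp_0 at 2. apply (@filterlim_opp R_AbsRing R_NormedModule 0).
    + apply tshift_continuous.
Qed.

Lemma Cfilterlim_plus (F : (R -> Prop) -> Prop) {FF : Filter F} (f g : R -> C) (L K : C) :
  filterlim f F (@locally C_UniformSpace L) -> filterlim g F (@locally C_UniformSpace K) ->
  filterlim (fun t => f t + g t)%C F (@locally C_UniformSpace (L + K)%C).
Proof.
  intros Hf Hg. apply (filterlim_comp_2 f g Cplus Hf Hg).
  exact (@filterlim_plus R_AbsRing C_R_NormedModule L K).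
Qed.

Lemma Cfilterlim_unique (f : R -> C) (L K : C) :
  filterlim f (at_right 0) (@locally C_UniformSpace L) ->
  filterlim f (at_right 0) (@locally C_UniformSpace K) -> L = K.
Proof. apply (@filterlim_locally_unique R R_AbsRing C_R_NormedModule (at_right 0) _ f). Qed.

Lemma dshift_eval h T t : dshift h T t = T (tshift h t).
Proof. reflexivity. Qed.

Lemma dshift_reg h g : dshift h (reg (pw_of_smooth g)) = reg (pw_of_smooth (sshift h g)).
Proof.
  apply distr_ext. intros t. rewrite dshift_eval.
  destruct (test_bound_above t 0) as [M [HM Ht]].
  set (P := sprim (smul g (stest (tshift h t)))).
  assert (A := Rabs_pos h).
  (* Beyond the support of the translated test function [P] is constant, so the end points [M + h]
     and [- M + h] may be moved out to [N] and [- N]. *)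
  assert (Z : forall x, M <= Rabs x -> P (x + h) = P ((if Rle_dec 0 x then M else - M) + h)).
  { assert (D : forall y, M <= Rabs (y - h) -> sder P y = 0%C).
    { intros y Hy. unfold P. rewrite sder_prim. simpl. rewrite Ht by trivial. ring. }
    intros x Hx. destruct (Rle_dec 0 x) as [H0|H0].
    - rewrite Rabs_pos_eq in Hx by lra. symmetry. apply smooth_const_on; [lra|].
      intros y Hy. apply D. rewrite Rabs_pos_eq; lra.
    - rewrite Rabs_left in Hx by lra. apply smooth_const_on; [lra|].
      intros y Hy. apply D. rewrite Rabs_left1; lra. }
  set (N := M + Rabs h).
  rewrite (reg_smooth_eval g P (tshift h t) N); [|apply sder_prim|unfold N; lra|].
  - rewrite (reg_smooth_eval (sshift h g) (sshift h P) t M); trivial.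
    + assert (B := Rle_abs h). assert (B' := Rle_abs (- h)). rewrite Rabs_Ropp in B'.
      assert (Z1 := Z (N - h)). assert (Z2 := Z (- N - h)). unfold N in *.
      change (P (M + Rabs h)%R - P (- (M + Rabs h))%R = P (M + h)%R - P (- M + h)%R)%C.
      destruct (Rle_dec 0 (M + Rabs h - h)); [|lra].
      destruct (Rle_dec 0 (- (M + Rabs h) - h)); [lra|].
      replace (M + Rabs h - h + h) with (M + Rabs h) in Z1 by ring.
      replace (- (M + Rabs h) - h + h) with (- (M + Rabs h)) in Z2 by ring.
      rewrite Z1, Z2; [easy| |]; unfold Rabs at 1; destruct Rcase_abs; lra.
    + rewrite sder_shift. unfold P. rewrite sder_prim. apply smooth_ext. intros x. simpl.
      now replace (x + h - h) with x by ring.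
  - intros x Hx. simpl. apply Ht. unfold N in Hx. assert (B := Rabs_triang_inv x h). lra.
Qed.

Lemma agree_dshift U h S T : agree U S T -> agree (fun x => U (x + h)) (dshift h S) (dshift h T).
Proof.
  intros H t c d Hc Ht. rewrite !dshift_eval. apply (H _ (c + h) (d + h)).
  - intros x Hx. replace x with (x - h + h) by ring. apply Hc. lra.
  - intros x Hx. specialize (Ht (x - h) Hx). lra.
Qed.

(** * Uniqueness of the local product and of the limit *)

Lemma is_hprod_intro F G P :
  (forall x, exists a b, a < x < b /\
    ((exists f, agree (fun y => a < y < b) F (reg (pw_of_smooth f)) /\
        agree (fun y => a < y < b) P (dmul f G)) \/
     (exists g, agree (fun y => a < y < b) G (reg (pw_of_smooth g)) /\
        agree (fun y => a < y < b) P (dmul g F)))) -> is_hprod F G P.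
Proof.
  intros H x. destruct (H x) as [a [b [Hx [[f [H1 H2]]|[f [H1 H2]]]]]]; exists a, b; split; trivial;
    [left|right]; exists f; split; now apply agree_eq_on.
Qed.

Lemma is_hprod_sym F G P : is_hprod F G P -> is_hprod G F P.
Proof. intros H x. destruct (H x) as [a [b [Hx [H'|H']]]]; exists a, b; auto. Qed.

Lemma interval_inter a b c d x : a < x < b -> c < x < d ->
  exists a' b', a' < x < b' /\ forall y, a' < y < b' -> a < y < b /\ c < y < d.
Proof.
  intros H1 H2. exists (Rmax a c), (Rmin b d). split.
  - split; [apply Rmax_lub_lt|apply Rmin_glb_lt]; lra.
  - intros y [Hy1 Hy2]. assert (A := Rmax_l a c). assert (B := Rmax_r a c).
    assert (A' := Rmin_l b d). assert (B' := Rmin_r b d). lra.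
Qed.

(** Two smooth representatives of [F] coincide on an interval. Where the product was formed with [G]
    as the smooth factor, both factors are smooth and the pointwise product is commutative. *)
Lemma hprod_left F G P f a b : is_hprod F G P ->
  agree (fun x => a < x < b) F (reg (pw_of_smooth f)) -> agree (fun x => a < x < b) P (dmul f G).
Proof.
  intros HP HF. apply agree_local. intros x Hx.
  destruct (HP x) as [c [d [Hcd [[f' [H1 H2]]|[g [H1 H2]]]]]];
    apply agree_eq_on in H1, H2; destruct (interval_inter a b c d x Hx Hcd) as [a' [b' [Hx' I]]];
    exists a', b'; split; trivial;
    apply (agree_sub _ (fun y => a' < y < b')) in H1, H2, HF; try (intros y Hy; now apply I).
  - apply agree_trans with (1 := H2). apply agree_dmul_fun. apply smooth_agree_on.
    apply agree_trans with (2 := HF). now apply agree_sym.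
  - apply agree_trans with (1 := H2).
    apply agree_trans with (1 := agree_dmul _ g _ _ HF).
    apply agree_sym. apply agree_trans with (1 := agree_dmul _ f _ _ H1).
    rewrite !dmul_reg. apply agree_reg. intros y _. simpl. ring.
Qed.

Lemma hprod_unique F G P P' : is_hprod F G P -> is_hprod F G P' -> P = P'.
Proof.
  intros H H'. apply agree_all, agree_local. intros x _.
  destruct (H x) as [c [d [Hcd [[f [H1 H2]]|[g [H1 H2]]]]]]; apply agree_eq_on in H1, H2;
    exists c, d; split; trivial; apply agree_trans with (1 := H2); apply agree_sym.
  - now apply (hprod_left F G).
  - apply (hprod_left G F); trivial. now apply is_hprod_sym.
Qed.

Lemma is_star_unique F G P P' : is_star F G P -> is_star F G P' -> P = P'.
Proof.
  intros [Q [H1 H2]] [Q' [H1' H2']]. apply distr_ext. intros t.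
  apply (Cfilterlim_unique (fun eps => Q eps t)); [apply H2|].
  apply filterlim_ext_loc with (2 := H2' t).
  generalize (filter_and _ _ H1 H1'). apply filter_imp. intros eps [A B].
  now rewrite (hprod_unique _ _ _ _ A B).
Qed.

(** Uniqueness of the limit identifies the value chosen by [epsilon] with any limit that has been
    exhibited. *)
Lemma star_eq F G P : is_star F G P -> star F G = P.
Proof.
  intros H. apply (is_star_unique F G); trivial.
  unfold star. apply epsilon_spec. now exists P.
Qed.

(** * The product with a factor smooth on both sides of a point *)

Definition dminus_reg (F : distr) (f : smooth) : distr :=
  dadd F (dscal (- (1)) (reg (pw_of_smooth f))).

(** For [S = k G] this is the product of [F] and [G] both where [F = k] and where [G = g]. *)
Definition glued (g k : smooth) (F S : distr) : distr := dadd (dmul g (dminus_reg F k)) S.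

Lemma glued_regular U g k F S : agree U F (reg (pw_of_smooth k)) -> agree U (glued g k F S) S.
Proof.
  intros H t c d Hc Ht. unfold glued, dminus_reg. deval. rewrite (H (tmul g t) c d Hc); [ring|].
  intros x Hx. apply Ht. revert Hx. apply tmul_supp.
Qed.

Lemma glued_product U g k F G : agree U G (reg (pw_of_smooth g)) ->
  agree U (glued g k F (dmul k G)) (dmul g F).
Proof.
  intros H t c d Hc Ht. unfold glued, dminus_reg. deval.
  rewrite (H (tmul k t) c d Hc).
  - change (reg (pw_of_smooth g) (tmul k t)) with (dmul k (reg (pw_of_smooth g)) t).
    change (reg (pw_of_smooth k) (tmul g t)) with (dmul g (reg (pw_of_smooth k)) t).
    rewrite !dmul_reg. replace (smul k g) with (smul g k); [ring|].
    apply smooth_ext. intros x. simpl. ring.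
  - intros x Hx. apply Ht. revert Hx. apply tmul_supp.
Qed.

Lemma is_star_intro (F G P : distr) (Q : R -> distr) r : 0 < r ->
  (forall eps, 0 < eps < r -> is_hprod F (dshift eps G) (Q eps)) ->
  (forall t, filterlim (fun eps => Q eps t) (at_right 0) (@locally C_UniformSpace (P t))) ->
  is_star F G P.
Proof.
  intros Hr H1 H2. exists Q. split; trivial. exists (mkposreal r Hr). intros y Hy Hy0.
  apply H1. change (Rabs (y - 0) < r) in Hy. rewrite Rminus_0_r, Rabs_pos_eq in Hy; lra.
Qed.

(** Three overlapping zones cover the line: [F = k] on [x < p], the translated [G] is smooth on
    [(p - eps, p + r - eps)], and [F = k] again beyond [p + r2]. The overlap on the right requires
    [eps < r - r2]. On each zone [glued] is the product, and both of its terms converge as [eps]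
    tends to 0. *)
Lemma is_star_one_sided F G (k g : smooth) p r r2 : 0 < r2 < r ->
  agree (fun x => x < p) F (reg (pw_of_smooth k)) ->
  agree (fun x => p + r2 < x) F (reg (pw_of_smooth k)) ->
  agree (fun x => p < x < p + r) G (reg (pw_of_smooth g)) ->
  is_star F G (glued g k F (dmul k G)).
Proof.
  intros Hr HF1 HF2 HG.
  apply (is_star_intro F G _ (fun eps => glued (sshift eps g) k F (dmul k (dshift eps G))) (r - r2)); [lra| |].
  - intros eps He. apply is_hprod_intro. intros x.
    destruct (Rlt_le_dec x p) as [Hx|Hx]; [|destruct (Rlt_le_dec x (p + r - eps)) as [Hx'|Hx']].
    + exists (x - 1), p. split; [lra|]. left. exists k. split.
      * apply agree_sub with (2 := HF1). intros y Hy. lra.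
      * apply glued_regular. apply agree_sub with (2 := HF1). intros y Hy. lra.
    + exists (p - eps), (p + r - eps). split; [lra|]. right. exists (sshift eps g).
      assert (A : agree (fun y => p - eps < y < p + r - eps) (dshift eps G) (reg (pw_of_smooth (sshift eps g)))).
      { rewrite <- dshift_reg. apply agree_sub with (2 := agree_dshift _ eps _ _ HG). intros y Hy. lra. }
      split; trivial. now apply glued_product.
    + exists (p + r2), (x + 1). split; [lra|]. left. exists k. split.
      * apply agree_sub with (2 := HF2). intros y Hy. lra.
      * apply glued_regular. apply agree_sub with (2 := HF2). intros y Hy. lra.
  - intros t. unfold glued, dminus_reg. rewrite dadd_eval, dmul_eval.
    refine (Cfilterlim_plus (at_right 0) _ _ _ _ _ _).
    + apply smul_shift_continuous.
    + rewrite dmul_eval. apply filterlim_at_right_0, tshift_continuous.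
Qed.

(** Mirror image, in which [F] is the translated factor: the zones of [F] and the function [k] now
    move with [eps], while [g] stays fixed. *)
Lemma is_star_one_sided' F G (k g : smooth) p r r2 : 0 < r2 < r ->
  agree (fun x => p < x) F (reg (pw_of_smooth k)) ->
  agree (fun x => x < p - r2) F (reg (pw_of_smooth k)) ->
  agree (fun x => p - r < x < p) G (reg (pw_of_smooth g)) ->
  is_star G F (glued g k F (dmul k G)).
Proof.
  intros Hr HF1 HF2 HG.
  apply (is_star_intro G F _ (fun eps => glued g (sshift eps k) (dshift eps F) (dmul (sshift eps k) G)) (r - r2)); [lra| |].
  - intros eps He. apply is_hprod_sym, is_hprod_intro. intros x.
    assert (A1 := agree_dshift _ eps _ _ HF1). assert (A2 := agree_dshift _ eps _ _ HF2).
    rewrite dshift_reg in A1, A2.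
    destruct (Rlt_le_dec x p) as [Hx|Hx]; [destruct (Rlt_le_dec (p - r) x) as [Hx'|Hx']|].
    + exists (p - r), p. split; [lra|]. right. exists g. split; trivial.
      now apply glued_product.
    + exists (x - 1), (p - r2 - eps). split; [lra|]. left. exists (sshift eps k). split.
      * apply agree_sub with (2 := A2). intros y Hy. lra.
      * apply glued_regular. apply agree_sub with (2 := A2). intros y Hy. lra.
    + exists (p - eps), (x + 1). split; [lra|]. left. exists (sshift eps k). split.
      * apply agree_sub with (2 := A1). intros y Hy. lra.
      * apply glued_regular. apply agree_sub with (2 := A1). intros y Hy. lra.
  - intros t. unfold glued, dminus_reg.
    apply filterlim_ext with (fun eps => (dshift eps (dadd F (dscal (- (1)) (reg (pw_of_smooth k)))) (tmul g t)
      + G (tmul (sshift eps k) t))%C).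
    { intros eps. deval. rewrite <- dshift_reg. reflexivity. }
    rewrite dadd_eval, !dmul_eval. refine (Cfilterlim_plus (at_right 0) _ _ _ _ _ _).
    + apply filterlim_at_right_0, tshift_continuous.
    + apply smul_shift_continuous.
Qed.

Definition interp (p a b : R) (fm fp : smooth) : smooth :=
  sadd fm (smul (sramp (p + a) (p + b)) (sadd fp (sopp fm))).

Lemma interp_left p a b fm fp x : a < b -> x <= p + a -> interp p a b fm fp x = fm x.
Proof. intros Hab Hx. simpl. rewrite ramp_0 by lra. ring. Qed.

Lemma interp_right p a b fm fp x : a < b -> p + b <= x -> interp p a b fm fp x = fp x.
Proof. intros Hab Hx. simpl. rewrite ramp_1 by lra. ring. Qed.

Definition sided (p : R) (F : distr) (fm fp : smooth) : Prop :=
  agree (fun x => x < p) F (reg (pw_of_smooth fm)) /\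
  agree (fun x => p < x) F (reg (pw_of_smooth fp)).

Definition germs (p : R) (G : distr) (gm gp : smooth) (r : R) : Prop :=
  agree (fun x => p - r < x < p) G (reg (pw_of_smooth gm)) /\
  agree (fun x => p < x < p + r) G (reg (pw_of_smooth gp)).

Lemma agree_reg_pw (U : R -> Prop) (f g : pwsmooth) : (forall x, U x -> f x = g x) -> agree U (reg f) (reg g).
Proof.
  intros H t c d Hc Ht. change (reg_fun f t = reg_fun g t). unfold reg_fun. f_equal.
  apply functional_extensionality. intros x.
  destruct (excluded_middle_informative (t x = 0%C)) as [E|E].
  - rewrite E. ring.
  - now rewrite H by (apply Hc, Ht, E).
Qed.

Lemma dderiv_n_reg n f : dderiv_n n (reg (pw_of_smooth f)) = reg (pw_of_smooth (Nat.iter n sder f)).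
Proof.
  induction n as [|n IH]; [easy|]. change (dderiv (dderiv_n n (reg (pw_of_smooth f))) =
    reg (pw_of_smooth (sder (Nat.iter n sder f)))). now rewrite IH, dderiv_reg.
Qed.

Lemma Aspace_germs G p : Aspace G -> exists r gm gp, 0 < r /\ germs p G gm gp r.
Proof.
  intros [f [n ->]]. destruct (pw_germs f p) as [r [gm [gp [Hr [Em Ep]]]]].
  exists r, (Nat.iter n sder gm), (Nat.iter n sder gp). split; trivial.
  split; rewrite <- dderiv_n_reg; apply agree_dderiv_n, agree_reg_pw; trivial.
Qed.

Lemma agree_dmul_reg U f F k : agree U F (reg (pw_of_smooth k)) ->
  agree U (dmul f F) (dmul k (reg (pw_of_smooth f))).
Proof.
  intros H. apply agree_trans with (1 := agree_dmul _ f _ _ H). rewrite !dmul_reg.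
  apply agree_reg. intros x _. simpl. ring.
Qed.

Lemma star_sided_A p F fm fp G : sided p F fm fp -> Aspace G ->
  agree (fun x => x < p) (star F G) (dmul fm G) /\
  agree (fun x => p < x) (star F G) (dmul fp G).
Proof.
  intros [H1 H2] HG. destruct (Aspace_germs G p HG) as [r [gm [gp [Hr [Gm Gp]]]]].
  (* [G] is known to be [gp] only up to distance [r], so the passage from [fm] to [fp] is completed
     at distance [r / 2]. *)
  set (k := interp p (r / 4) (r / 2) fm fp).
  assert (K1 : agree (fun x => x < p) F (reg (pw_of_smooth k))).
  { apply agree_trans with (1 := H1). apply agree_reg. intros x Hx. unfold k. rewrite interp_left; lra || easy. }
  assert (K2 : agree (fun x => p + r / 2 < x) F (reg (pw_of_smooth k))).
  { apply agree_trans with (reg (pw_of_smooth fp)); [apply agree_sub with (2 := H2); intros x Hx; lra|].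
    apply agree_reg. intros x Hx. unfold k. rewrite interp_right; lra || easy. }
  rewrite (star_eq F G (glued gp k F (dmul k G))).
  2:{ apply (is_star_one_sided F G k gp p r (r / 2)); trivial. lra. }
  split.
  - apply agree_trans with (1 := glued_regular _ _ _ _ _ K1). apply agree_dmul_fun.
    intros x Hx. unfold k. rewrite interp_left; lra || easy.
  - apply agree_local. intros x Hx. destruct (Rlt_le_dec x (p + r)) as [Hx'|Hx'].
    + exists p, (p + r). split; [lra|]. apply agree_trans with (1 := glued_product _ _ _ _ _ Gp).
      apply agree_trans with (dmul fp (reg (pw_of_smooth gp))).
      * apply agree_dmul_reg. apply agree_sub with (2 := H2). intros y Hy. lra.
      * apply agree_dmul, agree_sym, Gp.
    + exists (p + r / 2), (x + 1). split; [lra|].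
      apply agree_trans with (dmul k G).
      * apply glued_regular. apply agree_sub with (2 := K2). intros y Hy. lra.
      * apply agree_dmul_fun. intros y Hy. unfold k. rewrite interp_right; lra || easy.
Qed.

Lemma star_A_sided p F fm fp G : sided p F fm fp -> Aspace G ->
  agree (fun x => x < p) (star G F) (dmul fm G) /\
  agree (fun x => p < x) (star G F) (dmul fp G).
Proof.
  intros [H1 H2] HG. destruct (Aspace_germs G p HG) as [r [gm [gp [Hr [Gm Gp]]]]].
  (* Translating [F] by [eps] moves its singular point to the left of [p], where [gm] represents
     [G]; the passage from [fm] to [fp] takes place on that side. *)
  set (k := interp p (- (r / 2)) (- (r / 4)) fm fp).
  assert (K1 : agree (fun x => p < x) F (reg (pw_of_smooth k))).
  { apply agree_trans with (1 := H2). apply agree_reg. intros x Hx. unfold k. rewrite interp_right; lra || easy. }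
  assert (K2 : agree (fun x => x < p - r / 2) F (reg (pw_of_smooth k))).
  { apply agree_trans with (reg (pw_of_smooth fm)); [apply agree_sub with (2 := H1); intros x Hx; lra|].
    apply agree_reg. intros x Hx. unfold k. rewrite interp_left; lra || easy. }
  rewrite (star_eq G F (glued gm k F (dmul k G))).
  2:{ apply (is_star_one_sided' F G k gm p r (r / 2)); trivial. lra. }
  split.
  - apply agree_local. intros x Hx. destruct (Rlt_le_dec (p - r) x) as [Hx'|Hx'].
    + exists (p - r), p. split; [lra|]. apply agree_trans with (1 := glued_product _ _ _ _ _ Gm).
      apply agree_trans with (dmul fm (reg (pw_of_smooth gm))).
      * apply agree_dmul_reg. apply agree_sub with (2 := H1). intros y Hy. lra.
      * apply agree_dmul, agree_sym, Gm.
    + exists (x - 1), (p - r / 2). split; [lra|].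
      apply agree_trans with (dmul k G).
      * apply glued_regular. apply agree_sub with (2 := K2). intros y Hy. lra.
      * apply agree_dmul_fun. intros y Hy. unfold k. rewrite interp_left; lra || easy.
  - apply agree_trans with (1 := glued_regular _ _ _ _ _ K1). apply agree_dmul_fun.
    intros x Hx. unfold k. rewrite interp_right; lra || easy.
Qed.

(** Here [gp] represents [G] on the whole right half-line, and there [glued] equals [gp F] for every
    [k]. The interpolating function may therefore be replaced by [fm], with which it coincides on
    the left and near [p]. *)
Lemma star_sided p F fm fp G gm gp : sided p F fm fp -> sided p G gm gp ->
  star F G = dadd (dmul gp (dminus_reg F fm)) (dmul fm G).
Proof.
  intros [H1 H2] [G1 G2]. apply star_eq. fold (glued gp fm F (dmul fm G)).
  set (k := interp p 1 2 fm fp).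
  replace (glued gp fm F (dmul fm G)) with (glued gp k F (dmul k G)).
  - apply (is_star_one_sided F G k gp p 3 2); [lra|..].
    + apply agree_trans with (1 := H1). apply agree_reg. intros x Hx. unfold k. rewrite interp_left; lra || easy.
    + apply agree_trans with (reg (pw_of_smooth fp)); [apply agree_sub with (2 := H2); intros x Hx; lra|].
      apply agree_reg. intros x Hx. unfold k. rewrite interp_right; lra || easy.
    + apply agree_sub with (2 := G2). intros x Hx. lra.
  - apply agree_all, agree_local. intros x _. destruct (Rlt_le_dec p x) as [Hx|Hx].
    + exists p, (x + 1). split; [lra|].
      assert (A : agree (fun y => p < y < x + 1) G (reg (pw_of_smooth gp))).
      { apply agree_sub with (2 := G2). intros y Hy. lra. }
      apply agree_trans with (1 := glued_product _ _ _ _ _ A).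
      apply agree_sym, glued_product, A.
    + exists (x - 1), (p + 1). split; [lra|].
      assert (E : forall y, x - 1 < y < p + 1 -> k y = fm y).
      { intros y Hy. unfold k. rewrite interp_left; lra || easy. }
      apply agree_dadd; [apply agree_dmul, agree_dadd; [apply agree_refl|apply agree_dscal]|].
      * now apply agree_reg.
      * now apply agree_dmul_fun.
Qed.

(** * Linear differential systems *)

Lemma derive_nonneg_le (g g' : R -> R) a b : a <= b ->
  (forall s, a <= s <= b -> is_derive g s (g' s)) -> (forall s, a <= s <= b -> 0 <= g' s) ->
  g a <= g b.
Proof.
  intros Hab D Hp. destruct (MVT_gen g a b g') as [c [Hc E]]; rewrite ?Rmin_left, ?Rmax_right in * by trivial.
  - intros x Hx. apply D. lra.
  - intros x Hx. apply continuity_pt_filterlim, (@ex_derive_continuous _ _ g). eexists. now apply D.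
  - specialize (Hp c Hc). nra.
Qed.

(** [C exp (2 K (s - x0)) + f s] and [C exp (2 K (s - x0)) - f s] are both nondecreasing and start
    from [C >= 0]. *)
Lemma exp_weight_right (f f' : R -> R) x0 x K C : 0 < K -> 0 <= C -> x0 <= x ->
  (forall s, x0 <= s <= x -> is_derive f s (f' s)) -> f x0 = 0 ->
  (forall s, x0 <= s <= x -> Rabs (f' s) <= 2 * K * C * exp (2 * K * (s - x0))) ->
  Rabs (f x) <= C * exp (2 * K * (x - x0)).
Proof.
  intros HK HC Hx D H0 H.
  assert (E : forall s, is_derive (fun s => C * exp (2 * K * (s - x0))) s
    (2 * K * C * exp (2 * K * (s - x0)))).
  { intros s. auto_derive; trivial. unfold Rminus. ring. }
  assert (L1 := derive_nonneg_le (fun s => C * exp (2 * K * (s - x0)) + f s)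
    (fun s => 2 * K * C * exp (2 * K * (s - x0)) + f' s) x0 x Hx).
  assert (L2 := derive_nonneg_le (fun s => C * exp (2 * K * (s - x0)) - f s)
    (fun s => 2 * K * C * exp (2 * K * (s - x0)) - f' s) x0 x Hx).
  simpl in L1, L2. rewrite H0, Rminus_diag, Rmult_0_r, exp_0 in L1, L2.
  assert (A1 : C * 1 + 0 <= C * exp (2 * K * (x - x0)) + f x).
  { apply L1; intros s Hs.
    - apply @is_derive_plus; auto.
    - specialize (H s Hs). apply Rabs_le_between in H. lra. }
  assert (A2 : C * 1 - 0 <= C * exp (2 * K * (x - x0)) - f x).
  { apply L2; intros s Hs.
    - apply @is_derive_minus; auto.
    - specialize (H s Hs). apply Rabs_le_between in H. lra. }
  apply Rabs_le_between. lra.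
Qed.

(** The weight absorbs the Lipschitz constant: integrating a bound [K C exp (2 K |s - x0|)] returns
    half of [C] times the weight. Picard's iteration thereby contracts on every bounded interval,
    however long, and solutions are global. *)
Lemma exp_weight (f f' : R -> R) x0 x r K C : 0 < K -> 0 <= C ->
  (forall s, is_derive f s (f' s)) -> f x0 = 0 -> Rabs (x - x0) < r ->
  (forall s, Rabs (s - x0) < r -> Rabs (f' s) <= 2 * K * C * exp (2 * K * Rabs (s - x0))) ->
  Rabs (f x) <= C * exp (2 * K * Rabs (x - x0)).
Proof.
  intros HK HC D H0 Hx H. destruct (Rle_lt_dec x0 x) as [L|L].
  - rewrite (Rabs_pos_eq (x - x0)) in * by lra.
    apply (exp_weight_right f f'); trivial.
    intros s Hs. specialize (H s). rewrite (Rabs_pos_eq (s - x0)) in H by lra. apply H. lra.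
  - rewrite (Rabs_left (x - x0)) in * by lra.
    replace (f x) with (f (- - x)) by (f_equal; ring).
    replace (- (x - x0)) with (- x - - x0) by ring.
    apply (exp_weight_right (fun s => f (- s)) (fun s => - f' (- s))); trivial; try lra.
    + intros s _. evar_last; [apply (is_derive_comp f Ropp); [apply D|auto_derive; trivial; reflexivity]|].
      unfold scal. simpl. unfold mult. simpl. ring.
    + now rewrite Ropp_involutive.
    + intros s Hs. specialize (H (- s)). rewrite (Rabs_left1 (- s - x0)) in H by lra.
      rewrite Rabs_Ropp. replace (s - - x0) with (- (- s - x0)) by ring. apply H. lra.
Qed.

Lemma geometric_limit_bound (u : nat -> R) K :
  (forall n, Rabs (u (S n) - u n) <= K * (/ 2) ^ n) ->
  forall n, Rabs (u n - real (Lim_seq u)) <= 2 * K * (/ 2) ^ n.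
Proof.
  intros H n. assert (L := geometric_is_lim u K 0 (fun n _ => H n)).
  assert (T := geometric_tail u K 0 (fun n _ => H n) n).
  rewrite Rabs_minus_sym.
  assert (Lp : is_lim_seq (fun p => Rabs (u (p + n)%nat - u n)) (Rabs (real (Lim_seq u) - u n))).
  { apply (is_lim_seq_abs (fun p => u (p + n)%nat - u n) (real (Lim_seq u) - u n)).
    apply is_lim_seq_minus'; [|apply is_lim_seq_const].
    now apply (is_lim_seq_incr_n u n). }
  apply (is_lim_seq_le (fun p => Rabs (u (p + n)%nat - u n)) (fun _ => 2 * K * (/ 2) ^ n)
    (Rabs (real (Lim_seq u) - u n)) (2 * K * (/ 2) ^ n)); trivial.
  - intros p. rewrite Nat.add_comm. apply T. lia.
  - apply is_lim_seq_const.
Qed.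

(** * Picard iteration *)

Section Picard.
Variables (I : Type) (A : R -> (I -> R) -> I -> R) (x0 : R) (c : I -> R).
Hypothesis lip : forall r, 0 < r -> exists K, 0 < K /\ forall x, Rabs (x - x0) < r ->
  forall v w e, (forall j, Rabs (v j - w j) <= e) -> forall i, Rabs (A x v i - A x w i) <= K * e.
Hypothesis cont : forall y : I -> R -> R, (forall j x, continuous (y j) x) ->
  forall i x, continuous (fun x => A x (fun j => y j x) i) x.
Hypothesis bounded : forall r, 0 < r -> exists B, 0 < B /\
  forall x, Rabs (x - x0) < r -> forall i, Rabs (A x c i) <= B.

Fixpoint picard_iter (n : nat) (i : I) (x : R) : R :=
  match n with
  | O => c i
  | S m => c i + RInt (fun s => A s (fun j => picard_iter m j s) i) x0 x
  end.

Lemma picard_iter_derive n i x : (forall j z, continuous (picard_iter n j) z) ->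
  is_derive (picard_iter (S n) i) x (A x (fun j => picard_iter n j x) i).
Proof.
  intros C.
  change (picard_iter (S n) i) with (fun x => c i + RInt (fun s => A s (fun j => picard_iter n j s) i) x0 x).
  evar_last; [apply @is_derive_plus; [apply @is_derive_const|]|apply Rplus_0_l].
  apply (is_derive_RInt (fun s => A s (fun j => picard_iter n j s) i) _ x0).
  - apply filter_forall. intros y. apply (@RInt_correct R_CompleteNormedModule).
    apply (@ex_RInt_continuous R_CompleteNormedModule). intros z _. now apply cont.
  - now apply cont.
Qed.

Lemma picard_iter_continuous n i x : continuous (picard_iter n i) x.
Proof.
  revert i x. induction n as [|n IH]; intros i x; [apply continuous_const|].
  apply (@ex_derive_continuous _ _ (picard_iter (S n) i)). eexists. now apply picard_iter_derive.
Qed.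

Lemma picard_iter_start n i : picard_iter n i x0 = c i.
Proof. destruct n; simpl; [easy|]. rewrite RInt_point. apply Rplus_0_r. Qed.

(** With the weight of exponent [2 K], each step gains the factor [/ 2]; [B / (2 K)] is what the
    first step requires. *)
Lemma picard_iter_geometric r : 0 < r -> exists B, 0 <= B /\
  forall n i x, Rabs (x - x0) < r ->
    Rabs (picard_iter (S n) i x - picard_iter n i x) <= B * (/ 2) ^ n.
Proof.
  intros Hr. destruct (lip r Hr) as [K [HK Hl]], (bounded r Hr) as [B [HB Hb]].
  set (B' := B / (2 * K)).
  assert (HB' : 0 < B') by (apply Rdiv_lt_0_compat; lra).
  assert (G : forall n i x, Rabs (x - x0) < r ->
    Rabs (picard_iter (S n) i x - picard_iter n i x) <= B' * (/ 2) ^ n * exp (2 * K * Rabs (x - x0))).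
  { induction n as [|n IH]; intros i x Hx.
    - apply (exp_weight (fun x => picard_iter 1 i x - picard_iter 0 i x)
        (fun x => A x c i - 0) x0 x r); simpl pow; trivial; try lra.
      + intros s. apply @is_derive_minus; [|apply @is_derive_const].
        apply (picard_iter_derive 0), picard_iter_continuous.
      + rewrite !picard_iter_start. ring.
      + intros s Hs. rewrite Rminus_0_r. apply Rle_trans with (1 := Hb s Hs i).
        replace (2 * K * (B' * 1)) with B by (unfold B'; field; lra).
        assert (E := exp_ineq1_le (2 * K * Rabs (s - x0))). assert (P := Rabs_pos (s - x0)).
        assert (0 <= 2 * K * Rabs (s - x0)) by (apply Rmult_le_pos; lra). nra.
    - assert (P2 : 0 < (/ 2) ^ n) by (apply pow_lt; lra).
      apply (exp_weight (fun x => picard_iter (S (S n)) i x - picard_iter (S n) i x)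
        (fun x => A x (fun j => picard_iter (S n) j x) i - A x (fun j => picard_iter n j x) i) x0 x r); trivial.
      + simpl pow. nra.
      + intros s. apply @is_derive_minus; apply picard_iter_derive, picard_iter_continuous.
      + rewrite !picard_iter_start. ring.
      + intros s Hs. simpl pow.
        replace (2 * K * (B' * (/ 2 * (/ 2) ^ n)) * exp (2 * K * Rabs (s - x0)))
          with (K * (B' * (/ 2) ^ n * exp (2 * K * Rabs (s - x0)))) by field.
        apply Hl; trivial. intros j. now apply IH. }
  exists (B' * exp (2 * K * r)). split.
  - apply Rmult_le_pos; [lra|]. apply Rlt_le, exp_pos.
  - intros n i x Hx. apply Rle_trans with (1 := G n i x Hx).
    assert (P2 : 0 < (/ 2) ^ n) by (apply pow_lt; lra).
    assert (E : exp (2 * K * Rabs (x - x0)) <= exp (2 * K * r)).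
    { assert (L : 2 * K * Rabs (x - x0) <= 2 * K * r) by (apply Rmult_le_compat_l; lra).
      destruct L as [L|L]; [left; now apply exp_increasing|right; now rewrite L]. }
    assert (0 < B' * (/ 2) ^ n) by now apply Rmult_lt_0_compat. nra.
Qed.

Theorem picard : exists y : I -> R -> R,
  (forall i, y i x0 = c i) /\ forall i x, is_derive (y i) x (A x (fun j => y j x) i).
Proof.
  set (y := fun i x => real (Lim_seq (fun n => picard_iter n i x))).
  exists y. split.
  - intros i. unfold y. rewrite (Lim_seq_ext _ (fun _ => c i)); [now rewrite Lim_seq_const|].
    intros n. apply picard_iter_start.
  - intros i x. set (r := Rabs (x - x0) + 1).
    assert (P := Rabs_pos (x - x0)).
    destruct (picard_iter_geometric r ltac:(unfold r; lra)) as [B [HB G]].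
    destruct (lip r ltac:(unfold r; lra)) as [K [HK Hl]].
    set (g := fun n s => A s (fun j => picard_iter n j s) i).
    assert (Hg : forall n s, Rabs (s - x0) < r -> Rabs (g (S n) s - g n s) <= K * B * (/ 2) ^ n).
    { intros n s Hs. rewrite Rmult_assoc. apply Hl; trivial. intros j. now apply G. }
    replace (A x (fun j => y j x) i) with (real (Lim_seq (fun n => g n x))).
    + apply (is_derive_ext (fun s => real (Lim_seq (fun n => picard_iter (S n) i s)))).
      { intros s. unfold y. f_equal. exact (Lim_seq_incr_1 (fun n => picard_iter n i s)). }
      assert (P2 : forall n, 0 < (/ 2) ^ n) by (intros; apply pow_lt; lra).
      assert (HKB : 0 <= K * B) by (apply Rmult_le_pos; lra).
      (* One constant has to dominate the increments of the iterates, governed by [B], and those of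
         their derivatives, governed by [K B]. *)
      apply (termwise_derive (fun n => picard_iter (S n) i) g (x0 - r) (x0 + r) (B + K * B) 0).
      * intros n s _. apply picard_iter_derive, picard_iter_continuous.
      * intros n s _. apply cont. intros; apply picard_iter_continuous.
      * intros n s Hs _. apply Rle_trans with (B * (/ 2) ^ S n).
        -- apply G. apply Rabs_lt_between. lra.
        -- simpl. specialize (P2 n). nra.
      * intros n s Hs _. apply Rle_trans with (K * B * (/ 2) ^ n).
        -- apply Hg. apply Rabs_lt_between. lra.
        -- specialize (P2 n). nra.
      * assert (Q := proj1 (Rabs_lt_between (x - x0) r) ltac:(unfold r; lra)). lra.
    + assert (Hx : Rabs (x - x0) < r) by (unfold r; lra).
      change (real (Lim_seq (fun n => g n x)) = real (Finite (A x (fun j => y j x) i))).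
      f_equal. apply is_lim_seq_unique.
      apply is_lim_seq_le_le with (fun n => A x (fun j => y j x) i - 2 * (K * B) * (/ 2) ^ n)
        (fun n => A x (fun j => y j x) i + 2 * (K * B) * (/ 2) ^ n).
      * intros n.
        assert (D : Rabs (g n x - A x (fun j => y j x) i) <= K * (2 * B * (/ 2) ^ n)).
        { apply Hl; trivial. intros j.
          apply (geometric_limit_bound (fun n => picard_iter n j x)). intros m. now apply G. }
        apply Rabs_le_between in D. lra.
      * replace (Finite (A x (fun j => y j x) i)) with
          (Finite (A x (fun j => y j x) i - 2 * (K * B) * 0)) by (f_equal; ring).
        apply is_lim_seq_minus'; [apply is_lim_seq_const|].
        apply is_lim_seq_mult'; [apply is_lim_seq_const|]. apply is_lim_seq_geom. rewrite Rabs_pos_eq; lra.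
      * replace (Finite (A x (fun j => y j x) i)) with
          (Finite (A x (fun j => y j x) i + 2 * (K * B) * 0)) by (f_equal; ring).
        apply is_lim_seq_plus'; [apply is_lim_seq_const|].
        apply is_lim_seq_mult'; [apply is_lim_seq_const|]. apply is_lim_seq_geom. rewrite Rabs_pos_eq; lra.
Qed.
End Picard.

(** * Complex linear systems with smooth coefficients *)

Fixpoint csum (n : nat) (f : nat -> C) : C :=
  match n with O => RtoC 0 | S m => (csum m f + f m)%C end.

Fixpoint ssum (n : nat) (f : nat -> smooth) : smooth :=
  match n with O => csmooth 0 | S m => sadd (ssum m f) (f m) end.

Lemma ssum_eval n f x : ssum n f x = csum n (fun j => f j x).
Proof. induction n as [|n IH]; [easy|]. simpl. now rewrite IH. Qed.

Lemma csum_bound n f b : (forall j, (j < n)%nat -> Cmod (f j) <= b) -> Cmod (csum n f) <= INR n * b.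
Proof.
  induction n as [|n IH]; intros H; simpl csum.
  - rewrite Cmod_0. simpl. lra.
  - rewrite S_INR. apply Rle_trans with (1 := Cmod_triangle _ _).
    assert (A := IH (fun j Hj => H j ltac:(lia))). assert (B := H n ltac:(lia)). lra.
Qed.

Lemma csum_minus n f g : (csum n f - csum n g)%C = csum n (fun j => f j - g j)%C.
Proof. induction n as [|n IH]; simpl; [ring|]. rewrite <- IH. ring. Qed.

Lemma csum_ext n f g : (forall j, (j < n)%nat -> f j = g j) -> csum n f = csum n g.
Proof.
  induction n as [|n IH]; intros H; simpl; [easy|]. rewrite IH, H; trivial; [lia|].
  intros j Hj. apply H. lia.
Qed.

Lemma smooth_bounded_upto (f : nat -> smooth) M N :
  exists B, 0 < B /\ forall j x, (j < N)%nat -> Rabs x <= M -> Cmod (f j x) <= B.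
Proof.
  induction N as [|N [B [HB IH]]].
  - exists 1. split; [lra|]. intros; lia.
  - destruct (smooth_bounded (f N) M (smoothP _)) as [B' [HB' H]]. exists (B + B').
    split; [lra|]. intros j x Hj Hx. destruct (Nat.eq_dec j N) as [->|Hn].
    + specialize (H x Hx). lra.
    + specialize (IH j x ltac:(lia) Hx). lra.
Qed.

Lemma smooth_bounded_upto2 (f : nat -> nat -> smooth) M N :
  exists B, 0 < B /\ forall i j x, (i < N)%nat -> (j < N)%nat -> Rabs x <= M -> Cmod (f i j x) <= B.
Proof.
  enough (H : forall n, exists B, 0 < B /\ forall i j x, (i < n)%nat -> (j < N)%nat -> Rabs x <= M ->
    Cmod (f i j x) <= B) by apply H.
  induction n as [|n [B [HB IH]]].
  - exists 1. split; [lra|]. intros; lia.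
  - destruct (smooth_bounded_upto (f n) M N) as [B' [HB' H]]. exists (B + B').
    split; [lra|]. intros i j x Hi Hj Hx. destruct (Nat.eq_dec i n) as [->|Hn].
    + specialize (H j x Hj Hx). lra.
    + specialize (IH i j x ltac:(lia) Hj Hx). lra.
Qed.

Lemma continuous_csum n (f : nat -> R -> C) x : (forall j, (j < n)%nat -> continuous (f j) x) ->
  continuous (fun x => csum n (fun j => f j x)) x.
Proof.
  induction n as [|n IH]; intros H; simpl.
  - apply continuous_const.
  - apply (Cfilterlim_plus (locally x)); [apply IH; intros j Hj|]; apply H; lia.
Qed.

Lemma is_cderive_plus f g f' g' : is_cderive f f' -> is_cderive g g' ->
  is_cderive (fun x => f x + g x)%C (fun x => f' x + g' x)%C.
Proof.
  intros Hf Hg x. destruct (Hf x), (Hg x). split; simpl; now apply @is_derive_plus.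
Qed.

Lemma is_cderive_mult f g f' g' : is_cderive f f' -> is_cderive g g' ->
  is_cderive (fun x => f x * g x)%C (fun x => f' x * g x + f x * g' x)%C.
Proof.
  intros Hf Hg x. destruct (Hf x) as [f1 f2], (Hg x) as [g1 g2].
  assert (M : forall (u v u' v' : R -> R), is_derive u x (u' x) -> is_derive v x (v' x) ->
    is_derive (fun t => u t * v t) x (u' x * v x + u x * v' x)).
  { intros u v u' v' Hu Hv. apply (is_derive_mult u v x (u' x) (v' x) Hu Hv).
    intros n m. apply Rmult_comm. }
  split; simpl.
  - evar_last.
    + apply @is_derive_minus; [apply (M _ _ (fun t => Re (f' t)) (fun t => Re (g' t)) f1 g1)
        |apply (M _ _ (fun t => Im (f' t)) (fun t => Im (g' t)) f2 g2)].
    + unfold minus, plus, opp, Re, Im. simpl. ring.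
  - evar_last.
    + apply @is_derive_plus; [apply (M _ _ (fun t => Re (f' t)) (fun t => Im (g' t)) f1 g2)
        |apply (M _ _ (fun t => Im (f' t)) (fun t => Re (g' t)) f2 g1)].
    + unfold plus, Re, Im. simpl. ring.
Qed.

Section LinearSystem.
Variables (N : nat) (M : nat -> nat -> smooth).

(** Combinations of the unknowns with smooth coefficients: the system makes this class closed under
    differentiation, so [is_smooth_ind] gives the smoothness of solutions. *)
Inductive span (y : nat -> R -> C) : (R -> C) -> Prop :=
| span_var i : (i < N)%nat -> span y (y i)
| span_zero : span y (fun _ => RtoC 0)
| span_add f g : span y f -> span y g -> span y (fun x => f x + g x)%C
| span_mul (h : smooth) f : span y f -> span y (fun x => h x * f x)%C.

Lemma span_derive y :
  (forall i, (i < N)%nat -> is_cderive (y i) (fun x => csum N (fun j => M i j x * y j x)%C)) ->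
  forall f, span y f -> exists g, span y g /\ is_cderive f g.
Proof.
  intros H f Hf.
  induction Hf as [i Hi| |f g Hf [f' [Sf Df]] Hg [g' [Sg Dg]]|h f Hf [f' [Sf Df]]].
  - eexists. split; [|now apply H].
    assert (G : forall n, (n <= N)%nat -> span y (fun x => csum n (fun j => M i j x * y j x)%C)).
    { induction n as [|n IH]; intros Hn; simpl; [apply span_zero|].
      apply span_add; [apply IH; lia|]. apply span_mul, span_var. lia. }
    now apply G.
  - exists (fun _ => RtoC 0). split; [apply span_zero|]. intros x. split; apply @is_derive_const.
  - exists (fun x => f' x + g' x)%C. split; [now apply span_add|]. now apply is_cderive_plus.
  - exists (fun x => sder h x * f x + h x * f' x)%C. split.
    + apply span_add; now apply span_mul.
    + apply is_cderive_mult; trivial. apply sder_correct.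
Qed.

Theorem linear_system x0 (c : nat -> C) : exists y : nat -> smooth,
  forall i, (i < N)%nat -> y i x0 = c i /\ sder (y i) = ssum N (fun j => smul (M i j) (y j)).
Proof.
  (* Each complex unknown is coded by two real ones, [true] marking the real part. As the index type
     is infinite, the right-hand side is set to 0 outside the [N] unknowns. *)
  set (z := fun (v : nat * bool -> R) j => ((v (j, true), v (j, false)) : C)).
  set (rhs := fun x v i => if Compare_dec.lt_dec i N then csum N (fun j => M i j x * z v j)%C else RtoC 0).
  set (A := fun x v (i : nat * bool) => if snd i then Re (rhs x v (fst i)) else Im (rhs x v (fst i))).
  assert (Az : forall x v i, Rabs (A x v i) <= Cmod (rhs x v (fst i))).
  { intros x v [i [|]]; simpl; apply Cmod_components. }
  destruct (picard (nat * bool) A x0 (fun i => if snd i then Re (c (fst i)) else Im (c (fst i))))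
    as [y [Hy0 Hy]].
  - intros r Hr. destruct (smooth_bounded_upto2 M (Rabs x0 + r) N) as [B [HB H]].
    exists (INR N * (2 * B) + 1). assert (PN := pos_INR N). split; [nra|].
    intros x Hx v w e He i.
    assert (He0 : 0 <= e) by (apply Rle_trans with (2 := He (0%nat, true)), Rabs_pos).
    assert (Hx' : Rabs x <= Rabs x0 + r).
    { assert (T := Rabs_triang (x - x0) x0). replace (x - x0 + x0) with x in T by ring. lra. }
    assert (D : Cmod (rhs x v (fst i) - rhs x w (fst i))%C <= INR N * (B * (2 * e))).
    { unfold rhs. destruct Compare_dec.lt_dec as [L|L].
      - rewrite csum_minus. apply csum_bound. intros j Hj.
        replace (M (fst i) j x * z v j - M (fst i) j x * z w j)%C with
          (M (fst i) j x * (z v j - z w j))%C by ring.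
        rewrite Cmod_mult. apply Rmult_le_compat; try apply Cmod_ge_0; auto.
        apply Rle_trans with (1 := Cmod_le_sum _).
        assert (E1 := He (j, true)). assert (E2 := He (j, false)).
        change (Rabs (v (j, true) - w (j, true)) + Rabs (v (j, false) - w (j, false)) <= 2 * e). lra.
      - replace (RtoC 0 - RtoC 0)%C with (RtoC 0) by ring. rewrite Cmod_0.
        apply Rmult_le_pos; trivial. nra. }
    assert (E : Rabs (A x v i - A x w i) <= Cmod (rhs x v (fst i) - rhs x w (fst i))%C).
    { unfold A. destruct (snd i); [apply (proj1 (Cmod_components (rhs x v (fst i) - rhs x w (fst i))))
        |apply (proj2 (Cmod_components (rhs x v (fst i) - rhs x w (fst i))))]. }
    nra.
  - intros y Hy i x.
    assert (Cr : continuous (fun x => rhs x (fun j => y j x) (fst i)) x).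
    { unfold rhs. destruct Compare_dec.lt_dec as [L|L]; [|apply continuous_const].
      apply continuous_csum. intros j Hj. apply Ccontinuous_mult.
      - apply is_smooth_continuous, smoothP.
      - apply Ccontinuous_comp; apply Hy. }
    unfold A. destruct (snd i).
    + apply (Cfilterlim_fst (locally x) _ _ Cr).
    + apply (Cfilterlim_snd (locally x) _ _ Cr).
  - intros r Hr. destruct (smooth_bounded_upto2 M (Rabs x0 + r) N) as [B [HB H]].
    assert (G : exists b, 0 < b /\ forall j, (j < N)%nat -> Cmod (c j) <= b).
    { clear. induction N as [|n [b [Hb IH]]]; [exists 1; split; [lra|intros; lia]|].
      exists (b + Cmod (c n)). assert (P := Cmod_ge_0 (c n)). split; [lra|].
      intros j Hj. destruct (Nat.eq_dec j n) as [->|Hn]; [lra|]. specialize (IH j ltac:(lia)). lra. }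
    destruct G as [b [Hb G]]. exists (INR N * (B * b) + 1). assert (PN := pos_INR N). split.
    { assert (0 <= INR N * (B * b)) by (apply Rmult_le_pos; [trivial|apply Rlt_le; now apply Rmult_lt_0_compat]). lra. }
    intros x Hx i. apply Rle_trans with (1 := Az _ _ _).
    assert (Hx' : Rabs x <= Rabs x0 + r).
    { assert (T := Rabs_triang (x - x0) x0). replace (x - x0 + x0) with x in T by ring. lra. }
    unfold rhs. destruct Compare_dec.lt_dec as [L|L].
    + enough (Cmod (csum N (fun j => M (fst i) j x * z (fun i => if snd i then Re (c (fst i)) else Im (c (fst i))) j)%C)
        <= INR N * (B * b)) by lra.
      apply csum_bound. intros j Hj. rewrite Cmod_mult.
      apply Rmult_le_compat; try apply Cmod_ge_0; auto.
      replace (z _ j) with (c j); auto. unfold z. simpl. now destruct (c j).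
    + rewrite Cmod_0.
      assert (0 <= INR N * (B * b)) by (apply Rmult_le_pos; [trivial|apply Rlt_le; now apply Rmult_lt_0_compat]). lra.
  - set (yc := fun j x => ((y (j, true) x, y (j, false) x) : C)).
    assert (D : forall i, (i < N)%nat -> is_cderive (yc i) (fun x => csum N (fun j => M i j x * yc j x)%C)).
    { intros i Hi x. assert (D1 := Hy (i, true) x). assert (D2 := Hy (i, false) x).
      unfold A, rhs in D1, D2. simpl in D1, D2.
      destruct Compare_dec.lt_dec as [L|L]; [|easy]. split; trivial. }
    assert (S : forall i, (i < N)%nat -> is_smooth (yc i)).
    { intros i Hi. apply (is_smooth_ind (span yc)); [|now apply span_var]. now apply span_derive. }
    exists (fun i => match Compare_dec.lt_dec i N with left H => Smooth (yc i) (S i H) | right _ => csmooth 0 end).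
    intros i Hi. destruct Compare_dec.lt_dec as [L|L]; [|easy]. split.
    + simpl. unfold yc. rewrite !Hy0. simpl. now destruct (c i).
    + apply smooth_ext. intros x. rewrite ssum_eval. simpl.
      rewrite (is_cderive_unique _ _ x (D i L)). apply csum_ext. intros j Hj.
      destruct Compare_dec.lt_dec; [easy|lia].
Qed.
End LinearSystem.

Lemma csum_plus n f g : (csum n f + csum n g)%C = csum n (fun j => f j + g j)%C.
Proof. induction n as [|n IH]; simpl; [ring|]. rewrite <- IH. ring. Qed.

Lemma csum_scal n c f : (c * csum n f)%C = csum n (fun j => c * f j)%C.
Proof. induction n as [|n IH]; simpl; [ring|]. rewrite <- IH. ring. Qed.

Lemma csum_0 n f : (forall j, (j < n)%nat -> f j = RtoC 0) -> csum n f = RtoC 0.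
Proof.
  intros H. rewrite (csum_ext n f (fun _ => RtoC 0) H). clear.
  induction n as [|n IH]; simpl; [easy|]. rewrite IH. ring.
Qed.

Lemma csum_swap n m f : csum n (fun i => csum m (fun j => f i j)) = csum m (fun j => csum n (fun i => f i j)).
Proof.
  induction n as [|n IH]; simpl; [symmetry; now apply csum_0|]. now rewrite IH, csum_plus.
Qed.

Definition delta_ij (i j : nat) : C := if Nat.eq_dec i j then RtoC 1 else RtoC 0.

Lemma csum_delta n i f : (i < n)%nat -> csum n (fun j => delta_ij i j * f j)%C = f i.
Proof.
  induction n as [|n IH]; intros Hi; [lia|]. simpl. unfold delta_ij at 2.
  destruct (Nat.eq_dec i n) as [->|Hn].
  - rewrite csum_0; [ring|]. intros j Hj. unfold delta_ij. destruct Nat.eq_dec; [lia|ring].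
  - rewrite IH by lia. ring.
Qed.

Lemma sder_ssum n f : sder (ssum n f) = ssum n (fun j => sder (f j)).
Proof.
  induction n as [|n IH]; simpl; [apply sder_const|]. now rewrite sder_add, IH.
Qed.

Fixpoint dsumn (n : nat) (f : nat -> distr) : distr :=
  match n with O => dzero | S m => dadd (dsumn m f) (f m) end.

Lemma dsumn_eval n f t : dsumn n f t = csum n (fun j => f j t).
Proof. induction n as [|n IH]; [easy|]. simpl dsumn. rewrite dadd_eval, IH. reflexivity. Qed.

Lemma dmul_ssum n f T : dmul (ssum n f) T = dsumn n (fun j => dmul (f j) T).
Proof.
  induction n as [|n IH]; simpl ssum; simpl dsumn.
  - apply distr_ext. intros t. deval. apply distr_zero. intros x. simpl. ring.
  - now rewrite dmul_sadd, IH.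
Qed.

Lemma csum_distr n (T : distr) (f : nat -> smooth) t :
  csum n (fun j => T (tmul (f j) t)) = T (tmul (ssum n f) t).
Proof.
  change (T (tmul (ssum n f) t)) with (dmul (ssum n f) T t). rewrite dmul_ssum, dsumn_eval. reflexivity.
Qed.

Lemma dderiv_dsumn n f : dderiv (dsumn n f) = dsumn n (fun j => dderiv (f j)).
Proof.
  induction n as [|n IH]; simpl dsumn.
  - apply distr_ext. intros t. deval. ring.
  - rewrite <- IH. apply distr_ext. intros t. deval. ring.
Qed.

Lemma reg_ssum n f t : reg (pw_of_smooth (ssum n f)) t = csum n (fun j => reg (pw_of_smooth (f j)) t).
Proof.
  induction n as [|n IH]; simpl ssum; simpl csum.
  - replace (csmooth 0) with (smul (csmooth 0) (csmooth 1)) by (apply smooth_ext; intros x; simpl; ring).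
    rewrite <- dmul_reg, dmul_const, dscal_eval. ring.
  - now rewrite reg_add, dadd_eval, IH.
Qed.

(** * The adjoint system and fundamental matrices *)

Section Adjoint.
Variables (N : nat) (M : nat -> nat -> smooth).

Definition solves (y : nat -> smooth) : Prop :=
  forall i, (i < N)%nat -> sder (y i) = ssum N (fun j => smul (M i j) (y j)).

Definition solves_adjoint (p : nat -> smooth) : Prop :=
  forall i, (i < N)%nat -> sder (p i) = ssum N (fun j => smul (sopp (M j i)) (p j)).

(** The two terms of the derivative, with [p' = - M^T p] and [y' = M y], cancel after exchanging the
    sums. *)
Lemma adjoint_constant p y : solves_adjoint p -> solves y ->
  forall x, sder (ssum N (fun i => smul (p i) (y i))) x = RtoC 0.
Proof.
  intros Hp Hy x. rewrite sder_ssum, ssum_eval.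
  rewrite (csum_ext N _ (fun i => csum N (fun j => - (1) * (M j i x * p j x * y i x)) +
    csum N (fun j => M i j x * p i x * y j x))%C).
  - rewrite <- csum_plus, (csum_swap N N (fun i j => - (1) * (M j i x * p j x * y i x))%C), csum_plus.
    apply csum_0. intros j Hj. rewrite csum_plus. apply csum_0. intros i Hi. ring.
  - intros i Hi. rewrite sder_mul, (Hp i Hi), (Hy i Hi).
    change (ssum N (fun j => smul (sopp (M j i)) (p j)) x * y i x +
      p i x * ssum N (fun j => smul (M i j) (y j)) x = csum N (fun j => - (1) * (M j i x * p j x * y i x)) +
    csum N (fun j => M i j x * p i x * y j x))%C.
    rewrite !ssum_eval, Cmult_comm, !csum_scal. f_equal; apply csum_ext; intros j Hj; simpl; ring.
Qed.

Lemma smooth_constant (f : smooth) : (forall x, sder f x = RtoC 0) -> forall x y, f x = f y.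
Proof.
  intros H x y. destruct (Rle_lt_dec x y) as [L|L].
  - now apply smooth_const_on.
  - symmetry. apply smooth_const_on; [lra|auto].
Qed.

(** [Psi Phi] is constant by [adjoint_constant] and is the identity at [x0]. The adjoint solutions
    thus provide the inverse of [Phi] with no appeal to determinants. *)
Lemma fundamental_matrices x0 : exists Phi Psi : nat -> nat -> smooth,
  (forall k, (k < N)%nat -> solves (fun i => Phi i k)) /\
  (forall k, (k < N)%nat -> solves_adjoint (Psi k)) /\
  (forall i k, (i < N)%nat -> (k < N)%nat -> Phi i k x0 = delta_ij i k) /\
  (forall i k x, (i < N)%nat -> (k < N)%nat ->
     csum N (fun j => Psi i j x * Phi j k x)%C = delta_ij i k).
Proof.
  destruct (choice_function _ _ _ (fun k => linear_system N M x0 (fun i => delta_ij i k))) as [P HP].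
  destruct (choice_function _ _ _ (fun k => linear_system N (fun i j => sopp (M j i)) x0 (fun i => delta_ij k i)))
    as [Q HQ].
  exists (fun i k => P k i), Q.
  assert (A1 : forall k, solves (fun i => P k i)) by (intros k i Hi; now apply HP).
  assert (A2 : forall k, solves_adjoint (Q k)) by (intros k i Hi; now apply HQ).
  split; [auto|]. split; [auto|]. split.
  - intros i k Hi Hk. now apply HP.
  - intros i k x Hi Hk.
    transitivity (ssum N (fun j => smul (Q i j) (P k j)) x0).
    + rewrite <- (smooth_constant _ (adjoint_constant _ _ (A2 i) (A1 k)) x x0). now rewrite ssum_eval.
    + rewrite ssum_eval.
      rewrite (csum_ext N _ (fun j => delta_ij i j * delta_ij j k)%C).
      * now rewrite csum_delta.
      * intros j Hj. simpl. destruct (HP k j Hj) as [-> _]. now destruct (HQ i j Hj) as [-> _].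
Qed.

End Adjoint.

Section LeftInverse.
Import all_boot all_algebra.

Lemma csum_big n f : csum n f = (\sum_(i < n) f i)%R.
Proof. elim: n => [|n IH] /=; [by rewrite big_ord0|by rewrite big_ord_recr /= -IH]. Qed.

(** A one-sided inverse of a square matrix is two-sided. [fundamental_matrices] gives [Psi Phi = 1],
    whereas recovering a solution from its product with [Psi] takes [Phi Psi = 1]. *)
Lemma csum_left_inverse N (P Q : nat -> nat -> C) :
  (forall i k, (i < N)%coq_nat -> (k < N)%coq_nat ->
     csum N (fun j => Cmult (Q i j) (P j k)) = delta_ij i k) ->
  forall i k, (i < N)%coq_nat -> (k < N)%coq_nat ->
     csum N (fun j => Cmult (P i j) (Q j k)) = delta_ij i k.
Proof.
  move=> H i k /ltP Hi /ltP Hk.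
  pose mP := (\matrix_(i < N, j < N) P i j)%R. pose mQ := (\matrix_(i < N, j < N) Q i j)%R.
  have D (a b : 'I_N) : (1%:M : 'M[C]_N)%R a b = delta_ij a b.
  { rewrite mxE /delta_ij. case: Nat.eq_dec => E; case: eqP => [E'|E'] //=.
    - by case: E'; apply: val_inj.
    - by case: E; rewrite E'. }
  have E : (mQ *m mP = 1%:M)%R.
  { apply/matrixP => a b. rewrite D -H; [|exact/ltP|exact/ltP].
    rewrite csum_big mxE. apply: eq_bigr => j _. by rewrite !mxE. }
  move/mulmx1C/matrixP: E => /(_ (Ordinal Hi) (Ordinal Hk)). rewrite D /= => <-.
  rewrite csum_big mxE. apply: eq_bigr => j _. by rewrite !mxE.
Qed.

End LeftInverse.

Section Regularity.
Variables (N : nat) (M : nat -> nat -> smooth).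

(** For a solution [u] the vector [Psi u] is constant, so [u (x) = Phi (x) Psi (x0) u (x0)] depends
    only on the initial value. *)
Lemma solves_unique x0 y z : solves N M y -> solves N M z ->
  (forall i, (i < N)%nat -> y i x0 = z i x0) -> forall i x, (i < N)%nat -> y i x = z i x.
Proof.
  intros Hy Hz H0 i x Hi.
  destruct (fundamental_matrices N M x0) as [Phi [Psi [HPhi [HPsi [_ Inv]]]]].
  assert (Inv' := fun x => csum_left_inverse N (fun i j => Phi i j x) (fun i j => Psi i j x)
    (fun i k Hi Hk => Inv i k x Hi Hk)).
  assert (E : forall u, solves N M u -> u i x =
    csum N (fun k => Phi i k x * csum N (fun j => Psi k j x0 * u j x0))%C).
  { intros u Hu. rewrite <- (csum_delta N i (fun j => u j x)) by trivial.
    rewrite (csum_ext N _ (fun j => csum N (fun k => Phi i k x * Psi k j x * u j x)%C)).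
    - rewrite csum_swap. apply csum_ext. intros k Hk.
      transitivity (Phi i k x * ssum N (fun j => smul (Psi k j) (u j)) x)%C.
      + rewrite ssum_eval, csum_scal. apply csum_ext. intros j Hj. simpl. ring.
      + rewrite (smooth_constant _ (adjoint_constant N M _ _ (HPsi k Hk) Hu) x x0).
        now rewrite ssum_eval.
    - intros j Hj. rewrite <- (Inv' x i j Hi Hj), Cmult_comm, csum_scal.
      apply csum_ext. intros k Hk. ring. }
  rewrite (E y Hy), (E z Hz). apply csum_ext. intros k Hk. f_equal. apply csum_ext.
  intros j Hj. now rewrite H0.
Qed.

Lemma solves_combination (Phi : nat -> nat -> smooth) (c : nat -> C) :
  (forall k, (k < N)%nat -> solves N M (fun i => Phi i k)) ->
  solves N M (fun i => ssum N (fun k => smul (Phi i k) (csmooth (c k)))).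
Proof.
  intros H i Hi. apply smooth_ext. intros x. rewrite sder_ssum, !ssum_eval.
  rewrite (csum_ext N _ (fun k => csum N (fun j => M i j x * Phi j k x * c k)%C)).
  - rewrite csum_swap. apply csum_ext. intros j Hj. simpl. rewrite ssum_eval, csum_scal.
    apply csum_ext. intros k Hk. simpl. ring.
  - intros k Hk. rewrite sder_mul, sder_const, (H k Hk i Hi). simpl.
    rewrite ssum_eval. rewrite Cmult_0_r, Cplus_0_r, Cmult_comm, csum_scal.
    apply csum_ext. intros j Hj. simpl. ring.
Qed.

Theorem distribution_solution U x0 (r : posreal) (T : nat -> distr) :
  convex U -> (forall x, Rabs (x - x0) <= r -> U x) ->
  (forall i, (i < N)%nat -> agree U (dderiv (T i)) (dsumn N (fun j => dmul (M i j) (T j)))) ->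
  exists u, solves N M u /\ forall i, (i < N)%nat -> agree U (T i) (reg (pw_of_smooth (u i))).
Proof.
  intros HU Hx0 HT.
  destruct (fundamental_matrices N M x0) as [Phi [Psi [HPhi [HPsi [_ Inv]]]]].
  set (S := fun k => dsumn N (fun j => dmul (Psi k j) (T j))).
  assert (HS : forall k, exists c, (k < N)%nat -> agree U (S k) (reg (pw_of_smooth (csmooth c)))).
  { intros k. destruct (Compare_dec.lt_dec k N) as [Hk|Hk]; [|now exists 0%C].
    destruct (derivative_zero U x0 r (S k) HU Hx0) as [c Hc]; [|now exists c].
    intros t a b Hab Ht. rewrite dzero_eval. unfold S. rewrite dderiv_dsumn, dsumn_eval.
    rewrite (csum_ext N _ (fun j => csum N (fun i => T j (tmul (smul (sopp (M i j)) (Psi k i)) t))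
      + csum N (fun i => T i (tmul (M j i) (tmul (Psi k j) t))))%C).
    - rewrite <- csum_plus, (csum_swap N N (fun j i => T i (tmul (M j i) (tmul (Psi k j) t)))), csum_plus.
      apply csum_0. intros j Hj. rewrite csum_plus. apply csum_0. intros i Hi.
      rewrite <- distr_add. apply distr_zero. intros x. simpl. ring.
    - intros j Hj. rewrite dderiv_dmul, dadd_eval, (HPsi k Hk j Hj), dmul_ssum, dsumn_eval.
      f_equal. rewrite dmul_eval, (HT j Hj (tmul (Psi k j) t) a b Hab).
      + now rewrite dsumn_eval.
      + intros x Hx. apply Ht. revert Hx. apply tmul_supp. }
  destruct (choice_function _ _ _ HS) as [c Hc].
  exists (fun i => ssum N (fun k => smul (Phi i k) (csmooth (c k)))). split.
  { now apply solves_combination. }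
  intros i Hi t a b Hab Ht. rewrite reg_ssum.
  rewrite (csum_ext N _ (fun k => S k (tmul (Phi i k) t))).
  (* Here [Phi S = Phi Psi T = T]. *)
  - unfold S. rewrite (csum_ext N _ (fun k => csum N (fun j => T j (tmul (smul (Phi i k) (Psi k j)) t)))).
    + rewrite csum_swap. rewrite (csum_ext N _ (fun j => delta_ij i j * T j t)%C).
      * now rewrite csum_delta.
      * intros j Hj. rewrite csum_distr, <- distr_scal. f_equal. apply test_ext. intros x. simpl.
        rewrite ssum_eval. f_equal.
        exact (csum_left_inverse N (fun i j => Phi i j x) (fun i j => Psi i j x)
          (fun i k Hi Hk => Inv i k x Hi Hk) i j Hi Hj).
    + intros k Hk. rewrite dsumn_eval. apply csum_ext. intros j Hj. rewrite dmul_eval.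
      f_equal. apply test_ext. intros x. simpl. ring.
  - intros k Hk. rewrite <- dmul_reg, dmul_eval. symmetry. apply (Hc k Hk _ a b Hab).
    intros x Hx. apply Ht. revert Hx. apply tmul_supp.
Qed.

End Regularity.

(** * The scalar equation of order four *)

Arguments sder : simpl never.

Lemma sadd_eval f g x : sadd f g x = (f x + g x)%C.
Proof. reflexivity. Qed.

Lemma smul_eval f g x : smul f g x = (f x * g x)%C.
Proof. reflexivity. Qed.

Lemma sopp_eval f x : sopp f x = (- f x)%C.
Proof. simpl. ring. Qed.

Lemma csmooth_eval c x : csmooth c x = c.
Proof. reflexivity. Qed.

Ltac seval := repeat first [rewrite sadd_eval | rewrite smul_eval | rewrite sopp_eval | rewrite csmooth_eval].

Definition scalar_op (a k u : smooth) : smooth :=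
  sadd (sder (sder (smul a (sder (sder u))))) (sopp (smul k u)).

Definition scalar_dop (a k : smooth) (T : distr) : distr :=
  dadd (dderiv (dderiv (dmul a (dderiv (dderiv T))))) (dscal (- (1)) (dmul k T)).

Section Scalar.
Variables (a k : smooth).
Hypothesis a0 : forall x, a x <> RtoC 0.

Definition sinv : smooth := Smooth _ (is_smooth_Cinv a (smoothP a) a0).

(** The last row is [a u'''' + 2 a' u''' + a'' u'' = k u], the expanded form of [(a u'')'' = k u],
    solved for [u'''']. *)
Definition companion (i j : nat) : smooth :=
  match i, j with
  | 0%nat, 1%nat => csmooth 1
  | 1%nat, 2%nat => csmooth 1
  | 2%nat, 3%nat => csmooth 1
  | 3%nat, 0%nat => smul sinv k
  | 3%nat, 2%nat => smul sinv (sopp (sder (sder a)))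
  | 3%nat, 3%nat => smul sinv (smul (csmooth (- (2))) (sder a))
  | _, _ => csmooth 0
  end.

Lemma sinv_eval x : sinv x = (/ a x)%C.
Proof. reflexivity. Qed.

Lemma scalar_op_eval u x : scalar_op a k u x =
  (a x * Nat.iter 4 sder u x + 2 * (sder a x * Nat.iter 3 sder u x)
   + sder (sder a) x * Nat.iter 2 sder u x - k x * u x)%C.
Proof.
  unfold scalar_op. rewrite !sder_mul, !sder_add, !sder_mul.
  change (Nat.iter 4 sder u) with (sder (sder (sder (sder u)))).
  change (Nat.iter 3 sder u) with (sder (sder (sder u))).
  change (Nat.iter 2 sder u) with (sder (sder u)). seval. ring.
Qed.

Lemma companion_solves u : (forall x, scalar_op a k u x = RtoC 0) ->
  solves 4 companion (fun i => Nat.iter i sder u).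
Proof.
  intros H i Hi.
  do 3 (destruct i as [|i]; [apply smooth_ext; intros x; simpl; ring|]).
  destruct i as [|i]; [|lia]. apply smooth_ext. intros x.
  specialize (H x). rewrite scalar_op_eval in H.
  change (sder (Nat.iter 3 sder u) x) with (Nat.iter 4 sder u x).
  rewrite ssum_eval. cbv [csum companion]. seval. rewrite !sinv_eval.
  assert (A := a0 x).
  apply (f_equal (fun z => (/ a x * z)%C)) in H.
  transitivity (Nat.iter 4 sder u x - / a x * (a x * Nat.iter 4 sder u x + 2 * (sder a x * Nat.iter 3 sder u x)
   + sder (sder a) x * Nat.iter 2 sder u x - k x * u x))%C.
  - rewrite H. simpl. ring.
  - simpl Nat.iter. field. trivial.
Qed.

Lemma solves_companion y : solves 4 companion y ->
  (forall i, (i < 4)%nat -> y i = Nat.iter i sder (y O)) /\ forall x, scalar_op a k (y O) x = RtoC 0.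
Proof.
  intros H.
  assert (E1 : y 1%nat = sder (y 0%nat)).
  { rewrite (H 0%nat) by lia. apply smooth_ext. intros x. simpl. ring. }
  assert (E2 : y 2%nat = sder (y 1%nat)).
  { rewrite (H 1%nat) by lia. apply smooth_ext. intros x. simpl. ring. }
  assert (E3 : y 3%nat = sder (y 2%nat)).
  { rewrite (H 2%nat) by lia. apply smooth_ext. intros x. simpl. ring. }
  split.
  - intros i Hi. do 4 (destruct i as [|i]; [simpl Nat.iter; rewrite ?E3, ?E2, ?E1; easy|]). lia.
  - intros x. rewrite scalar_op_eval.
    change (Nat.iter 4 sder (y 0%nat)) with (sder (sder (sder (sder (y 0%nat))))).
    change (Nat.iter 3 sder (y 0%nat)) with (sder (sder (sder (y 0%nat)))).
    change (Nat.iter 2 sder (y 0%nat)) with (sder (sder (y 0%nat))).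
    rewrite <- E1, <- E2, <- E3, (H 3%nat), ssum_eval by lia.
    cbv [csum companion]. seval. rewrite !sinv_eval.
        field. apply a0.
Qed.

Lemma scalar_exists x0 (c : nat -> C) : exists u, (forall x, scalar_op a k u x = RtoC 0) /\
  forall i, (i < 4)%nat -> Nat.iter i sder u x0 = c i.
Proof.
  destruct (linear_system 4 companion x0 c) as [y Hy].
  destruct (solves_companion y) as [E1 E2]; [intros i Hi; now apply Hy|].
  exists (y 0%nat). split; trivial. intros i Hi. rewrite <- E1 by trivial. now apply Hy.
Qed.

Lemma scalar_unique x0 u v :
  (forall x, scalar_op a k u x = RtoC 0) -> (forall x, scalar_op a k v x = RtoC 0) ->
  (forall i, (i < 4)%nat -> Nat.iter i sder u x0 = Nat.iter i sder v x0) -> u = v.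
Proof.
  intros Hu Hv E. apply smooth_ext. intros x.
  apply (solves_unique 4 companion x0 _ _ (companion_solves u Hu) (companion_solves v Hv) E 0 x). lia.
Qed.

Lemma scalar_dop_expand T t : scalar_dop a k T t =
  (dmul a (dderiv_n 4 T) t + 2 * dmul (sder a) (dderiv_n 3 T) t
   + dmul (sder (sder a)) (dderiv_n 2 T) t - dmul k T t)%C.
Proof.
  unfold scalar_dop. rewrite dadd_eval, dscal_eval, !dderiv_dmul.
  change (dderiv (dadd ?A ?B)) with (dderiv (dadd A B)).
  assert (Dadd : forall S S', dderiv (dadd S S') = dadd (dderiv S) (dderiv S')).
  { intros S S'. apply distr_ext. intros s. deval. ring. }
  rewrite Dadd, !dderiv_dmul, !dadd_eval.
  change (dderiv_n 4 T) with (dderiv (dderiv (dderiv (dderiv T)))).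
  change (dderiv_n 3 T) with (dderiv (dderiv (dderiv T))).
  change (dderiv_n 2 T) with (dderiv (dderiv T)). ring.
Qed.

Lemma scalar_regularity U x0 (r : posreal) T :
  convex U -> (forall x, Rabs (x - x0) <= r -> U x) -> agree U (scalar_dop a k T) dzero ->
  exists u, (forall x, scalar_op a k u x = RtoC 0) /\ agree U T (reg (pw_of_smooth u)).
Proof.
  intros HU Hx0 HT.
  destruct (distribution_solution 4 companion U x0 r (fun i => dderiv_n i T) HU Hx0) as [u [Hu Hr]].
  - intros i Hi t c d Hc Ht. rewrite dsumn_eval.
    do 3 (destruct i as [|i]; [cbv [csum companion]; rewrite !dmul_const, !dscal_eval;
      unfold dderiv_n; cbn [Nat.iter nat_rect]; ring|]).
    destruct i as [|i]; [|lia].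
    cbv [csum companion]. rewrite !dmul_const, !dscal_eval.
    (* Dividing the equation by [a] amounts to testing it with [t / a]. *)
    assert (E := HT (tmul sinv t) c d Hc).
    rewrite scalar_dop_expand, dzero_eval in E.
    assert (E' := E (fun x Hx => Ht x (tmul_supp _ _ _ Hx))). clear E.
    change (dderiv (dderiv_n 3 T) t) with (dderiv_n 4 T t).
    replace (dmul a (dderiv_n 4 T) (tmul sinv t)) with (dderiv_n 4 T t) in E'.
    2:{ rewrite dmul_eval. f_equal. apply test_ext. intros x. simpl. field. apply a0. }
    assert (R : forall f S, dmul (smul sinv f) S t = dmul f S (tmul sinv t)).
    { intros f S. rewrite !dmul_eval. f_equal. apply test_ext. intros x. simpl. ring. }
    rewrite !R. unfold sopp. rewrite <- !dmul_dmul, !dmul_const, !dscal_eval.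
    unfold dderiv_n in E' |- *. cbn [Nat.iter nat_rect] in E' |- *.
    set (X := dderiv (dderiv (dderiv (dderiv T))) t) in *.
    match type of E' with ?L = _ => transitivity (X - L)%C; [rewrite E'|]; ring end.
  - destruct (solves_companion u Hu) as [_ E]. exists (u 0%nat). split; trivial. apply (Hr 0%nat). lia.
Qed.
End Scalar.

(** * Distributions with one singular point *)

Definition deltas (p : R) (c : nat -> C) (n : nat) : distr :=
  dsum (fun j => dscal (c j) (dderiv_n j (ddelta p))) n.

Lemma coeff_eval p f g c n t : coeff p f g c n t =
  (reg (H_left p) (tmul f t) + reg (H_right p) (tmul g t) + deltas p c n t)%C.
Proof. reflexivity. Qed.

Opaque coeff.

Lemma deltas_S p c n t : deltas p c (S n) t = (deltas p c n t + c (S n) * dderiv_n (S n) (ddelta p) t)%C.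
Proof. reflexivity. Qed.

Lemma deltas_0 p c t : deltas p c 0 t = (c O * t p)%C.
Proof. reflexivity. Qed.

Lemma dderiv_n_delta p j t :
  dderiv_n j (ddelta p) t = ((- (1)) ^ j * Nat.iter j sder (stest t) p)%C.
Proof.
  revert t. induction j as [|j IH]; intros t.
  - change (t p = 1 * t p)%C. ring.
  - change (- dderiv_n j (ddelta p) (tderiv t) = (- (1)) ^ S j * Nat.iter (S j) sder (stest t) p)%C.
    rewrite IH, Nat.iter_succ_r.
    change (sder (stest t)) with (stest (tderiv t)). simpl Cpow. ring.
Qed.

Lemma deltas_ext p (c c' : nat -> C) n : (forall j, (j <= n)%nat -> c j = c' j) -> deltas p c n = deltas p c' n.
Proof.
  intros H. apply distr_ext. intros t. induction n as [|n IH].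
  - rewrite !deltas_0, H; easy.
  - rewrite !deltas_S, IH, H; trivial. intros j Hj. apply H. lia.
Qed.

Lemma deltas_truncate p c n : c (S n) = RtoC 0 -> deltas p c (S n) = deltas p c n.
Proof. intros H. apply distr_ext. intros t. rewrite deltas_S, H. ring. Qed.

Lemma coeff_ext p (f f' g g' : smooth) (c c' : nat -> C) n : (forall x, f x = f' x) -> (forall x, g x = g' x) ->
  (forall j, (j <= n)%nat -> c j = c' j) -> coeff p f g c n = coeff p f' g' c' n.
Proof.
  intros Hf Hg Hc. rewrite (smooth_ext f f' Hf), (smooth_ext g g' Hg).
  apply distr_ext. intros t. rewrite !coeff_eval. f_equal. now rewrite (deltas_ext p c c').
Qed.

Lemma coeff_truncate p f g c n : c (S n) = RtoC 0 -> coeff p f g c (S n) = coeff p f g c n.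
Proof. intros H. apply distr_ext. intros t. rewrite !coeff_eval. now rewrite deltas_truncate. Qed.

Lemma deltas_add p c c' n t :
  deltas p (fun j => c j + c' j)%C n t = (deltas p c n t + deltas p c' n t)%C.
Proof. induction n as [|n IH]; [rewrite !deltas_0|rewrite !deltas_S, IH]; ring. Qed.

Lemma deltas_scal p k c n t : deltas p (fun j => k * c j)%C n t = (k * deltas p c n t)%C.
Proof. induction n as [|n IH]; [rewrite !deltas_0|rewrite !deltas_S, IH]; ring. Qed.

Lemma coeff_add p f g c f' g' c' n : dadd (coeff p f g c n) (coeff p f' g' c' n) =
  coeff p (sadd f f') (sadd g g') (fun j => c j + c' j)%C n.
Proof.
  apply distr_ext. intros t. rewrite dadd_eval, !coeff_eval, deltas_add.
  rewrite <- !dmul_eval, !dmul_sadd, !dadd_eval. ring.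
Qed.

Lemma coeff_scal p k f g c n : dscal k (coeff p f g c n) =
  coeff p (smul (csmooth k) f) (smul (csmooth k) g) (fun j => k * c j)%C n.
Proof.
  apply distr_ext. intros t. rewrite dscal_eval, !coeff_eval, deltas_scal.
  rewrite <- !dmul_eval, <- !dmul_dmul, !dmul_const, !dscal_eval. ring.
Qed.

Lemma deltas_zero_coef p n t : deltas p (fun _ => RtoC 0) n t = RtoC 0.
Proof. induction n as [|n IH]; [rewrite deltas_0|rewrite deltas_S, IH]; ring. Qed.

Lemma coeff_reg p f n : reg (pw_of_smooth f) = coeff p f f (fun _ => RtoC 0) n.
Proof.
  apply distr_ext. intros t. rewrite coeff_eval, deltas_zero_coef, (reg_smooth_split p f). deval. ring.
Qed.

(** Each one-sided part contributes its value at [p], with the sign of the derivative of the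
    Heaviside function. The jump [g p - f p] enters at order 0 and the given coefficients move up by
    one order. *)
Lemma coeff_deriv p f g c n : dderiv (coeff p f g c n) = coeff p (sder f) (sder g)
  (fun j => match j with O => (g p - f p)%C | S j => c j end) (S n).
Proof.
  apply distr_ext. intros t. rewrite dderiv_eval, !coeff_eval.
  assert (E : deltas p (fun j => match j with O => (g p - f p)%C | S j => c j end) (S n) t =
    ((g p - f p) * t p - deltas p c n (tderiv t))%C).
  { induction n as [|n IH].
    - rewrite deltas_S, !deltas_0. change (dderiv_n 1 (ddelta p) t) with (- tderiv t p)%C. ring.
    - rewrite deltas_S, IH, deltas_S.
      change (dderiv_n (S (S n)) (ddelta p) t) with (- dderiv_n (S n) (ddelta p) (tderiv t))%C. ring. }
  rewrite E.
  assert (L := f_equal (fun T : distr => T t) (dderiv_dmul f (reg (H_left p)))).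
  assert (R := f_equal (fun T : distr => T t) (dderiv_dmul g (reg (H_right p)))).
  cbv beta in L, R. rewrite dderiv_H_left in L. rewrite dderiv_H_right in R.
  rewrite dadd_eval, dderiv_eval, !dmul_eval, dscal_eval in L.
  rewrite dadd_eval, dderiv_eval, !dmul_eval in R.
  change (ddelta p (tmul f t)) with (f p * t p)%C in L.
  change (ddelta p (tmul g t)) with (g p * t p)%C in R.
  transitivity (- reg (H_left p) (tmul f (tderiv t)) + - reg (H_right p) (tmul g (tderiv t))
    - deltas p c n (tderiv t))%C; [ring|]. rewrite L, R. ring.
Qed.

Lemma stest_tmul f t : stest (tmul f t) = smul f (stest t).
Proof. reflexivity. Qed.

(** Coefficients of the product of [h] with a sum of Dirac derivatives of order at most 3, from [h
    delta^(j) = sum_i (-1)^(j-i) binom(j,i) h^(j-i)(p) delta^(i)]. *)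
Definition mul_jet (h : smooth) (p : R) (c : nat -> C) (j : nat) : C :=
  match j with
  | 0%nat => h p * c 0%nat - sder h p * c 1%nat + sder (sder h) p * c 2%nat
             - sder (sder (sder h)) p * c 3%nat
  | 1%nat => h p * c 1%nat - 2 * (sder h p * c 2%nat) + 3 * (sder (sder h) p * c 3%nat)
  | 2%nat => h p * c 2%nat - 3 * (sder h p * c 3%nat)
  | _ => h p * c 3%nat
  end%C.

Lemma coeff_mul p h f g c : dmul h (coeff p f g c 3) =
  coeff p (smul h f) (smul h g) (mul_jet h p c) 3.
Proof.
  apply distr_ext. intros t. rewrite dmul_eval, !coeff_eval.
  f_equal; [f_equal; f_equal; apply test_ext; intros x; simpl; ring|].
  rewrite !deltas_S, !deltas_0, !dderiv_n_delta, stest_tmul.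
  simpl Nat.iter. rewrite !sder_mul, !sder_add, !sder_mul, !sder_add, !sder_mul. seval.
  change (stest t p) with (t p). change (tmul h t p) with (h p * t p)%C.
  simpl Cpow. unfold mul_jet. ring.
Qed.

(** * Vanishing test functions and independence of Dirac derivatives *)

Definition sx (p : R) : smooth := sreal (fun x => x - p) (rsmooth_minus _ _ rsmooth_id (rsmooth_const p)).

Fixpoint spow (p : R) (m : nat) : smooth :=
  match m with O => csmooth 1 | S m => smul (sx p) (spow p m) end.

Lemma sder_sx p : sder (sx p) = csmooth 1.
Proof.
  apply smooth_ext. intros x. apply (is_cderive_unique _ (fun _ => RtoC 1)).
  intros y. split; simpl; auto_derive; trivial; ring.
Qed.

Lemma sder_spow p m : sder (spow p (S m)) = smul (csmooth (INR (S m))) (spow p m).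
Proof.
  induction m as [|m IH].
  - simpl. rewrite sder_mul, sder_sx, sder_const. apply smooth_ext. intros x. simpl. ring.
  - change (spow p (S (S m))) with (smul (sx p) (spow p (S m))).
    rewrite sder_mul, sder_sx, IH. apply smooth_ext. intros x. seval.
    rewrite (S_INR (S m)), RtoC_plus. simpl spow. seval. ring.
Qed.

(** [((x - p)^(m+1) s)' = (x - p)^m ((m + 1) s + (x - p) s')] *)
Definition lower (p : R) (m : nat) (s : smooth) : smooth :=
  sadd (smul (csmooth (INR (S m))) s) (smul (sx p) (sder s)).

Lemma sder_spow_mul p m s : sder (smul (spow p (S m)) s) = smul (spow p m) (lower p m s).
Proof.
  rewrite sder_mul, sder_spow. apply smooth_ext. intros x. unfold lower. simpl spow. seval. ring.
Qed.

Lemma sx_at p : sx p p = RtoC 0.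
Proof. change (RtoC (p - p) = RtoC 0). f_equal. ring. Qed.

Lemma lower_at p m s : lower p m s p = (INR (S m) * s p)%C.
Proof. unfold lower. seval. rewrite sx_at. ring. Qed.

Lemma spow_at p m : spow p (S m) p = RtoC 0.
Proof. change (sx p p * spow p m p = 0)%C. rewrite sx_at. ring. Qed.

Lemma jet_low p m s j : (j < m)%nat -> Nat.iter j sder (smul (spow p m) s) p = RtoC 0.
Proof.
  revert s j. induction m as [|m IH]; intros s j Hj; [lia|]. destruct j as [|j].
  - change (spow p (S m) p * s p = 0)%C. rewrite spow_at. ring.
  - rewrite Nat.iter_succ_r, sder_spow_mul. apply IH. lia.
Qed.

(** The constant is [m!]; later arguments use only that it is nonzero. *)
Lemma jet_top p m : exists q, q <> RtoC 0 /\ forall s,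
  Nat.iter m sder (smul (spow p m) s) p = (q * s p)%C.
Proof.
  induction m as [|m [q [Hq IH]]].
  - exists (RtoC 1). split; [apply C1_nz|]. intros s. reflexivity.
  - exists (q * INR (S m))%C. split.
    + apply Cmult_neq_0; trivial. intros E. apply RtoC_inj in E. revert E. apply not_0_INR. lia.
    + intros s. rewrite Nat.iter_succ_r, sder_spow_mul, IH, lower_at. ring.
Qed.

Lemma Cpow_opp1_nz n : ((- (1)) ^ n)%C <> RtoC 0.
Proof.
  induction n as [|n IH]; simpl; [apply C1_nz|]. apply Cmult_neq_0; trivial.
  intros E. apply (f_equal Re) in E. simpl in E. lra.
Qed.

Lemma deltas_low p c n t m s : stest t = smul (spow p m) s -> (n < m)%nat -> deltas p c n t = RtoC 0.
Proof.
  intros E Hn. induction n as [|n IH].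
  - rewrite deltas_0. change (t p) with (stest t p). rewrite E. destruct m as [|m]; [lia|].
    change (c 0%nat * (spow p (S m) p * s p) = 0)%C. rewrite spow_at. ring.
  - rewrite deltas_S, dderiv_n_delta, E, jet_low by trivial. rewrite IH by lia. ring.
Qed.

(** A test function vanishing at [p] to the exact order [n] annihilates all terms of lower order and
    isolates the top coefficient. *)
Lemma deltas_top p c n t s : stest t = smul (spow p n) s -> s p <> RtoC 0 ->
  deltas p c n t = RtoC 0 -> c n = RtoC 0.
Proof.
  intros E Hs H. destruct (jet_top p n) as [q [Hq J]].
  assert (Z : (c n * ((- (1)) ^ n * (q * s p)) = 0)%C).
  { rewrite <- H, <- J, <- E. destruct n as [|n].
    - rewrite deltas_0. simpl. ring.
    - rewrite deltas_S, dderiv_n_delta, (deltas_low p c n t (S n) s E) by lia. ring. }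
  destruct (excluded_middle_informative (c n = RtoC 0)) as [E0|E0]; trivial. exfalso. revert Z.
  repeat apply Cmult_neq_0; trivial. apply Cpow_opp1_nz.
Qed.

Definition bump1 (p : R) : test := bump p p (mkposreal _ Rlt_0_1).

Lemma bump1_at p : bump1 p p = RtoC 1.
Proof. simpl. rewrite plateau_1; trivial; lra. Qed.

(** The coefficients are removed from the top down with the test functions [(x - p)^n chi]. *)
Lemma deltas_independent p c n : deltas p c n = dzero -> forall j, (j <= n)%nat -> c j = RtoC 0.
Proof.
  intros H.
  assert (Z : c n = RtoC 0).
  { apply (deltas_top p c n (tmul (spow p n) (bump1 p)) (stest (bump1 p))); trivial.
    - change (bump1 p p <> RtoC 0). rewrite bump1_at. apply C1_nz.
    - now rewrite H. }
  revert H Z. induction n as [|n IH]; intros H Z j Hj.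
  - now replace j with 0%nat by lia.
  - destruct (Nat.eq_dec j (S n)) as [->|Hn]; trivial.
    rewrite deltas_truncate in H by trivial. apply IH; trivial; [|lia].
    apply (deltas_top p c n (tmul (spow p n) (bump1 p)) (stest (bump1 p))); trivial.
    + change (bump1 p p <> RtoC 0). rewrite bump1_at. apply C1_nz.
    + now rewrite H.
Qed.

(** The term of highest order of [Delta] is seen by the test function
    [(x - p)^(n + 4) chi], which annihilates the lower order terms. *)
Lemma no_deltas p (a k : smooth) c r n : a p <> RtoC 0 ->
  dadd (scalar_dop a k (deltas p c n)) (deltas p r 3) = dzero ->
  forall j, (j <= n)%nat -> c j = RtoC 0.
Proof.
  intros Ha H.
  assert (Top : forall n, dadd (scalar_dop a k (deltas p c n)) (deltas p r 3) = dzero -> c n = RtoC 0).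
  { clear n H. intros n H.
    set (t := tmul (spow p (S (S (S (S n))))) (bump1 p)).
    assert (E := f_equal (fun T : distr => T t) H). cbv beta in E.
    rewrite dadd_eval, dzero_eval in E.
    rewrite (deltas_low p r 3 t (S (S (S (S n)))) (stest (bump1 p))) in E by (trivial || lia).
    unfold scalar_dop in E. rewrite dadd_eval, dscal_eval, !dmul_eval in E.
    rewrite (deltas_low p c n (tmul k t) (S (S (S (S n)))) (smul k (stest (bump1 p)))) in E.
    2:{ apply smooth_ext. intros x. unfold t. rewrite !stest_tmul. seval. ring. }
    2: lia.
    (* Two derivatives lower the power from [n + 4] to [n + 2], and two more, after the
       multiplication by [a], lower it to [n]. The cofactor [s4] at [p] is [a p] times nonzero
       integers. *)
    set (s2 := smul a (lower p (S (S n)) (lower p (S (S (S n))) (stest (bump1 p))))).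
    set (s4 := lower p n (lower p (S n) s2)).
    set (q := tderiv (tderiv (tmul a (tderiv (tderiv t))))).
    assert (Eq : stest q = smul (spow p n) s4).
    { change (stest q) with (sder (sder (smul a (sder (sder (smul (spow p (S (S (S (S n))))) (stest (bump1 p)))))))).
      rewrite !sder_spow_mul.
      replace (smul a _) with (smul (spow p (S (S n))) s2)
        by (apply smooth_ext; intros x; unfold s2; seval; ring).
      now rewrite !sder_spow_mul. }
    apply (deltas_top p c n q s4 Eq).
    - unfold s4. rewrite !lower_at. unfold s2. seval. rewrite !lower_at.
      change (stest (bump1 p) p) with (bump1 p p). rewrite bump1_at.
      assert (I : forall m, RtoC (INR (S m)) <> RtoC 0).
      { intros m E'. apply RtoC_inj in E'. revert E'. apply not_0_INR. lia. }
      repeat apply Cmult_neq_0; trivial; try apply I. apply C1_nz.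
    - rewrite !dderiv_eval, dmul_eval, !dderiv_eval in E. fold q in E.
      rewrite <- E. ring. }
  revert H. induction n as [|n IH]; intros H j Hj.
  - replace j with 0%nat by lia. now apply Top.
  - assert (Z := Top _ H). destruct (Nat.eq_dec j (S n)) as [->|Hn]; trivial.
    rewrite deltas_truncate in H by trivial. apply IH; trivial. lia.
Qed.

(** * Glued functions and the shape of elements of the algebra *)

Definition glue_fun (p : R) (u v : smooth) (y : C) (x : R) : C :=
  if Rlt_dec x p then u x else if Rlt_dec p x then v x else y.

Lemma Cderive_n_ext_loc (f g : R -> C) n x : locally x (fun t => f t = g t) ->
  Cderive_n f n x = Cderive_n g n x.
Proof.
  intros L. unfold Cderive_n.
  f_equal; apply Derive_n_ext_loc; apply filter_imp with (2 := L); intros t Ht; now rewrite Ht.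
Qed.

Lemma ex_Cderive_n_ext_loc (f g : R -> C) n x : locally x (fun t => f t = g t) ->
  ex_Cderive_n f n x -> ex_Cderive_n g n x.
Proof.
  intros L [H1 H2]. split; [apply ex_derive_n_ext_loc with (2 := H1)|apply ex_derive_n_ext_loc with (2 := H2)];
  apply filter_imp with (2 := L); intros t Ht; now rewrite Ht.
Qed.

Lemma is_pwsmooth_glue p u v y : is_pwsmooth (glue_fun p u v y).
Proof.
  assert (L1 : forall x, x < p -> locally x (fun t => u t = glue_fun p u v y t)).
  { intros x Hx. apply filter_imp with (fun t => t < p); [|now apply open_lt].
    intros t Ht. unfold glue_fun. now destruct Rlt_dec. }
  assert (L2 : forall x, p < x -> locally x (fun t => v t = glue_fun p u v y t)).
  { intros x Hx. apply filter_imp with (fun t => p < t); [|now apply open_gt].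
    intros t Ht. unfold glue_fun. destruct Rlt_dec; [lra|]. now destruct Rlt_dec. }
  assert (Lim : forall (f : smooth) n, continuous (Cderive_n f n) p).
  { intros f n. apply (continuous_ext (Nat.iter n sder f)).
    - intros t. now rewrite Cderive_n_sder.
    - apply is_smooth_continuous, smoothP. }
  exists (p :: nil). split.
  - intros x Hx n. destruct (Rtotal_order x p) as [H|[H|H]].
    + apply (ex_Cderive_n_ext_loc u); [now apply L1|apply smoothP].
    + elim Hx. now left.
    + apply (ex_Cderive_n_ext_loc v); [now apply L2|apply smoothP].
  - intros x [<-|[]] n. split.
    + exists (Cderive_n u n p). apply filterlim_ext_loc with (Cderive_n u n).
      * exists (mkposreal _ Rlt_0_1). intros t _ Ht. now apply Cderive_n_ext_loc, L1.
      * intros P HP. apply at_left_locally. exact (Lim u n P HP).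
    + exists (Cderive_n v n p). apply filterlim_ext_loc with (Cderive_n v n).
      * exists (mkposreal _ Rlt_0_1). intros t _ Ht. now apply Cderive_n_ext_loc, L2.
      * intros P HP. apply at_right_locally. exact (Lim v n P HP).
Qed.

(** The value at [p] is a parameter so that [sided_reg] can match a given function at every point
    near [p]. *)
Definition glue p u v y : pwsmooth := Pwsmooth _ (is_pwsmooth_glue p u v y).

Lemma glue_left p u v y x : x < p -> glue p u v y x = u x.
Proof. intros H. simpl. unfold glue_fun. now destruct Rlt_dec. Qed.

Lemma glue_right p u v y x : p < x -> glue p u v y x = v x.
Proof. intros H. simpl. unfold glue_fun. destruct Rlt_dec; [lra|]. now destruct Rlt_dec. Qed.

Lemma reg_glue p u v y : reg (glue p u v y) = coeff p u v (fun _ => RtoC 0) 0.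
Proof.
  rewrite (reg_two_sides _ p u v); [|apply glue_left|apply glue_right].
  apply distr_ext. intros t. rewrite coeff_eval, deltas_zero_coef. deval. ring.
Qed.

Lemma Aspace_coeff p u v : Aspace (coeff p u v (fun _ => RtoC 0) 0).
Proof. exists (glue p u v 0), 0%nat. symmetry. apply reg_glue. Qed.

Lemma agree_ddelta (U : R -> Prop) p : ~ U p -> agree U (ddelta p) dzero.
Proof.
  intros HU t c d Hc Ht. change (t p = 0%C).
  destruct (excluded_middle_informative (t p = 0%C)) as [E|E]; trivial.
  elim HU. now apply Hc, Ht.
Qed.

Lemma agree_deltas (U : R -> Prop) p c n : ~ U p -> agree U (deltas p c n) dzero.
Proof.
  intros HU. assert (Z : forall j, agree U (dderiv_n j (ddelta p)) dzero).
  { intros j. apply agree_trans with (dderiv_n j dzero).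
    - now apply agree_dderiv_n, agree_ddelta.
    - replace (dderiv_n j dzero) with dzero; [apply agree_refl|].
      induction j as [|j IH]; [easy|]. change (dzero = dderiv (dderiv_n j dzero)).
      rewrite <- IH. apply distr_ext. intros t. deval. ring. }
  intros t a b Ha Ht. rewrite dzero_eval. induction n as [|n IH].
  - rewrite deltas_0. assert (E := Z 0%nat t a b Ha Ht). change (t p = 0%C) in E. rewrite E. ring.
  - rewrite deltas_S, IH, (Z (S n) t a b Ha Ht), dzero_eval. ring.
Qed.

Lemma sided_coeff p f g c n : sided p (coeff p f g c n) f g.
Proof.
  set (G := glue p f g 0). assert (E := reg_glue p f g 0).
  assert (D : forall U : R -> Prop, ~ U p -> agree U (coeff p f g c n) (reg (glue p f g 0))).
  { intros U HU t a b Ha Ht. rewrite E, !coeff_eval.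
    now rewrite (agree_deltas U p c n HU t a b Ha Ht), (agree_deltas U p _ 0 HU t a b Ha Ht). }
  split.
  - apply agree_trans with (1 := D (fun x => x < p) (Rlt_irrefl p)).
    apply agree_reg_pw. intros x Hx. rewrite glue_left; trivial.
  - apply agree_trans with (1 := D (fun x => p < x) (Rlt_irrefl p)).
    apply agree_reg_pw. intros x Hx. rewrite glue_right; trivial.
Qed.

Lemma sided_deriv p F u v : sided p F u v -> sided p (dderiv F) (sder u) (sder v).
Proof. intros [H1 H2]. split; rewrite <- dderiv_reg; now apply agree_dderiv. Qed.

Lemma sided_deriv_n p F u v n : sided p F u v ->
  sided p (dderiv_n n F) (Nat.iter n sder u) (Nat.iter n sder v).
Proof.
  intros H. induction n as [|n IH]; [exact H|]. exact (sided_deriv _ _ _ _ IH).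
Qed.

Lemma convex_left p : convex (fun x => x < p).
Proof. intros c d x Hc Hd Hx. lra. Qed.

Lemma convex_right p : convex (fun x => p < x).
Proof. intros c d x Hc Hd Hx. lra. Qed.

(** A ball inside the half-line, where [derivative_zero] places its auxiliary test function. *)
Lemma ball_left p x : Rabs (x - (p - 2)) <= mkposreal _ Rlt_0_1 -> x < p.
Proof. simpl. intros H. apply Rabs_le_between in H. lra. Qed.

Lemma ball_right p x : Rabs (x - (p + 2)) <= mkposreal _ Rlt_0_1 -> p < x.
Proof. simpl. intros H. apply Rabs_le_between in H. lra. Qed.

(** Near [p] the function equals its germs, and these coincide with [u] and [v] because a smooth
    density is determined by its distribution. Equality of functions leaves no room for a
    distribution carried by [p]. *)
Lemma sided_reg p (f : pwsmooth) u v : sided p (reg f) u v -> reg f = coeff p u v (fun _ => RtoC 0) 0.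
Proof.
  intros [H1 H2]. rewrite <- (reg_glue p u v (f p)).
  apply agree_all, agree_local. intros x _.
  destruct (Rtotal_order x p) as [H|[->|H]].
  - exists (x - 1), p. split; [lra|].
    apply agree_trans with (reg (pw_of_smooth u)); [apply agree_sub with (2 := H1); intros y Hy; lra|].
    apply agree_reg_pw. intros y Hy. rewrite glue_left; [easy|lra].
  - destruct (pw_germs f p) as [r [gm [gp [Hr [Em Ep]]]]].
    exists (p - r), (p + r). split; [lra|]. apply agree_reg_pw. intros y Hy.
    destruct (Rtotal_order y p) as [H|[->|H]].
    + rewrite glue_left, Em by lra. apply (smooth_agree_on gm u (p - r) p); [|lra].
      apply agree_trans with (reg f).
      * apply agree_reg_pw. intros z Hz. symmetry. now apply Em.
      * apply agree_sub with (2 := H1). intros z Hz. lra.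
    + simpl. unfold glue_fun. destruct Rlt_dec; [lra|easy].
    + rewrite glue_right, Ep by lra. apply (smooth_agree_on gp v p (p + r)); [|lra].
      apply agree_trans with (reg f).
      * apply agree_reg_pw. intros z Hz. symmetry. now apply Ep.
      * apply agree_sub with (2 := H2). intros z Hz. lra.
  - exists p, (x + 1). split; [lra|].
    apply agree_trans with (reg (pw_of_smooth v)); [apply agree_sub with (2 := H2); intros y Hy; lra|].
    apply agree_reg_pw. intros y Hy. rewrite glue_right; [easy|lra].
Qed.

(** Induction on the number of derivatives: the undifferentiated distribution is smooth on each
    half-line, being a primitive of [u] or [v] there. Differentiating its normal form adds one order
    of Dirac terms. *)
Lemma sided_Aspace p phi u v : Aspace phi -> sided p phi u v -> exists c n, phi = coeff p u v c n.
Proof.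
  intros [f [n ->]]. revert u v. induction n as [|n IH]; intros u v H.
  - exists (fun _ => RtoC 0), 0%nat. now apply sided_reg.
  - destruct H as [H1 H2].
    destruct (regular_antiderivative _ (p - 2) (mkposreal _ Rlt_0_1) _ u (convex_left p) (ball_left p) H1)
      as [gu [Eu Au]].
    destruct (regular_antiderivative _ (p + 2) (mkposreal _ Rlt_0_1) _ v (convex_right p) (ball_right p) H2)
      as [gv [Ev Av]].
    destruct (IH gu gv (conj Au Av)) as [c [m E]].
    change (dderiv_n (S n) (reg f)) with (dderiv (dderiv_n n (reg f))).
    rewrite E, coeff_deriv, Eu, Ev. now eexists _, _.
Qed.

Lemma Aspace_deriv_n n G : Aspace G -> Aspace (dderiv_n n G).
Proof.
  intros [f [m ->]]. exists f, (n + m)%nat. unfold dderiv_n. now rewrite Nat.iter_add.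
Qed.

(** * The jump conditions *)

Section Ode.
Variables (xi : R) (w : C) (am ap bm bp : nat -> smooth) (A B : nat -> nat -> C).

Let a i := coeff xi (am i) (ap i) (A i) 1.
Let b i := coeff xi (bm i) (bp i) (B i) 3.

Lemma binomial_2_i : Binomial.C 2 0 = 1 /\ Binomial.C 2 1 = 2 /\ Binomial.C 2 2 = 1.
Proof. repeat split; unfold Binomial.C; simpl; field. Qed.

Lemma dderiv_add S T : dderiv (dadd S T) = dadd (dderiv S) (dderiv T).
Proof. apply distr_ext. intros t. deval. ring. Qed.

Lemma dderiv_dderiv_mul f T t : dderiv (dderiv (dmul f T)) t =
  (dmul f (dderiv (dderiv T)) t + 2 * dmul (sder f) (dderiv T) t + dmul (sder (sder f)) T t)%C.
Proof. rewrite !dderiv_dmul, !dderiv_add, !dderiv_dmul, !dadd_eval. ring. Qed.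

Lemma ode_lhs_eval phi t : ode_lhs a b w phi t =
  ((star (a 0%nat) (dderiv_n 4 phi) t + star (dderiv_n 4 phi) (a 1%nat) t)
   + 2 * (star (dderiv (a 0%nat)) (dderiv_n 3 phi) t + star (dderiv_n 3 phi) (dderiv (a 1%nat)) t)
   + (star (dderiv (dderiv (a 0%nat))) (dderiv_n 2 phi) t + star (dderiv_n 2 phi) (dderiv (dderiv (a 1%nat))) t)
   - w ^ 2 * (star (b 0%nat) phi t + star phi (b 1%nat) t))%C.
Proof.
  change (ode_lhs a b w phi t) with
    (RtoC (Binomial.C 2 0) * (star (a 0%nat) (dderiv_n 4 phi) t + star (dderiv_n 4 phi) (a 1%nat) t)
     + RtoC (Binomial.C 2 1) * (star (dderiv (a 0%nat)) (dderiv_n 3 phi) t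
         + star (dderiv_n 3 phi) (dderiv (a 1%nat)) t)
     + RtoC (Binomial.C 2 2) * (star (dderiv (dderiv (a 0%nat))) (dderiv_n 2 phi) t
         + star (dderiv_n 2 phi) (dderiv (dderiv (a 1%nat))) t)
     + - (w ^ 2) * (star (b 0%nat) phi t + star phi (b 1%nat) t))%C.
  destruct binomial_2_i as [-> [-> ->]]. ring.
Qed.

(** The binomial weights 1, 2, 1 are those of the Leibniz formula for the second derivative of
    [a phi''], with [a = a0 + a1]. *)
Lemma ode_lhs_agree (U : R -> Prop) phi (a0 a1 b0 b1 : smooth) :
  (forall i, agree U (star (dderiv_n i (a 0%nat)) (dderiv_n (4 - i) phi))
     (dmul (Nat.iter i sder a0) (dderiv_n (4 - i) phi))) ->
  (forall i, agree U (star (dderiv_n (4 - i) phi) (dderiv_n i (a 1%nat)))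
     (dmul (Nat.iter i sder a1) (dderiv_n (4 - i) phi))) ->
  agree U (star (b 0%nat) phi) (dmul b0 phi) -> agree U (star phi (b 1%nat)) (dmul b1 phi) ->
  agree U (ode_lhs a b w phi) (scalar_dop (sadd a0 a1) (smul (csmooth (w ^ 2)) (sadd b0 b1)) phi).
Proof.
  intros H0 H1 K0 K1 t c d Hc Ht. rewrite ode_lhs_eval.
  assert (E00 := H0 0%nat t c d Hc Ht). assert (E01 := H0 1%nat t c d Hc Ht). assert (E02 := H0 2%nat t c d Hc Ht).
  assert (E10 := H1 0%nat t c d Hc Ht). assert (E11 := H1 1%nat t c d Hc Ht). assert (E12 := H1 2%nat t c d Hc Ht).
  simpl (4 - _)%nat in E00, E01, E02, E10, E11, E12.
  change (dderiv_n 0 ?T) with T in E00, E10. change (dderiv_n 1 ?T) with (dderiv T) in E01, E11.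
  change (dderiv_n 2 (a ?i)) with (dderiv (dderiv (a i))) in E02, E12.
  rewrite E00, E01, E02, E10, E11, E12, (K0 t c d Hc Ht), (K1 t c d Hc Ht).
  unfold scalar_dop. rewrite dadd_eval, dscal_eval, dderiv_dderiv_mul.
  rewrite <- dmul_dmul, dmul_const, dscal_eval, !sder_add, !dmul_sadd, !dadd_eval.
  simpl Nat.iter. unfold dderiv_n. simpl Nat.iter. ring.
Qed.

Lemma sided_a i : sided xi (a i) (am i) (ap i).
Proof. exact (sided_coeff xi (am i) (ap i) (A i) 1). Qed.

Lemma sided_b i : sided xi (b i) (bm i) (bp i).
Proof. exact (sided_coeff xi (bm i) (bp i) (B i) 3). Qed.

Lemma ode_lhs_left phi : Aspace phi -> agree (fun x => x < xi) (ode_lhs a b w phi)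
  (scalar_dop (sadd (am 0%nat) (am 1%nat)) (smul (csmooth (w ^ 2)) (sadd (bm 0%nat) (bm 1%nat))) phi).
Proof.
  intros H. apply ode_lhs_agree; intros; [| | |].
  - apply (star_sided_A xi _ _ _ _ (sided_deriv_n _ _ _ _ i (sided_a 0)) (Aspace_deriv_n _ _ H)).
  - apply (star_A_sided xi _ _ _ _ (sided_deriv_n _ _ _ _ i (sided_a 1)) (Aspace_deriv_n _ _ H)).
  - apply (star_sided_A xi _ _ _ _ (sided_b 0) H).
  - apply (star_A_sided xi _ _ _ _ (sided_b 1) H).
Qed.

Lemma ode_lhs_right phi : Aspace phi -> agree (fun x => xi < x) (ode_lhs a b w phi)
  (scalar_dop (sadd (ap 0%nat) (ap 1%nat)) (smul (csmooth (w ^ 2)) (sadd (bp 0%nat) (bp 1%nat))) phi).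
Proof.
  intros H. apply ode_lhs_agree; intros; [| | |].
  - apply (star_sided_A xi _ _ _ _ (sided_deriv_n _ _ _ _ i (sided_a 0)) (Aspace_deriv_n _ _ H)).
  - apply (star_A_sided xi _ _ _ _ (sided_deriv_n _ _ _ _ i (sided_a 1)) (Aspace_deriv_n _ _ H)).
  - apply (star_sided_A xi _ _ _ _ (sided_b 0) H).
  - apply (star_A_sided xi _ _ _ _ (sided_b 1) H).
Qed.

Lemma dderiv_minus_reg F f : dderiv (dminus_reg F f) = dminus_reg (dderiv F) (sder f).
Proof. unfold dminus_reg. rewrite <- dderiv_reg. apply distr_ext. intros t. deval. ring. Qed.

(** By [star_sided], [a_0^(i)] is paired with derivatives of [v] after removal of its left function,
    and [a_1^(i)] with derivatives of [u]. In both families of terms the weights are again those of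
    the Leibniz formula, so the sum is an exact second derivative. *)
Lemma ode_lhs_sided phi u v : sided xi phi u v -> ode_lhs a b w phi =
  dadd (dderiv (dderiv (dadd (dadd
      (dmul (sder (sder v)) (dminus_reg (a 0%nat) (am 0%nat)))
      (dmul (sder (sder u)) (dminus_reg (a 1%nat) (ap 1%nat))))
      (dmul (sadd (am 0%nat) (ap 1%nat)) (dderiv (dderiv phi))))))
    (dscal (- (w ^ 2))%C (dadd (dadd
      (dmul v (dminus_reg (b 0%nat) (bm 0%nat)))
      (dmul u (dminus_reg (b 1%nat) (bp 1%nat))))
      (dmul (sadd (bm 0%nat) (bp 1%nat)) phi))).
Proof.
  intros H. apply distr_ext. intros t. rewrite ode_lhs_eval.
  assert (P := fun n => sided_deriv_n xi phi u v n H).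
  assert (D1 := fun i => sided_deriv _ _ _ _ (sided_a i)).
  assert (D2 := fun i => sided_deriv _ _ _ _ (D1 i)).
  rewrite (star_sided _ _ _ _ _ _ _ (sided_a 0) (P 4%nat)), (star_sided _ _ _ _ _ _ _ (P 4%nat) (sided_a 1)).
  rewrite (star_sided _ _ _ _ _ _ _ (D1 0%nat) (P 3%nat)), (star_sided _ _ _ _ _ _ _ (P 3%nat) (D1 1%nat)).
  rewrite (star_sided _ _ _ _ _ _ _ (D2 0%nat) (P 2%nat)), (star_sided _ _ _ _ _ _ _ (P 2%nat) (D2 1%nat)).
  rewrite (star_sided _ _ _ _ _ _ _ (sided_b 0) H), (star_sided _ _ _ _ _ _ _ H (sided_b 1)).
  rewrite !dderiv_add, !dadd_eval, !dderiv_dderiv_mul, dscal_eval, !dadd_eval, !sder_add, !dmul_sadd, !dadd_eval.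
  rewrite !dderiv_minus_reg. unfold dminus_reg.
  assert (Dm : forall f S T, dmul f (dadd S T) t = (dmul f S t + dmul f T t)%C) by reflexivity.
  assert (Dr : forall f k g, dmul f (dscal k (reg (pw_of_smooth g))) t = (k * reg (pw_of_smooth (smul f g)) t)%C).
  { intros f k g. now rewrite <- dmul_reg. }
  rewrite !Dm, !Dr.
  (* Commuting the regular product of a derivative of [u] with one of [ap 1] moves the subtraction
     from [phi^(4-i)] to [a_1^(i)]. *)
  assert (Sw : forall f g, reg (pw_of_smooth (smul f g)) t = reg (pw_of_smooth (smul g f)) t).
  { intros f g. do 3 f_equal. apply smooth_ext. intros x. seval. ring. }
  unfold dderiv_n. simpl Nat.iter.
  rewrite (Sw (ap 1%nat)), (Sw (sder (ap 1%nat))), (Sw (sder (sder (ap 1%nat)))), (Sw (bp 1%nat)).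
  ring.
Qed.

End Ode.

Definition shift_coef (z : C) (c : nat -> C) (j : nat) : C := match j with O => z | S j => c j end.

(** A vanishing top coefficient lets the derivative fit again into orders up to 3, which keeps all
    coefficient sequences at one length. *)
Lemma coeff_deriv3 p f g c : c 3%nat = RtoC 0 ->
  dderiv (coeff p f g c 3) = coeff p (sder f) (sder g) (shift_coef (g p - f p) c) 3.
Proof. intros H. rewrite coeff_deriv. exact (coeff_truncate p (sder f) (sder g) (shift_coef (g p - f p) c) 3 H). Qed.

Definition pad1 (c : nat -> C) (j : nat) : C := match j with 0%nat => c 0%nat | 1%nat => c 1%nat | _ => RtoC 0 end.

Lemma coeff_pad1 p f g c : coeff p f g c 1 = coeff p f g (pad1 c) 3.
Proof.
  rewrite (coeff_truncate p f g (pad1 c) 2), (coeff_truncate p f g (pad1 c) 1) by easy.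
  apply coeff_ext; trivial. intros [|[|j]] Hj; trivial. lia.
Qed.

Lemma coeff_pad0 p f g n : coeff p f g (fun _ => RtoC 0) 0 = coeff p f g (fun _ => RtoC 0) n.
Proof. induction n as [|n IH]; [easy|]. now rewrite coeff_truncate. Qed.

Lemma dminus_coeff p f g c n k :
  dminus_reg (coeff p f g c n) k = coeff p (sadd f (sopp k)) (sadd g (sopp k)) c n.
Proof.
  unfold dminus_reg. rewrite (coeff_reg p k n), coeff_scal, coeff_add.
  apply coeff_ext; intros; seval; ring.
Qed.

Section Jump.
Variables (xi : R) (w : C) (am ap bm bp : nat -> smooth) (A B : nat -> nat -> C).

Let a i := coeff xi (am i) (ap i) (A i) 1.
Let b i := coeff xi (bm i) (bp i) (B i) 3.

Definition mid_a : smooth := sadd (am 0%nat) (ap 1%nat).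
Definition left_a : smooth := sadd (am 0%nat) (am 1%nat).
Definition right_a : smooth := sadd (ap 0%nat) (ap 1%nat).
Definition mid_b : smooth := smul (csmooth (w ^ 2)) (sadd (bm 0%nat) (bp 1%nat)).
Definition left_b : smooth := smul (csmooth (w ^ 2)) (sadd (bm 0%nat) (bm 1%nat)).
Definition right_b : smooth := smul (csmooth (w ^ 2)) (sadd (bp 0%nat) (bp 1%nat)).

(** The Dirac coefficients of the distribution under the second derivative: [v''] acting on the
    singular part of [a_0], [u''] on that of [a_1], and [mid_a] on [phi''], whose singular part is
    [(v' - u') delta + (v - u) delta']. *)
Definition jump_a (u v : smooth) (j : nat) : C :=
  match j with
  | 0%nat => Nat.iter 2 sder v xi * A 0 0 - Nat.iter 3 sder v xi * A 0 1
      + (Nat.iter 2 sder u xi * A 1 0 - Nat.iter 3 sder u xi * A 1 1)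
      + (mid_a xi * (sder v xi - sder u xi) - sder mid_a xi * (v xi - u xi))
  | 1%nat => Nat.iter 2 sder v xi * A 0 1 + Nat.iter 2 sder u xi * A 1 1 + mid_a xi * (v xi - u xi)
  | _ => 0
  end%C.

Lemma principal_part u v :
  dadd (dadd (dmul (sder (sder v)) (dminus_reg (a 0%nat) (am 0%nat)))
             (dmul (sder (sder u)) (dminus_reg (a 1%nat) (ap 1%nat))))
       (dmul (sadd (am 0%nat) (ap 1%nat)) (dderiv (dderiv (coeff xi u v (fun _ => RtoC 0) 0)))) =
  coeff xi (smul left_a (sder (sder u))) (smul right_a (sder (sder v))) (jump_a u v) 3.
Proof.
  unfold a. rewrite !dminus_coeff, !coeff_pad1, (coeff_pad0 xi u v 3).
  rewrite !coeff_deriv3 by easy. rewrite !coeff_mul, !coeff_add.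
  apply coeff_ext.
  - intros x. unfold left_a. seval. ring.
  - intros x. unfold right_a. seval. ring.
  - intros j Hj.
    do 4 (destruct j as [|j]; [unfold mul_jet, pad1, shift_coef, jump_a; cbv iota beta;
      change (Nat.iter 2 sder ?f) with (sder (sder f));
      change (Nat.iter 3 sder ?f) with (sder (sder (sder f))); unfold mid_a; ring|]).
    lia.
Qed.

Definition jump_b (u v : smooth) (j : nat) : C := (mul_jet v xi (B 0%nat) j + mul_jet u xi (B 1%nat) j)%C.

Lemma potential_part u v :
  dadd (dadd (dmul v (dminus_reg (b 0%nat) (bm 0%nat))) (dmul u (dminus_reg (b 1%nat) (bp 1%nat))))
       (dmul (sadd (bm 0%nat) (bp 1%nat)) (coeff xi u v (fun _ => RtoC 0) 0)) =
  coeff xi (smul (sadd (bm 0%nat) (bm 1%nat)) u) (smul (sadd (bp 0%nat) (bp 1%nat)) v) (jump_b u v) 3.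
Proof.
  unfold b. rewrite !dminus_coeff, (coeff_pad0 xi u v 3), !coeff_mul, !coeff_add.
  apply coeff_ext.
  - intros x. seval. ring.
  - intros x. seval. ring.
  - intros j Hj. unfold jump_b.
    do 4 (destruct j as [|j]; [unfold mul_jet; ring|]). lia.
Qed.

(** The Dirac coefficients of the left-hand side of the equation. The second derivative shifts
    [jump_a] by two orders and adds, at orders 0 and 1, the jumps of [(a phi'')'] and of [a phi'']
    between the left and the right side. *)
Definition jump (u v : smooth) (j : nat) : C :=
  (match j with
   | 0%nat => sder right_a xi * Nat.iter 2 sder v xi + right_a xi * Nat.iter 3 sder v xi
              - (sder left_a xi * Nat.iter 2 sder u xi + left_a xi * Nat.iter 3 sder u xi)
   | 1%nat => right_a xi * Nat.iter 2 sder v xi - left_a xi * Nat.iter 2 sder u xi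
   | S (S j) => jump_a u v j
   end - w ^ 2 * jump_b u v j)%C.

Lemma ode_lhs_normal u v :
  ode_lhs a b w (coeff xi u v (fun _ => RtoC 0) 0) =
  coeff xi (scalar_op left_a left_b u) (scalar_op right_a right_b v) (jump u v) 3.
Proof.
  unfold a, b. rewrite (ode_lhs_sided xi w am ap bm bp A B _ u v (sided_coeff _ _ _ _ _)).
  rewrite principal_part, potential_part, !coeff_deriv3, coeff_scal, coeff_add by easy.
  apply coeff_ext.
  - intros x. unfold scalar_op, left_b. seval. ring.
  - intros x. unfold scalar_op, right_b. seval. ring.
  - intros j Hj. unfold jump, shift_coef.
    do 4 (destruct j as [|j]; [rewrite ?sder_mul; seval;
      change (Nat.iter 2 sder ?f) with (sder (sder f));
      change (Nat.iter 3 sder ?f) with (sder (sder (sder f))); ring|]). lia.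
Qed.

(** The one-sided functions [u] and [v] do not change when Dirac terms are added to [phi], so in
    [ode_lhs_sided] these terms meet only [mid_a] and [mid_b]. *)
Lemma ode_lhs_deltas u v c n : ode_lhs a b w (coeff xi u v c n) =
  dadd (ode_lhs a b w (coeff xi u v (fun _ => RtoC 0) 0)) (scalar_dop mid_a mid_b (deltas xi c n)).
Proof.
  unfold a, b. rewrite !(ode_lhs_sided xi w am ap bm bp A B _ u v (sided_coeff _ _ _ _ _)).
  replace (coeff xi u v c n) with (dadd (coeff xi u v (fun _ => RtoC 0) 0) (deltas xi c n)).
  2:{ apply distr_ext. intros t. rewrite dadd_eval, !coeff_eval, deltas_zero_coef. ring. }
  set (phi := coeff xi u v (fun _ => RtoC 0) 0). set (D := deltas xi c n).
  unfold scalar_dop, mid_a, mid_b.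
  assert (M : forall f S T, dmul f (dadd S T) = dadd (dmul f S) (dmul f T))
    by (intros f S T; now apply distr_ext).
  assert (E : forall S T, dscal (- w ^ 2)%C (dadd S T) = dadd (dscal (- w ^ 2)%C S) (dscal (- w ^ 2)%C T)).
  { intros S T. apply distr_ext. intros t. deval. ring. }
  apply distr_ext. intros t.
  rewrite !dderiv_add, !M, !dderiv_add, !dadd_eval, !dscal_eval, !dadd_eval.
  rewrite <- (dmul_dmul (csmooth (w ^ 2))), dmul_const, dscal_eval. ring.
Qed.

Hypothesis mid_nz : mid_a xi <> RtoC 0.
Hypothesis left_nz : forall x, left_a x <> RtoC 0.
Hypothesis right_nz : forall x, right_a x <> RtoC 0.

Theorem ode_solutions phi : (Aspace phi /\ ode_lhs a b w phi = dzero) <->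
  exists u v, phi = coeff xi u v (fun _ => RtoC 0) 0 /\
    (forall x, scalar_op left_a left_b u x = RtoC 0) /\
    (forall x, scalar_op right_a right_b v x = RtoC 0) /\
    forall j, (j <= 3)%nat -> jump u v j = RtoC 0.
Proof.
  split.
  - intros [HA HO].
    destruct (scalar_regularity left_a left_b left_nz (fun x => x < xi) (xi - 2) (mkposreal _ Rlt_0_1) phi)
      as [u [Hu Au]].
    { apply convex_left. }
    { apply ball_left. }
    { rewrite <- HO. apply agree_sym. exact (ode_lhs_left xi w am ap bm bp A B phi HA). }
    destruct (scalar_regularity right_a right_b right_nz (fun x => xi < x) (xi + 2) (mkposreal _ Rlt_0_1) phi)
      as [v [Hv Av]].
    { apply convex_right. }
    { apply ball_right. }
    { rewrite <- HO. apply agree_sym. exact (ode_lhs_right xi w am ap bm bp A B phi HA). }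
    destruct (sided_Aspace xi phi u v HA (conj Au Av)) as [c [n E]].
    (* The regular part vanishes because [u] and [v] solve their equations on the whole line. *)
    assert (Z : coeff xi (scalar_op left_a left_b u) (scalar_op right_a right_b v) (jump u v) 3 =
      deltas xi (jump u v) 3).
    { apply distr_ext. intros t. rewrite coeff_eval.
      rewrite (distr_zero (reg (H_left xi))), (distr_zero (reg (H_right xi))); [ring| |]; intros x.
      - change (scalar_op right_a right_b v x * t x = 0)%C. rewrite Hv. ring.
      - change (scalar_op left_a left_b u x * t x = 0)%C. rewrite Hu. ring. }
    rewrite E, ode_lhs_deltas, ode_lhs_normal, Z in HO.
    (* The terms of [jump] have order at most 3, below the order [n + 4] of the leading term created
       by [c n]. *)
    assert (N : forall j, (j <= n)%nat -> c j = RtoC 0).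
    { apply (no_deltas xi mid_a mid_b c (jump u v) n mid_nz). rewrite <- HO.
      apply distr_ext. intros t. deval. ring. }
    assert (E0 : phi = coeff xi u v (fun _ => RtoC 0) 0).
    { rewrite E, (coeff_pad0 xi u v n). now apply coeff_ext. }
    exists u, v. repeat split; trivial.
    apply (deltas_independent xi (jump u v) 3).
    rewrite <- HO, <- Z, <- ode_lhs_normal, <- ode_lhs_deltas, <- E. now rewrite <- E0.
  - intros [u [v [-> [Hu [Hv Hj]]]]]. split; [apply Aspace_coeff|].
    rewrite ode_lhs_normal. rewrite (coeff_ext xi _ (csmooth 0) _ (csmooth 0) _ (fun _ => RtoC 0) 3 Hu Hv Hj).
    rewrite <- (coeff_reg xi (csmooth 0) 3).
    replace (csmooth 0) with (smul (csmooth 0) (csmooth 1)) by (apply smooth_ext; intros x; seval; ring).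
    rewrite <- dmul_reg, dmul_const. apply distr_ext. intros t. deval. ring.
Qed.

End Jump.

(** Any smooth representative near [x0] coincides with [u] or [v] on a smaller interval and
    therefore has the same derivatives at [x0]. *)
Lemma bc_iff xi phi u v x0 (Cbar : matrix.matrix C 4 1) (c : nat -> C) (side : x0 < xi \/ xi < x0) :
  (forall i, matrix.fun_of_matrix Cbar i fintype.ord0 = c (fintype.nat_of_ord i)) ->
  phi = coeff xi u v (fun _ => RtoC 0) 0 ->
  satisfies_bc x0 Cbar phi <->
  forall i, (i < 4)%nat -> Nat.iter i sder (if Rlt_dec x0 xi then u else v) x0 = c i.
Proof.
  intros Hc E.
  destruct (sided_coeff xi u v (fun _ => RtoC 0) 0) as [S1 S2]. rewrite <- E in S1, S2.
  set (f0 := if Rlt_dec x0 xi then u else v).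
  assert (L : exists al be, al < x0 < be /\ agree (fun y => al < y < be) phi (reg (pw_of_smooth f0))).
  { unfold f0. destruct (Rlt_dec x0 xi) as [H|H].
    - exists (x0 - 1), xi. split; [lra|]. apply agree_sub with (2 := S1). intros y Hy. lra.
    - exists xi, (x0 + 1). split; [lra|]. apply agree_sub with (2 := S2). intros y Hy. lra. }
  destruct L as [al [be [Hx L]]]. split.
  - intros [al' [be' [Hx' [f [Hf Hj]]]]] i Hi. apply agree_eq_on in Hf.
    destruct (interval_inter _ _ _ _ x0 Hx Hx') as [a' [b' [Hab I]]].
    assert (Ef : forall y, a' < y < b' -> f y = f0 y).
    { apply smooth_agree_on. apply agree_trans with phi.
      - apply agree_sym. apply agree_sub with (2 := Hf). intros y Hy. now apply I.
      - apply agree_sub with (2 := L). intros y Hy. now apply I. }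
    rewrite <- (sder_n_ext_on f f0 a' b' i Ef x0 Hab), <- Cderive_n_sder.
    assert (Hi' : is_true (ssrnat.leq (S i) 4)) by exact (ssrbool.introT (@ssrnat.ltP i 4) Hi).
    specialize (Hj (fintype.Ordinal Hi')). rewrite Hc in Hj. exact Hj.
  - intros H. exists al, be. split; trivial. exists f0. split; [now apply agree_eq_on|].
    intros i. rewrite Hc, Cderive_n_sder. apply H. exact (ssrbool.elimT (@ssrnat.ltP _ _) (fintype.ltn_ord i)).
Qed.

(** The distribution determines [u] on the left and [v] on the right of [xi]; one-sided continuity
    carries the derivatives to [xi] itself. This makes the parametrisation of solutions by a jet
    injective. *)
Lemma coeff_right_unique xi u v u' v' : coeff xi u v (fun _ => RtoC 0) 0 = coeff xi u' v' (fun _ => RtoC 0) 0 ->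
  forall i, Nat.iter i sder u xi = Nat.iter i sder u' xi /\ Nat.iter i sder v xi = Nat.iter i sder v' xi.
Proof.
  intros E i.
  destruct (sided_coeff xi u v (fun _ => RtoC 0) 0) as [S1 S2].
  destruct (sided_coeff xi u' v' (fun _ => RtoC 0) 0) as [S1' S2']. rewrite <- E in S1', S2'. split.
  - apply (smooth_eq_left_closure _ _ (xi - 1)); [lra|]. apply sder_n_ext_on.
    apply smooth_agree_on. apply agree_sub with (fun x => x < xi); [intros y Hy; lra|].
    apply agree_trans with (2 := S1'). now apply agree_sym.
  - apply (smooth_eq_right_closure _ _ _ (xi + 1)); [lra|]. apply sder_n_ext_on.
    apply smooth_agree_on. apply agree_sub with (fun x => xi < x); [intros y Hy; lra|].
    apply agree_trans with (2 := S2'). now apply agree_sym.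
Qed.

(** * Matrix form of the jump conditions *)

Section JumpRows.
Variables (xi : R) (w : C) (am ap : nat -> smooth) (A B : nat -> nat -> C) (u v : smooth).
Local Open Scope C_scope.

Let J := jump xi w am ap A B u v.
Let a := fun_a am ap.
Let a' := Cderive_n a 1 xi.
Let a_m := fun_am am.
Let a_m' := Cderive_n a_m 1 xi.
Let a_p := fun_ap ap.
Let a_p' := Cderive_n a_p 1 xi.
Let U i := Nat.iter i sder u xi.
Let V i := Nat.iter i sder v xi.

Ltac expand := unfold J, jump, jump_a, jump_b, mul_jet;
  change (Nat.iter 2 sder u xi) with (U 2); change (Nat.iter 3 sder u xi) with (U 3);
  change (Nat.iter 2 sder v xi) with (V 2); change (Nat.iter 3 sder v xi) with (V 3);
  change (sder (right_a ap) xi) with a_p'; change (right_a ap xi) with (a_p xi);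
  change (sder (left_a am) xi) with a_m'; change (left_a am xi) with (a_m xi);
  change (sder (mid_a am ap) xi) with a'; change (mid_a am ap xi) with (a xi);
  change (sder (sder (sder u)) xi) with (U 3); change (sder (sder u) xi) with (U 2);
  change (sder u xi) with (U 1); change (u xi) with (U 0);
  change (sder (sder (sder v)) xi) with (V 3); change (sder (sder v) xi) with (V 2);
  change (sder v xi) with (V 1); change (v xi) with (V 0).

(** This and the next three identities write out the rows of [matB V - matA U] as the expanded
    matrix products have them, hence the leading 0 and the terms with factor 0. *)
Lemma jump_0 : J 0 =
  0 + - B 0 0 * w ^ 2 * V 0 + B 0 1 * w ^ 2 * V 1 + (a_p' - B 0 2 * w ^ 2) * V 2
    + (a_p xi + B 0 3 * w ^ 2) * V 3
  - (0 + B 1 0 * w ^ 2 * U 0 + - B 1 1 * w ^ 2 * U 1 + (a_m' + B 1 2 * w ^ 2) * U 2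
    + (a_m xi - B 1 3 * w ^ 2) * U 3).
Proof. expand. ring. Qed.

Lemma jump_1 : J 1 =
  0 + - B 0 1 * w ^ 2 * V 0 + 2 * B 0 2 * w ^ 2 * V 1 + (a_p xi - 3 * B 0 3 * w ^ 2) * V 2 + 0 * V 3
  - (0 + B 1 1 * w ^ 2 * U 0 + - 2 * B 1 2 * w ^ 2 * U 1 + (a_m xi + 3 * B 1 3 * w ^ 2) * U 2 + 0 * U 3).
Proof. expand. replace (RtoC (-2)) with (- RtoC 2) by (rewrite <- RtoC_opp; f_equal; ring). ring. Qed.

Lemma jump_2 : J 2 =
  0 + (- a' - B 0 2 * w ^ 2) * V 0 + (a xi + 3 * B 0 3 * w ^ 2) * V 1 + A 0 0 * V 2 + - A 0 1 * V 3
  - (0 + (- a' + B 1 2 * w ^ 2) * U 0 + (a xi - 3 * B 1 3 * w ^ 2) * U 1 + - A 1 0 * U 2 + A 1 1 * U 3).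
Proof. expand. ring. Qed.

Lemma jump_3 : J 3 =
  0 + (a xi - B 0 3 * w ^ 2) * V 0 + 0 * V 1 + A 0 1 * V 2 + 0 * V 3
  - (0 + (a xi + B 1 3 * w ^ 2) * U 0 + 0 * U 1 + - A 1 1 * U 2 + 0 * U 3).
Proof. expand. ring. Qed.

End JumpRows.

(** * The determinant criterion *)

Section Final.
Import all_boot all_algebra.
Import GRing.Theory.
Open Scope ring_scope.

(** If [P] is singular, adding a kernel vector to a solution [y] gives another one, and injectivity
    keeps their images distinct; so unique existence fails for every [d]. Here [Phi] will send the
    undetermined jet at [xi] to the glued distribution. *)
Lemma unique_preimage_iff_det (F : fieldType) (n : nat) (T : Type) (Phi : 'cV[F]_n -> T)
    (S : T -> Prop) (P : 'M[F]_n) (d : 'cV[F]_n) :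
  injective Phi -> (forall phi, S phi <-> exists y, phi = Phi y /\ P *m y = d) ->
  (exists! phi, S phi) <-> \det P <> 0.
Proof.
  move=> inj HS; split.
  - move=> [phi [/HS [y [-> Hy]] U]] det0.
    (* [det0P] produces a row vector of the left kernel, so it is applied to the transpose. *)
    have /det0P [z nz Hz] : \det P^T == 0 by rewrite det_tr det0.
    have Hz' : P *m z^T = 0 by rewrite -[LHS]trmxK trmx_mul trmxK Hz trmx0.
    have : Phi y = Phi (y + z^T).
    { apply: U. apply/HS. exists (y + z^T); split=> //. by rewrite mulmxDr Hz' addr0. }
    move/inj/esym/eqP. rewrite -subr_eq0 addrC addKr.
    by rewrite -[z^T == 0](inj_eq (can_inj (@trmxK _ _ _))) trmxK trmx0 (negPf nz).
  - move=> /eqP detP. have uP : P \in unitmx by rewrite unitmxE unitfE.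
    exists (Phi (invmx P *m d)); split.
    + apply/HS. exists (invmx P *m d). by rewrite mulKVmx.
    + move=> phi /HS [y [-> Hy]]. by rewrite -Hy mulKmx.
Qed.

Definition jets (u : smooth) (xi : R) : 'cV[C]_4 := \col_(i < 4) Nat.iter i sder u xi.

Lemma jump_matrix xi w am ap A B u v (j : 'I_4) :
  jump xi w am ap A B u v j =
  (matB am ap A B w xi *m jets v xi - matA am ap A B w xi *m jets u xi) j ord0.
Proof.
  rewrite !mxE !big_ord_recr !big_ord0 /= !mxE /=.
  case: j => [[|[|[|[|//]]]] Hj] /=.
  - exact: jump_0.
  - exact: jump_1.
  - exact: jump_2.
  - exact: jump_3.
Qed.

Lemma jump_zero_iff xi w am ap A B u v :
  (forall j, (j <= 3)%coq_nat -> jump xi w am ap A B u v j = 0%C) <->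
  matB am ap A B w xi *m jets v xi = matA am ap A B w xi *m jets u xi.
Proof.
  split=> [H|E j Hj].
  - apply/eqP. rewrite -subr_eq0. apply/eqP/matrixP => i k.
    rewrite [RHS]mxE (ord1 k) -jump_matrix. apply: H. apply/leP. exact: (ltn_ord i).
  - have Hj' : (j < 4)%N by apply/leP; lia.
    by rewrite (jump_matrix xi w am ap A B u v (Ordinal Hj')) E subrr mxE.
Qed.

Lemma jets_eq u v xi : jets u xi = jets v xi <->
  forall i, (i < 4)%coq_nat -> Nat.iter i sder u xi = Nat.iter i sder v xi.
Proof.
  split=> [/matrixP E i /ltP Hi|H].
  - by have := E (Ordinal Hi) ord0; rewrite !mxE.
  - apply/matrixP => i j. rewrite !mxE. apply: H. apply/ltP. exact: ltn_ord.
Qed.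

Lemma scalar_jets (a k : smooth) xi : (forall x, a x <> 0%C) -> forall y : 'cV[C]_4,
  exists u, (forall x, scalar_op a k u x = 0%C) /\ jets u xi = y.
Proof.
  move=> a0 y. case: (scalar_exists a k a0 xi (fun i => y (inord i) ord0)) => u [Hu Hj].
  exists u; split=> //. apply/matrixP => i j.
  rewrite mxE Hj ?inord_val ?(ord1 j) //. apply/ltP. exact: ltn_ord.
Qed.

Lemma bc_jets xi u v x0 (Cbar : 'cV[C]_4) : Rlt x0 xi \/ Rlt xi x0 ->
  satisfies_bc x0 Cbar (coeff xi u v (fun _ => 0%C) 0) <->
  jets (if Rlt_dec x0 xi then u else v) x0 = Cbar.
Proof.
  move=> side.
  rewrite (bc_iff xi _ u v x0 Cbar (fun i => Cbar (inord i) ord0) side _ erefl); last first.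
    by move=> i; rewrite inord_val.
  case: Rlt_dec => _ /=; (split=> [H|<- i /ltP Hi]; last by rewrite mxE inordK);
    by apply/matrixP => i j; rewrite (ord1 j) [LHS]mxE (H i (elimT ltP (ltn_ord i))) inord_val.
Qed.

End Final.

From mathcomp Require Import all_boot all_algebra.

Open Scope R_scope.

Theorem corollary3p4
  (xi0 : R) (w : C)
  (am ap bm bp : nat -> smooth) (A B : nat -> nat -> C)
  (ha : (am 0%nat xi0 + ap 1%nat xi0)%C <> 0%C)
  (ham : forall x : R, (am 0%nat x + am 1%nat x)%C <> 0%C)
  (hap : forall x : R, (ap 0%nat x + ap 1%nat x)%C <> 0%C)
  (x0 : R) (Cbar : 'cV[C]_4) :
  let a := fun i => coeff xi0 (am i) (ap i) (A i) 1 in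
  let b := fun i => coeff xi0 (bm i) (bp i) (B i) 3 in
  let solution := fun phi : distr =>
    Aspace phi /\ ode_lhs a b w phi = dzero /\ satisfies_bc x0 Cbar phi in
  (x0 < xi0 ->
     ((exists! phi : distr, solution phi) <-> (\det (matB am ap A B w xi0) <> 0)%R)) /\
  (xi0 < x0 ->
     ((exists! phi : distr, solution phi) <-> (\det (matA am ap A B w xi0) <> 0)%R)).
Proof.
  move=> a b solution.
  have sol := ode_solutions xi0 w am ap bm bp A B ha ham hap.
  (* [U y] and [V y] are the solutions of the left and right equations with jet [y] at [xi0]. *)
  have [U HU] := choice_function _ _ _ (scalar_jets (left_a am) (left_b w bm) xi0 ham).
  have [V HV] := choice_function _ _ _ (scalar_jets (right_a ap) (right_b w bp) xi0 hap).
  split=> side.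
  (* The boundary condition fixes the left solution [u]; the unknown is the jet [y] of the right
     solution, subject to [matB y = matA (jets u)]. *)
  - have [u [Hu Ju]] := scalar_jets (left_a am) (left_b w bm) x0 ham Cbar.
    apply: (unique_preimage_iff_det _ _ _ (fun y => coeff xi0 u (V y) (fun _ => RtoC 0) 0)
      _ _ (matA am ap A B w xi0 *m jets u xi0)%R).
    + move=> y y' /coeff_right_unique E.
      rewrite -(proj2 (HV y)) -(proj2 (HV y')). apply/jets_eq => i _. exact: (proj2 (E i)).
    + move=> phi; split.
      * move=> [HA [HO]].
        have /sol [u' [v [-> [Hu' [Hv Hj]]]]] := conj HA HO.
        rewrite bc_jets; last by left.
        case: Rlt_dec => //= _ Ju'.
        (* Both solve the left equation with jet [Cbar] at [x0]. *)
        have E : u' = u.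
          by apply: (scalar_unique (left_a am) (left_b w bm) ham x0 _ _ Hu' Hu); apply/jets_eq; rewrite Ju.
        rewrite E in Hj *.
        have Ev : V (jets v xi0) = v.
          by apply: (scalar_unique (right_a ap) (right_b w bp) hap xi0 _ _ (proj1 (HV _)) Hv); apply/jets_eq; exact: (proj2 (HV _)).
        exists (jets v xi0). rewrite Ev. split=> //. exact/jump_zero_iff.
      * move=> [y [-> Hy]].
        have [HA HO] : Aspace (coeff xi0 u (V y) (fun _ => RtoC 0) 0) /\
          ode_lhs a b w (coeff xi0 u (V y) (fun _ => RtoC 0) 0) = dzero.
        { apply/sol. exists u, (V y). split=> //. split=> //. split; first exact: (proj1 (HV y)).
          apply/jump_zero_iff. by rewrite (proj2 (HV y)). }
        split=> //. split=> //. apply/bc_jets; first by left. by case: Rlt_dec.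
  - have [v [Hv Jv]] := scalar_jets (right_a ap) (right_b w bp) x0 hap Cbar.
    have nlt : ~ x0 < xi0 by move=> H; exact: (Rlt_asym _ _ H side).
    (* Now the right solution [v] is fixed, and the jet of the left one is subject to
       [matA y = matB (jets v)]. *)
    apply: (unique_preimage_iff_det _ _ _ (fun y => coeff xi0 (U y) v (fun _ => RtoC 0) 0)
      _ _ (matB am ap A B w xi0 *m jets v xi0)%R).
    + move=> y y' /coeff_right_unique E.
      rewrite -(proj2 (HU y)) -(proj2 (HU y')). apply/jets_eq => i _. exact: (proj1 (E i)).
    + move=> phi; split.
      * move=> [HA [HO]].
        have /sol [u [v' [-> [Hu [Hv' Hj]]]]] := conj HA HO.
        rewrite bc_jets; last by right.
        case: Rlt_dec => //= _ Jv'.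
        have E : v' = v.
          by apply: (scalar_unique (right_a ap) (right_b w bp) hap x0 _ _ Hv' Hv); apply/jets_eq; rewrite Jv.
        rewrite E in Hj *.
        have Eu : U (jets u xi0) = u.
          by apply: (scalar_unique (left_a am) (left_b w bm) ham xi0 _ _ (proj1 (HU _)) Hu); apply/jets_eq; exact: (proj2 (HU _)).
        exists (jets u xi0). rewrite Eu. split=> //. by symmetry; exact/jump_zero_iff.
      * move=> [y [-> Hy]].
        have [HA HO] : Aspace (coeff xi0 (U y) v (fun _ => RtoC 0) 0) /\
          ode_lhs a b w (coeff xi0 (U y) v (fun _ => RtoC 0) 0) = dzero.
        { apply/sol. exists (U y), v. split=> //. split; first exact: (proj1 (HU y)). split=> //.
          apply/jump_zero_iff. by rewrite (proj2 (HU y)). }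
        split=> //. split=> //. apply/bc_jets; first by right. by case: Rlt_dec.
Qed.
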